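(* Let $(E,q,L)$ be a quadratic form of rank $n$ on a scheme $S$. The even Clifford algebras $\mathcal C_0$ (defined as a quotient of the tensor algebra of $E\otimes E\otimes L^\vee$) and $\mathcal B_0$ (defined, following Kuznetsov, as a colimit of twisted graded pieces of the homogeneous Clifford algebra) are isomorphic $\mathcal O_S$-algebras.
   Context: A (line bundle-valued) quadratic form $(E,q,L)$ of rank $n$ on $S$ is a vector bundle $E$ of rank $n$, a line bundle $L$, and a map of sheaves $q:E\to L$ with $q(av)=a^2q(v)$ and $b_q(v,w)=q(v+w)-q(v)-q(w)$ bilinear; equivalently an $\mathcal O_S$-module morphism (also denoted $q$) $S_2E\to L$, $v\otimes v\mapsto q(v)$, where $S_2E\subset E\otimes E$ is the submodule of symmetric tensor squares. First construction: $\mathcal C_0=T(E\otimes E\otimes L^\vee)/(J_1+J_2)$, where $J_1,J_2$ are the ideals generated respectively by $v\otimes v\otimes f-f(q(v))$ and $u\otimes v\otimes f\otimes v\otimes w\otimes g-f(q(v))\,u\otimes w\otimes g$ for sections $u,v,w$ of $E$ and $f,g$ of $L^\vee$. Second construction: let $\mathfrak B=T(E)/I=\bigoplus_{i\ge0}\mathfrak B_i$ (the homogeneous Clifford algebra) be the graded quotient of the tensor algebra by the homogeneous two-sided ideal generated by $I_2=\ker(q:S_2E\to L)\subset T^2(E)$. In the source, $\mathfrak B_2$ is taken to fit into an exact sequence $0\to L\to\mathfrak B_2\to\bigwedge^2E\to0$ of locally free $\mathcal O_S$-modules, receiving a map from $0\to S_2E\to T^2(E)\to\bigwedge^2E\to0$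 given by $q$ on $S_2E$, the quotient map on $T^2(E)$, and the identity on $\bigwedge^2E$. The subbundle $L\subset\mathfrak B_2$ is central in $\mathfrak B$, and multiplication by it gives canonical morphisms $\mathfrak B_i\otimes L\to\mathfrak B_{i+2}$ for all $i\ge0$, hence $\mathfrak B_{2m}\otimes(L^\vee)^{\otimes m}\to\mathfrak B_{2(m+1)}\otimes(L^\vee)^{\otimes(m+1)}$ for all $m\ge0$. Then $\mathcal B_0=\varinjlim_m\mathfrak B_{2m}\otimes(L^\vee)^{\otimes m}$, with algebra structure induced from $\mathfrak B$.
   Formalization: The exact sequence 0→L→B_2→∧²E→0, compatible with q on S_2E, is assumed as explicit data; it exists exactly when q: S_2E→L is surjective. For other forms (e.g. q=0) L does not embed in B_2 and B_0 as defined is meaningless. *)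

(* Defs.v *)
From HB Require Import structures.
From mathcomp Require Import all_boot all_algebra.
From mathcomp Require Import all_classical topology.

Set Implicit Arguments.
Unset Strict Implicit.
Unset Printing Implicit Defensive.
Set Warnings "-redundant-canonical-projection".

Import GRing.Theory.
Local Open Scope classical_set_scope.
Local Open Scope ring_scope.

(* Definite description: the element satisfying P if there is one, else x0. *)
Definition the (T : Type) (x0 : T) (P : T -> Prop) : T :=
  match pselect (exists x, P x) with
  | left h => projT1 (cid h)
  | right _ => x0
  end.

Record opn (X : topologicalType) := Opn { oset :> X -> Prop; oset_open : open oset }.

Notation "V <<= U" := (oset V `<=` oset U) (at level 70, no associativity).

Definition oI (X : topologicalType) (U V : opn X) : opn X :=
  Opn (openI (oset_open U) (oset_open V)).

Record rpsh (X : topologicalType) := RPsh {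
  rsec :> opn X -> comPzRingType;
  rres : forall U V : opn X, V <<= U -> {rmorphism rsec U -> rsec V};
  rres_id : forall U (h : U <<= U) a, rres h a = a;
  rres_comp : forall U V W (h : V <<= U) (k : W <<= V) (l : W <<= U) a,
    rres k (rres h a) = rres l a }.

(* The index type I may be empty, so sections over the empty set are unique. *)
Definition sheaf_axiom (X : topologicalType) (F : opn X -> Type)
    (res : forall U V : opn X, V <<= U -> F U -> F V) : Prop :=
  forall (U : opn X) (I : Type) (C : I -> opn X) (CU : forall i, C i <<= U),
    (forall x, U x -> exists i, C i x) ->
  forall s : forall i, F (C i),
    (forall i j W (hi : W <<= C i) (hj : W <<= C j),
       res _ _ hi (s i) = res _ _ hj (s j)) ->
  exists! t : F U, forall i, res _ _ (CU i) t = s i.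

Definition prime_ideal (A : comPzRingType) (P : set A) : Prop :=
  [/\ P 0, forall a b, P a -> P b -> P (a + b),
      forall a b, P b -> P (a * b),
      ~ P 1 & forall a b, P (a * b) -> P a \/ P b].

(* g : A -> B identifies B with the localization of A at the powers of f. *)
Definition localization_at (A B : comPzRingType) (g : A -> B) (f : A) : Prop :=
  [/\ exists b, b * g f = 1,
      forall b, exists n a, g f ^+ n * b = g a &
      forall a, g a = 0 -> exists n, f ^+ n * a = 0].

(* (U, O|U) is isomorphic to Spec A: h is a homeomorphism of U onto the prime
   spectrum with its Zariski topology, and the structure sheaf is the one
   determined by its values A_f on the basic opens D(f) = {P | f \notin P}.
   As D(1) = Spec A, phi itself is then an isomorphism.  *)
Definition affine (X : topologicalType) (O : rpsh X) (U : opn X) : Prop :=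
  exists (A : comPzRingType) (phi : {rmorphism A -> O U}) (h : X -> set A),
  [/\ forall x, U x -> prime_ideal (h x),
      forall x y, U x -> U y -> h x = h y -> x = y,
      forall P, prime_ideal P -> exists2 x, U x & h x = P,
      forall V : set X, V `<=` oset U ->
        (open V <-> forall x, V x ->
           exists2 f, ~ h x f & forall y, U y -> ~ h y f -> V y) &
      forall f (V : opn X) (k : V <<= U), (forall y, V y <-> U y /\ ~ h y f) ->
        localization_at (fun a => rres O k (phi a)) f].

Record scheme := Scheme {
  space :> topologicalType;
  OS : rpsh space;
  OS_sheaf : sheaf_axiom (fun U V (h : V <<= U) => rres OS h);
  OS_affine : forall x : space, exists2 U : opn space, U x & affine OS U }.

Record mpsh (X : topologicalType) (O : rpsh X) := MPsh {
  msec :> forall U : opn X, lmodType (O U);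
  mres : forall U V : opn X, V <<= U -> msec U -> msec V;
  mres_lin : forall U V (h : V <<= U) a (x y : msec U),
    mres h (a *: x + y) = rres O h a *: mres h x + mres h y;
  mres_id : forall U (h : U <<= U) x, mres h x = x;
  mres_comp : forall U V W (h : V <<= U) (k : W <<= V) (l : W <<= U) x,
    mres k (mres h x) = mres l x }.

Section Modules.
Variables (X : topologicalType) (O : rpsh X).
Implicit Types M N : mpsh O.

Definition is_sheaf M : Prop := sheaf_axiom (mres (m := M)).

Definition locally_free (n : nat) M : Prop :=
  forall x : X, exists (U : opn X) (e : 'I_n -> M U), U x /\
    forall V (h : V <<= U) (s : M V),
      exists! c : {ffun 'I_n -> O V}, s = \sum_(i < n) c i *: mres h (e i).

Definition vector_bundle (n : nat) M : Prop := is_sheaf M /\ locally_free n M.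
Definition line_bundle M : Prop := vector_bundle 1 M.

Record hom M N := Hom {
  happ :> forall U, M U -> N U;
  hlin : forall U a (x y : M U), happ (a *: x + y) = a *: happ x + happ y;
  hnat : forall U V (h : V <<= U) (x : M U), happ (mres h x) = mres h (happ x) }.

Record alg_struct M := AlgStruct {
  aone : forall U, M U;
  amul : forall U, M U -> M U -> M U;
  amulA : forall U (x y z : M U), amul x (amul y z) = amul (amul x y) z;
  amul1l : forall U (x : M U), amul (aone U) x = x;
  amul1r : forall U (x : M U), amul x (aone U) = x;
  amulDl : forall U a (x y z : M U),
    amul (a *: x + y) z = a *: amul x z + amul y z;
  amulDr : forall U a (x y z : M U),
    amul z (a *: x + y) = a *: amul z x + amul z y;
  ares1 : forall U V (h : V <<= U), mres h (aone U) = aone V;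
  aresM : forall U V (h : V <<= U) (x y : M U),
    mres h (amul x y) = amul (mres h x) (mres h y) }.

Record alg := Alg { amod :> mpsh O; astr : alg_struct amod }.

Definition one (A : alg) (U : opn X) : A U := aone (astr A) U.
Definition mul (A : alg) (U : opn X) (x y : A U) : A U := amul (astr A) x y.

Definition alg_iso (A B : alg) : Prop :=
  exists f : hom A B,
  [/\ forall U, bijective (f U),
      forall U, f U (one A U) = one B U &
      forall U (x y : A U), f U (mul x y) = mul (f U x) (f U y)].

Lemma mresD M U V (h : V <<= U) (x y : M U) :
  mres h (x + y) = mres h x + mres h y.
Proof. by have := mres_lin h 1 x y; rewrite !scale1r rmorph1 scale1r. Qed.

Lemma mres0 M U V (h : V <<= U) : mres h (0 : M U) = 0.
Proof. by apply: (@addrI _ (mres h 0)); rewrite -mresD !addr0. Qed.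

Lemma mresZ M U V (h : V <<= U) a (x : M U) :
  mres h (a *: x) = rres O h a *: mres h x.
Proof. by have := mres_lin h a x 0; rewrite mres0 !addr0. Qed.

Lemma mresB M U V (h : V <<= U) (x y : M U) :
  mres h (x - y) = mres h x - mres h y.
Proof. by rewrite -scaleN1r mresD mresZ rmorphN1 scaleN1r. Qed.

Lemma hom0_subproof M N U (a : O U) (x y : M U) : 0 = a *: 0 + 0 :> N U.
Proof. by rewrite scaler0 addr0. Qed.

Lemma hom0_subproof' M N U V (h : V <<= U) (x : M U) : 0 = mres h (0 : N U).
Proof. by rewrite mres0. Qed.

Definition hom0 M N : hom M N :=
  @Hom M N (fun U _ => 0) (@hom0_subproof M N) (@hom0_subproof' M N).

End Modules.

(* A presheaf of modules presented by "raw" sections up to an equivalence. *)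
Record rawmod (X : topologicalType) (O : rpsh X) := RawMod {
  raw :> opn X -> Type;
  wres : forall U V : opn X, V <<= U -> raw U -> raw V;
  weq : forall U, raw U -> raw U -> Prop;
  wzero : forall U, raw U;
  wadd : forall U, raw U -> raw U -> raw U;
  wscale : forall U, O U -> raw U -> raw U;
  weq_refl : forall U (x : raw U), weq x x;
  weq_sym : forall U (x y : raw U), weq x y -> weq y x;
  weq_trans : forall U (x y z : raw U), weq x y -> weq y z -> weq x z;
  weq_add : forall U (x x' y y' : raw U),
    weq x x' -> weq y y' -> weq (wadd x y) (wadd x' y');
  weq_scale : forall U a (x x' : raw U), weq x x' -> weq (wscale a x) (wscale a x');
  weq_res : forall U V (h : V <<= U) (x x' : raw U),
    weq x x' -> weq (wres h x) (wres h x');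
  waddA : forall U (x y z : raw U), weq (wadd x (wadd y z)) (wadd (wadd x y) z);
  waddC : forall U (x y : raw U), weq (wadd x y) (wadd y x);
  wadd0 : forall U (x : raw U), weq (wadd (wzero U) x) x;
  waddN : forall U (x : raw U), weq (wadd (wscale (- 1) x) x) (wzero U);
  wscaleA : forall U a b (x : raw U),
    weq (wscale a (wscale b x)) (wscale (a * b) x);
  wscale1 : forall U (x : raw U), weq (wscale 1 x) x;
  wscaleDr : forall U a (x y : raw U),
    weq (wscale a (wadd x y)) (wadd (wscale a x) (wscale a y));
  wscaleDl : forall U a b (x : raw U),
    weq (wscale (a + b) x) (wadd (wscale a x) (wscale b x));
  wres_id : forall U (h : U <<= U) (x : raw U), weq (wres h x) x;
  wres_comp : forall U V W (h : V <<= U) (k : W <<= V) (l : W <<= U) (x : raw U),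
    weq (wres k (wres h x)) (wres l x);
  wres0 : forall U V (h : V <<= U), weq (wres h (wzero U)) (wzero V);
  wresD : forall U V (h : V <<= U) (x y : raw U),
    weq (wres h (wadd x y)) (wadd (wres h x) (wres h y));
  wresZ : forall U V (h : V <<= U) a (x : raw U),
    weq (wres h (wscale a x)) (wscale (rres O h a) (wres h x)) }.

Section Sheafify.
Variables (X : topologicalType) (O : rpsh X) (P : rawmod O).
Implicit Types U V W : opn X.

Definition locally U (Q : forall W, W <<= U -> Prop) : Prop :=
  forall x, U x -> exists W (h : W <<= U), W x /\ Q W h.

Definition loc_eq U (s t : P U) : Prop :=
  locally (fun W (h : W <<= U) => weq (wres h s) (wres h t)).

(* A section over U of the sheaf associated with P is given by the set of all
   its local representatives: [rep V t] says that V is contained in U and that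
   the section restricts on V to the image of t in the associated sheaf.  Equality
   of such sets is equality of sections. *)
Record shsec U := ShSec {
  rep : forall V, P V -> Prop;
  rep_sub : forall V (t : P V), rep t -> V <<= U;
  rep_ex : forall x, U x -> exists V (t : P V), V x /\ rep t;
  rep_uniq : forall V (s t : P V), rep s -> rep t -> loc_eq s t;
  rep_res : forall V W (h : W <<= V) (t : P V), rep t -> rep (wres h t);
  rep_loc : forall V (t : P V), V <<= U ->
    locally (fun W (h : W <<= V) => exists2 t' : P W, rep t' & weq (wres h t) t') ->
    rep t }.

HB.instance Definition _ U := gen_eqMixin (shsec U).
HB.instance Definition _ U := gen_choiceMixin (shsec U).

Lemma oI_l U V : oI U V <<= U. Proof. by move=> x []. Qed.
Lemma oI_r U V : oI U V <<= V. Proof. by move=> x []. Qed.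

Lemma sub_refl U : U <<= U. Proof. by []. Qed.

Lemma weq_resres U V V' W (h : V <<= U) (k : W <<= V) (h' : V' <<= U)
    (k' : W <<= V') (x : P U) :
  weq (wres k (wres h x)) (wres k' (wres h' x)).
Proof.
have l : W <<= U by move=> y /k /h.
by apply: (weq_trans (wres_comp h k l x) _); apply: weq_sym; apply: wres_comp.
Qed.

Lemma loc_eq_refl U (s : P U) : loc_eq s s.
Proof. by move=> x Ux; exists U, (@sub_refl U); split=> //; exact: weq_refl. Qed.

Lemma weq_loc U (s t : P U) : weq s t -> loc_eq s t.
Proof.
by move=> e x Ux; exists U, (@sub_refl U); split=> //; exact: weq_res.
Qed.

Lemma loc_eq_sym U (s t : P U) : loc_eq s t -> loc_eq t s.
Proof.
move=> e x Ux; have [W [h [Wx ew]]] := e x Ux.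
by exists W, h; split=> //; exact: weq_sym.
Qed.

Lemma loc_eq_trans U (s t r : P U) : loc_eq s t -> loc_eq t r -> loc_eq s r.
Proof.
move=> e f x Ux; have [W [h [Wx ew]]] := e x Ux; have [W' [h' [Wx' ew']]] := f x Ux.
have l : oI W W' <<= U by move=> y [] /h.
exists (oI W W'), l; split=> //.
apply: (weq_trans (weq_sym (wres_comp h (@oI_l W W') l s)) _).
apply: (weq_trans (weq_res (@oI_l W W') ew) _).
apply: (weq_trans (weq_resres h _ h' (@oI_r W W') t) _).
apply: (weq_trans (weq_res (@oI_r W W') ew') _).
exact: wres_comp.
Qed.

Lemma loc_eq_res U V (h : V <<= U) (s t : P U) :
  loc_eq s t -> loc_eq (wres h s) (wres h t).
Proof.
move=> e x Vx; have [W [k [Wx ew]]] := e x (h x Vx).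
exists (oI V W), (@oI_l V W); split=> //.
apply: (weq_trans (weq_resres h _ k (@oI_r V W) s) _).
apply: (weq_trans (weq_res _ ew) _); exact: weq_resres.
Qed.

Lemma rep_eqv U (F : shsec U) V (s t : P V) : loc_eq s t -> rep F t -> rep F s.
Proof.
move=> e Ft; apply: rep_loc; first exact: (rep_sub Ft).
move=> x Vx; have [W [h [Wx ew]]] := e x Vx.
by exists W, h; split=> //; exists (wres h t) => //; exact: rep_res.
Qed.

Lemma rep_weq U (F : shsec U) V (s t : P V) : rep F t -> weq s t -> rep F s.
Proof. by move=> Ft /weq_loc e; exact: (rep_eqv e Ft). Qed.

Lemma shsec_eq U (F G : shsec U) :
  (forall x, U x -> exists V (t : P V), [/\ V x, rep F t & rep G t]) -> F = G.
Proof.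
move=> H.
have incl (F' G' : shsec U) :
    (forall x, U x -> exists V (t : P V), [/\ V x, rep F' t & rep G' t]) ->
    forall V (t : P V), rep F' t -> rep G' t.
  move=> H' V t Ft; have VU := rep_sub Ft; apply: rep_loc => // x Vx.
  have [W [s [Wx Fs Gs]]] := H' x (VU x Vx).
  have := rep_uniq (rep_res (@oI_l V W) Ft) (rep_res (@oI_r V W) Fs).
  move=> /(_ x (conj Vx Wx)) [W' [k [W'x e]]].
  have hV : W' <<= V by move=> y /k [].
  have hW : W' <<= W by move=> y /k [].
  exists W', hV; split=> //; exists (wres hW s); first exact: rep_res.
  apply: (weq_trans (weq_sym (wres_comp (@oI_l V W) k hV t)) _).
  by apply: (weq_trans e _); exact: wres_comp.
have E : rep F = rep G.
  apply: functional_extensionality_dep => V; apply/funext => t; apply/propext.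
  split; first exact: incl.
  by apply: incl => x Ux; have [V' [t' [? ? ?]]] := H x Ux; exists V', t'.
case: F G E {H} => rF a1 a2 a3 a4 a5 [rG b1 b2 b3 b4 b5] /= E.
by subst rG; congr ShSec; exact: Prop_irrelevance.
Qed.

Lemma shunit_subproof U (s : P U) :
  let r := fun V (t : P V) => exists h : V <<= U, loc_eq t (wres h s) in
  [/\ forall V (t : P V), r V t -> V <<= U,
   forall x, U x -> exists V (t : P V), V x /\ r V t,
   forall V (s t : P V), r V s -> r V t -> loc_eq s t,
   forall V W (h : W <<= V) (t : P V), r V t -> r W (wres h t) &
   forall V (t : P V), V <<= U ->
    locally (fun W (h : W <<= V) => exists2 t' : P W, r W t' & weq (wres h t) t') ->
    r V t].
Proof.
move=> r; split.
- by move=> V t [].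
- move=> x Ux; exists U, s; split=> //; exists (@sub_refl U).
  by apply: weq_loc; apply: weq_sym; exact: wres_id.
- move=> V t t' [h e] [h' e']; apply: (loc_eq_trans e _); apply: loc_eq_sym.
  by rewrite (Prop_irrelevance h h').
- move=> V W h t [k e]; have l : W <<= U by move=> y /h /k.
  exists l; apply: (loc_eq_trans (loc_eq_res h e) _); apply: weq_loc; exact: wres_comp.
- move=> V t VU H; exists VU => x Vx.
  have [W [h [Wx [t' [k e] ew]]]] := H x Vx.
  have [W' [h' [W'x e']]] := e x Wx.
  have l : W' <<= V by move=> y /h' /h.
  exists W', l; split=> //.
  apply: (weq_trans (weq_sym (wres_comp h h' l t)) _).
  apply: (weq_trans (weq_res h' ew) _); apply: (weq_trans e' _); exact: weq_resres.
Qed.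

Definition shunit U (s : P U) : shsec U :=
  let: And5 a1 a2 a3 a4 a5 := shunit_subproof s in ShSec a1 a2 a3 a4 a5.

Lemma rep_shunit U (s : P U) V (t : P V) :
  rep (shunit s) t <-> exists h : V <<= U, loc_eq t (wres h s).
Proof. by rewrite /shunit; case: (shunit_subproof s). Qed.

Lemma rep_shunitP U (s : P U) : rep (shunit s) s.
Proof.
apply/rep_shunit; exists (@sub_refl U); apply: weq_loc; apply: weq_sym.
exact: wres_id.
Qed.

Section Lift.
Variables (U : opn X) (op : forall V, V <<= U -> P V -> P V -> P V).
Hypothesis op_eq : forall V (h : V <<= U) x x' y y',
  weq x x' -> weq y y' -> weq (op h x y) (op h x' y').
Hypothesis op_res : forall V W (h : V <<= U) (k : W <<= V) (l : W <<= U) x y,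
  weq (wres k (op h x y)) (op l (wres k x) (wres k y)).

Lemma op_loc V (h : V <<= U) x x' y y' :
  loc_eq x x' -> loc_eq y y' -> loc_eq (op h x y) (op h x' y').
Proof.
move=> e f z Vz; have [W [k [Wz ew]]] := e z Vz; have [W' [k' [Wz' ew']]] := f z Vz.
have l : oI W W' <<= V by move=> u [] /k.
have m : oI W W' <<= U by move=> u /l /h.
exists (oI W W'), l; split=> //.
apply: (weq_trans (op_res h l m x y) _).
apply: (weq_trans _ (weq_sym (op_res h l m x' y'))).
apply: op_eq.
  apply: (weq_trans (weq_sym (wres_comp k (@oI_l _ _) l x)) _).
  apply: (weq_trans (weq_res _ ew) _); exact: wres_comp.
apply: (weq_trans (weq_sym (wres_comp k' (@oI_r _ _) l y)) _).
apply: (weq_trans (weq_res _ ew') _); exact: wres_comp.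
Qed.

Lemma shlift_subproof (F G : shsec U) :
  let r := fun V (t : P V) => exists hV : V <<= U,
     locally (fun W (h : W <<= V) => exists (k : W <<= U) (x y : P W),
       [/\ rep F x, rep G y & weq (wres h t) (op k x y)]) in
  [/\ forall V (t : P V), r V t -> V <<= U,
   forall x, U x -> exists V (t : P V), V x /\ r V t,
   forall V (s t : P V), r V s -> r V t -> loc_eq s t,
   forall V W (h : W <<= V) (t : P V), r V t -> r W (wres h t) &
   forall V (t : P V), V <<= U ->
    locally (fun W (h : W <<= V) => exists2 t' : P W, r W t' & weq (wres h t) t') ->
    r V t].
Proof.
move=> r; split.
- by move=> V t [].
- move=> x Ux; have [V [s [Vx Fs]]] := rep_ex F Ux.
  have [W [t [Wx Gt]]] := rep_ex G Ux.
  have k : oI V W <<= U by move=> y [/(rep_sub Fs)].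
  exists (oI V W), (op k (wres (@oI_l V W) s) (wres (@oI_r V W) t)); split=> //.
  exists k => y Vy; exists (oI V W), (@sub_refl _); split=> //.
  exists k, (wres (@oI_l V W) s), (wres (@oI_r V W) t).
  by split; [exact: rep_res|exact: rep_res|exact: wres_id].
- move=> V s t [hV Hs] [_ Ht] z Vz.
  have [W [h [Wz [k [x [y [Fx Gy e]]]]]]] := Hs z Vz.
  have [W' [h' [Wz' [k' [x' [y' [Fx' Gy' e']]]]]]] := Ht z Vz.
  set I := oI W W'; have l : I <<= U by move=> u [/k].
  have := op_loc l (rep_uniq (rep_res (@oI_l W W') Fx) (rep_res (@oI_r W W') Fx'))
                   (rep_uniq (rep_res (@oI_l W W') Gy) (rep_res (@oI_r W W') Gy')).
  move=> /(_ z (conj Wz Wz')) [J [j [Jz eJ]]].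
  have jV : J <<= V by move=> u /j [/h].
  have jW : J <<= W by move=> u /j [].
  have jW' : J <<= W' by move=> u /j [].
  have jU : J <<= U by move=> u /j /l.
  exists J, jV; split=> //.
  apply: (weq_trans (weq_sym (wres_comp h jW jV s)) _).
  apply: (weq_trans _ (wres_comp h' jW' jV t)).
  apply: (weq_trans (weq_res jW e) _).
  apply: (weq_trans _ (weq_sym (weq_res jW' e'))).
  apply: (weq_trans (weq_sym (wres_comp (@oI_l W W') j jW _)) _).
  apply: (weq_trans _ (wres_comp (@oI_r W W') j jW' _)).
  apply: (weq_trans (weq_res j (op_res k (@oI_l W W') l x y)) _).
  apply: (weq_trans _ (weq_res j (weq_sym (op_res k' (@oI_r W W') l x' y')))).
  exact: eJ.
- move=> V W h t [hV Ht]; have l : W <<= U by move=> u /h /hV.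
  exists l => z Wz; have [J [j [Jz [k [x [y [Fx Gy e]]]]]]] := Ht z (h z Wz).
  have m : oI W J <<= U by move=> u [/l].
  exists (oI W J), (@oI_l W J); split=> //.
  exists m, (wres (@oI_r W J) x), (wres (@oI_r W J) y).
  split; [exact: rep_res|exact: rep_res|].
  apply: (weq_trans (weq_resres h _ j (@oI_r W J) t) _).
  by apply: (weq_trans (weq_res _ e) _); exact: op_res.
- move=> V t VU H; exists VU => z Vz.
  have [W [h [Wz [t' [hW Ht'] e]]]] := H z Vz.
  have [J [j [Jz [k [x [y [Fx Gy e']]]]]]] := Ht' z Wz.
  have l : J <<= V by move=> u /j /h.
  exists J, l; split=> //; exists k, x, y; split=> //.
  apply: (weq_trans (weq_sym (wres_comp h j l t)) _).
  by apply: (weq_trans (weq_res _ e) _).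
Qed.

Definition shlift (F G : shsec U) : shsec U :=
  let: And5 a1 a2 a3 a4 a5 := shlift_subproof F G in ShSec a1 a2 a3 a4 a5.

Lemma rep_shlift (F G : shsec U) V (k : V <<= U) (x y t : P V) :
  rep F x -> rep G y -> weq t (op k x y) -> rep (shlift F G) t.
Proof.
move=> Fx Gy e; rewrite /shlift; case: (shlift_subproof F G) => /= *.
exists k => z Vz; exists V, (@sub_refl V); split=> //.
by exists k, x, y; split=> //; exact: (weq_trans (wres_id _ _) e).
Qed.

End Lift.

Lemma shadd_res U V W (h : V <<= U) (k : W <<= V) (l : W <<= U) (x y : P V) :
  weq (wres k (wadd x y)) (wadd (wres k x) (wres k y)).
Proof. exact: wresD. Qed.

Definition shadd U (F G : shsec U) : shsec U :=
  shlift (op := fun V _ x y => wadd x y)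
    (fun V _ x x' y y' => @weq_add _ _ P V x x' y y') (@shadd_res U) F G.

Lemma shscale_eq U (a : O U) V (h : V <<= U) (x x' y y' : P V) :
  weq x x' -> weq y y' -> weq (wscale (rres O h a) x) (wscale (rres O h a) x').
Proof. by move=> e _; exact: weq_scale. Qed.

Lemma shscale_res U (a : O U) V W (h : V <<= U) (k : W <<= V) (l : W <<= U)
   (x y : P V) :
  weq (wres k (wscale (rres O h a) x)) (wscale (rres O l a) (wres k x)).
Proof. by apply: (weq_trans (wresZ _ _ _) _); rewrite (rres_comp h k l); exact: weq_refl. Qed.

Definition shscale U (a : O U) (F : shsec U) : shsec U :=
  shlift (op := fun V h x _ => wscale (rres O h a) x)
    (@shscale_eq U a) (@shscale_res U a) F F.

Definition shzero U : shsec U := shunit (wzero P U).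

Lemma rep_add U (F G : shsec U) V (x y t : P V) :
  rep F x -> rep G y -> weq t (wadd x y) -> rep (shadd F G) t.
Proof. by move=> Fx Gy e; exact: (rep_shlift (k := rep_sub Fx) _ _ Fx Gy e). Qed.

Lemma rep_scale U (a : O U) (F : shsec U) V (h : V <<= U) (x t : P V) :
  rep F x -> weq t (wscale (rres O h a) x) -> rep (shscale a F) t.
Proof. by move=> Fx e; exact: (rep_shlift (k := h) _ _ Fx Fx e). Qed.

Lemma rep_zero U V (h : V <<= U) (t : P V) : weq t (wzero P V) -> rep (shzero U) t.
Proof.
move=> e; apply/rep_shunit; exists h; apply: weq_loc; apply: (weq_trans e _).
by apply: weq_sym; exact: wres0.
Qed.

Lemma rep2_ex U (F G : shsec U) x : U x ->
  exists V (s t : P V), [/\ V x, V <<= U, rep F s & rep G t].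
Proof.
move=> Ux; have [V [s [Vx Fs]]] := rep_ex F Ux.
have [W [t [Wx Gt]]] := rep_ex G Ux.
exists (oI V W), (wres (@oI_l V W) s), (wres (@oI_r V W) t).
split=> //; [|exact: rep_res|exact: rep_res].
by move=> y [/(rep_sub Fs)].
Qed.

Lemma rep3_ex U (F G H : shsec U) x : U x ->
  exists V (s t r : P V), [/\ V x, rep F s, rep G t & rep H r].
Proof.
move=> Ux; have [V [s [t [Vx VU Fs Gt]]]] := rep2_ex F G Ux.
have [W [r [Wx Hr]]] := rep_ex H Ux.
exists (oI V W), (wres (@oI_l V W) s), (wres (@oI_l V W) t), (wres (@oI_r V W) r).
by split=> //; exact: rep_res.
Qed.

Lemma shaddA U : associative (@shadd U).
Proof.
move=> F G H; apply: shsec_eq => x Ux.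
have [V [s [t [r [Vx Fs Gt Hr]]]]] := rep3_ex F G H Ux.
exists V, (wadd s (wadd t r)); split=> //.
  apply: (rep_add Fs _ (weq_refl _)); exact: (rep_add Gt Hr (weq_refl _)).
by apply: (rep_add _ Hr (waddA _ _ _)); exact: (rep_add Fs Gt (weq_refl _)).
Qed.

Lemma shaddC U : commutative (@shadd U).
Proof.
move=> F G; apply: shsec_eq => x Ux.
have [V [s [t [Vx _ Fs Gt]]]] := rep2_ex F G Ux.
exists V, (wadd s t); split=> //; first exact: (rep_add Fs Gt (weq_refl _)).
by apply: (rep_add Gt Fs (waddC _ _)).
Qed.

Lemma shadd0 U : left_id (shzero U) (@shadd U).
Proof.
move=> F; apply: shsec_eq => x Ux; have [V [s [Vx Fs]]] := rep_ex F Ux.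
exists V, s; split=> //; apply: (rep_add (x := wzero P V) (y := s)) => //.
  exact: (rep_zero (rep_sub Fs) (weq_refl _)).
by apply: weq_sym; exact: wadd0.
Qed.

Lemma shaddN U : left_inverse (shzero U) (@shscale U (- 1)) (@shadd U).
Proof.
move=> F; apply: shsec_eq => x Ux; have [V [s [Vx Fs]]] := rep_ex F Ux.
have h := rep_sub Fs.
exists V, (wadd (wscale (- 1) s) s); split=> //; last exact: (rep_zero h (waddN _)).
apply: (rep_add _ Fs (weq_refl _)).
by apply: (rep_scale (h := h) Fs _); rewrite rmorphN1; exact: weq_refl.
Qed.

HB.instance Definition _ U :=
  GRing.isZmodule.Build (shsec U) (@shaddA U) (@shaddC U) (@shadd0 U) (@shaddN U).

Lemma shscaleA U (a b : O U) (F : shsec U) :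
  shscale a (shscale b F) = shscale (a * b) F.
Proof.
apply: shsec_eq => x Ux; have [V [s [Vx Fs]]] := rep_ex F Ux.
have h := rep_sub Fs.
exists V, (wscale (rres O h a) (wscale (rres O h b) s)); split=> //.
  apply: (rep_scale (h := h) _ (weq_refl _)).
  exact: (rep_scale (h := h) Fs (weq_refl _)).
by apply: (rep_scale (h := h) Fs _); rewrite rmorphM; exact: wscaleA.
Qed.

Lemma shscale1 U : left_id (1 : O U) (@shscale U).
Proof.
move=> F; apply: shsec_eq => x Ux; have [V [s [Vx Fs]]] := rep_ex F Ux.
have h := rep_sub Fs; exists V, s; split=> //.
apply: (rep_scale (h := h) Fs _); rewrite rmorph1; apply: weq_sym; exact: wscale1.
Qed.

Lemma shscaleDr U : right_distributive (@shscale U) +%R.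
Proof.
move=> a F G; apply: shsec_eq => x Ux.
have [V [s [t [Vx h Fs Gt]]]] := rep2_ex F G Ux.
exists V, (wscale (rres O h a) (wadd s t)); split=> //.
  apply: (rep_scale (h := h) _ (weq_refl _)); exact: (rep_add Fs Gt (weq_refl _)).
apply: (rep_add _ _ (wscaleDr _ _ _)).
  exact: (rep_scale (h := h) Fs (weq_refl _)).
exact: (rep_scale (h := h) Gt (weq_refl _)).
Qed.

Lemma shscaleDl U (F : shsec U) :
  {morph (@shscale U)^~ F : a b / a + b >-> a + b}.
Proof.
move=> a b; apply: shsec_eq => x Ux.
have [V [s [Vx Fs]]] := rep_ex F Ux; have h := rep_sub Fs.
exists V, (wscale (rres O h (a + b)) s); split=> //.
  exact: (rep_scale (h := h) Fs (weq_refl _)).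
rewrite rmorphD; apply: (rep_add _ _ (wscaleDl _ _ _));
  exact: (rep_scale (h := h) Fs (weq_refl _)).
Qed.

HB.instance Definition _ U :=
  GRing.Zmodule_isLmodule.Build (O U) (shsec U) (@shscaleA U) (@shscale1 U)
    (@shscaleDr U) (@shscaleDl U).

Lemma shres_subproof U U' (h : U' <<= U) (F : shsec U) :
  let r := fun V (t : P V) => V <<= U' /\ rep F t in
  [/\ forall V (t : P V), r V t -> V <<= U',
   forall x, U' x -> exists V (t : P V), V x /\ r V t,
   forall V (s t : P V), r V s -> r V t -> loc_eq s t,
   forall V W (h : W <<= V) (t : P V), r V t -> r W (wres h t) &
   forall V (t : P V), V <<= U' ->
    locally (fun W (h : W <<= V) => exists2 t' : P W, r W t' & weq (wres h t) t') ->
    r V t].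
Proof.
move=> r; split.
- by move=> V t [].
- move=> x Ux; have [V [s [Vx Fs]]] := rep_ex F (h x Ux).
  exists (oI V U'), (wres (@oI_l V U') s); split=> //.
  by split; [exact: oI_r|exact: rep_res].
- by move=> V s t [_ Fs] [_ Ft]; exact: (rep_uniq Fs Ft).
- move=> V W k t [VU Ft]; split; last exact: rep_res.
  by move=> u /k /VU.
- move=> V t VU H; split=> //; apply: rep_loc; first by move=> u /VU /h.
  move=> x Vx; have [W [k [Wx [t' [_ Ft'] e]]]] := H x Vx.
  by exists W, k; split=> //; exists t'.
Qed.

Definition shres U U' (h : U' <<= U) (F : shsec U) : shsec U' :=
  let: And5 a1 a2 a3 a4 a5 := shres_subproof h F in ShSec a1 a2 a3 a4 a5.

Lemma rep_shres U U' (h : U' <<= U) (F : shsec U) V (t : P V) :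
  rep (shres h F) t <-> V <<= U' /\ rep F t.
Proof. by rewrite /shres; case: (shres_subproof h F). Qed.

Lemma shres_lin U V (h : V <<= U) a (F G : shsec U) :
  shres h (a *: F + G) = rres O h a *: shres h F + shres h G.
Proof.
apply: shsec_eq => x Vx.
have [W [s [t [Wx k /rep_shres[_ Fs] /rep_shres[_ Gt]]]]] :=
  rep2_ex (shres h F) (shres h G) Vx.
have l : W <<= U by move=> u /k /h.
exists W, (wadd (wscale (rres O l a) s) t); split=> //.
  apply/rep_shres; split=> //; apply: (rep_add _ Gt (weq_refl _)).
  exact: (rep_scale (h := l) Fs (weq_refl _)).
apply: (@rep_add _ _ _ _ (wscale (rres O l a) s) t) => //; last exact: weq_refl.
  apply: (@rep_scale _ _ _ _ k s); first by apply/rep_shres.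
  by rewrite (rres_comp h k l); exact: weq_refl.
by apply/rep_shres.
Qed.

Lemma shres_id U (h : U <<= U) (F : shsec U) : shres h F = F.
Proof.
apply: shsec_eq => x Ux; have [V [s [Vx Fs]]] := rep_ex F Ux.
by exists V, s; split=> //; apply/rep_shres; split=> //; exact: (rep_sub Fs).
Qed.

Lemma shres_comp U V W (h : V <<= U) (k : W <<= V) (l : W <<= U) (F : shsec U) :
  shres k (shres h F) = shres l F.
Proof.
apply: shsec_eq => x Wx.
have [V' [s [Vx /rep_shres[VW Fs]]]] := rep_ex (shres l F) Wx.
exists V', s; split=> //; apply/rep_shres; split=> //; apply/rep_shres; split=> //.
by move=> u /VW /k.
Qed.

Definition sheafify : mpsh O := MPsh shres_lin shres_id shres_comp.

Lemma shunitD U (s t : P U) : shunit (wadd s t) = shunit s + shunit t.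
Proof.
apply: shsec_eq => x Ux; exists U, (wadd s t); split=> //.
  exact: rep_shunitP.
by apply: (rep_add (rep_shunitP _) (rep_shunitP _) (weq_refl _)).
Qed.

Lemma shunitZ U a (s : P U) : shunit (wscale a s) = a *: shunit s.
Proof.
apply: shsec_eq => x Ux; exists U, (wscale a s); split=> //.
  exact: rep_shunitP.
apply: (rep_scale (h := @sub_refl U) (rep_shunitP _) _).
by rewrite rres_id; exact: weq_refl.
Qed.

Lemma shunit_res U V (h : V <<= U) (s : P U) :
  shunit (wres h s) = shres h (shunit s).
Proof.
apply: shsec_eq => x Ux; exists V, (wres h s); split=> //.
  exact: rep_shunitP.
by apply/rep_shres; split=> //; apply: rep_res; exact: rep_shunitP.
Qed.

Lemma shunit_eq U (s t : P U) : weq s t -> shunit s = shunit t.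
Proof.
move=> e; apply: shsec_eq => x Ux; exists U, s; split=> //.
  exact: rep_shunitP.
by apply: (rep_eqv (weq_loc e) _); exact: rep_shunitP.
Qed.

Lemma sheafify_is_sheaf : is_sheaf sheafify.
Proof.
move=> U I C CU cov s cmp.
have cmp' i j V (t : P V) : V <<= C j -> rep (s i) t -> rep (s j) t.
  move=> hj si; have hi := rep_sub si.
  have : rep (shres hi (s i)) t by apply/rep_shres; split.
  have -> : shres hi (s i) = shres hj (s j) by exact: cmp.
  by move=> /rep_shres[].
pose r V (t : P V) := V <<= U /\ locally (fun W (h : W <<= V) =>
   exists i, rep (s i) (wres h t)).
have rU : forall V (t : P V), r V t -> V <<= U by move=> V t [].
have rE x : U x -> exists V (t : P V), V x /\ r V t.
  move=> Ux; have [i Cx] := cov x Ux.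
  have [V [t [Vx st]]] := rep_ex (s i) Cx.
  exists V, t; split=> //; split; first by move=> u /(rep_sub st) /CU.
  by move=> z Vz; exists V, (@sub_refl V); split=> //; exists i; exact: rep_res.
have rQ : forall V (a b : P V), r V a -> r V b -> loc_eq a b.
  move=> V a b [VU ra] [_ rb] z Vz.
  have [W [h [Wz [i si]]]] := ra z Vz; have [W' [h' [Wz' [j sj]]]] := rb z Vz.
  have k : oI W W' <<= V by move=> u [/h].
  have ia : rep (s i) (wres k a).
    apply: (rep_weq (rep_res (@oI_l W W') si) _); apply: weq_sym.
    exact: wres_comp.
  have ib : rep (s i) (wres k b).
    apply: (cmp' j); first by move=> u [/(rep_sub si)].
    apply: (rep_weq (rep_res (@oI_r W W') sj) _); apply: weq_sym.
    exact: wres_comp.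
  have [J [l [Jz e]]] := rep_uniq ia ib (conj Wz Wz' : oI W W' z).
  have m : J <<= V by move=> u /l /k.
  exists J, m; split=> //; apply: (weq_trans (weq_sym (wres_comp k l m a)) _).
  apply: (weq_trans e _); exact: wres_comp.
have rR : forall V W (h : W <<= V) (t : P V), r V t -> r W (wres h t).
  move=> V W h t [VU rt]; split; first by move=> u /h /VU.
  move=> z Wz; have [J [k [Jz [i si]]]] := rt z (h z Wz).
  exists (oI W J), (@oI_l W J); split=> //; exists i.
  apply: (rep_weq (rep_res (@oI_r W J) si) _); exact: weq_resres.
have rL : forall V (t : P V), V <<= U ->
    locally (fun W (h : W <<= V) => exists2 t' : P W, r W t' & weq (wres h t) t') ->
    r V t.
  move=> V t VU H; split=> // z Vz.
  have [W [h [Wz [t' [_ rt'] e]]]] := H z Vz.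
  have [J [k [Jz [i si]]]] := rt' z Wz.
  have l : J <<= V by move=> u /k /h.
  exists J, l; split=> //; exists i; apply: (rep_weq si _).
  by apply: (weq_trans (weq_sym (wres_comp h k l t)) _); exact: weq_res.
exists (ShSec rU rE rQ rR rL); split.
  move=> i; apply: shsec_eq => x Cx; have [V [t [Vx st]]] := rep_ex (s i) Cx.
  exists V, t; split=> //; apply/rep_shres; split; first exact: (rep_sub st).
  split; first by move=> u /(rep_sub st) /CU.
  by move=> z Vz; exists V, (@sub_refl V); split=> //; exists i; exact: rep_res.
move=> F HF; apply: shsec_eq => x Ux; have [i Cx] := cov x Ux.
have [V [t [Vx st]]] := rep_ex (s i) Cx.
exists V, t; split=> //.
  split; first by move=> u /(rep_sub st) /CU.
  by move=> z Vz; exists V, (@sub_refl V); split=> //; exists i; exact: rep_res.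
by move: st; rewrite -(HF i) => /rep_shres[].
Qed.

End Sheafify.

Record rawalg (X : topologicalType) (O : rpsh X) := RawAlg {
  rawm :> rawmod O;
  wone : forall U, rawm U;
  wmul : forall U, rawm U -> rawm U -> rawm U;
  weq_mul : forall U (x x' y y' : rawm U),
    weq x x' -> weq y y' -> weq (wmul x y) (wmul x' y');
  wmulA : forall U (x y z : rawm U), weq (wmul x (wmul y z)) (wmul (wmul x y) z);
  wmul1l : forall U (x : rawm U), weq (wmul (wone U) x) x;
  wmul1r : forall U (x : rawm U), weq (wmul x (wone U)) x;
  wmulDl : forall U a (x y z : rawm U),
    weq (wmul (wadd (wscale a x) y) z) (wadd (wscale a (wmul x z)) (wmul y z));
  wmulDr : forall U a (x y z : rawm U),
    weq (wmul z (wadd (wscale a x) y)) (wadd (wscale a (wmul z x)) (wmul z y));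
  wres1 : forall U V (h : V <<= U), weq (wres h (wone U)) (wone V);
  wresM : forall U V (h : V <<= U) (x y : rawm U),
    weq (wres h (wmul x y)) (wmul (wres h x) (wres h y)) }.

Section SheafifyAlg.
Variables (X : topologicalType) (O : rpsh X) (P : rawalg O).

Lemma shmul_res U V W (h : V <<= U) (k : W <<= V) (l : W <<= U) (x y : P V) :
  weq (wres k (wmul x y)) (wmul (wres k x) (wres k y)).
Proof. exact: wresM. Qed.

Definition shmul U (F G : shsec P U) : shsec P U :=
  shlift (op := fun V _ x y => wmul x y)
    (fun V _ x x' y y' => @weq_mul _ _ P V x x' y y') (@shmul_res U) F G.

Lemma rep_mul U (F G : shsec P U) V (x y t : P V) :
  rep F x -> rep G y -> weq t (wmul x y) -> rep (shmul F G) t.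
Proof. by move=> Fx Gy e; exact: (rep_shlift (k := rep_sub Fx) _ _ Fx Gy e). Qed.

Definition shone U : shsec P U := shunit (wone P U).

Lemma rep_one U V (h : V <<= U) : rep (shone U) (wone P V).
Proof.
apply/rep_shunit; exists h; apply: weq_loc; apply: weq_sym; exact: wres1.
Qed.

Lemma shmulA U (x y z : sheafify P U) : shmul x (shmul y z) = shmul (shmul x y) z.
Proof.
apply: shsec_eq => u Uu; have [V [s [t [r [Vx xs yt zr]]]]] := rep3_ex x y z Uu.
exists V, (wmul s (wmul t r)); split=> //.
  apply: (rep_mul xs _ (weq_refl _)); exact: (rep_mul yt zr (weq_refl _)).
by apply: (rep_mul _ zr (wmulA _ _ _)); exact: (rep_mul xs yt (weq_refl _)).
Qed.

Lemma shmul1l U (x : sheafify P U) : shmul (shone U) x = x.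
Proof.
apply: shsec_eq => u Uu; have [V [s [Vx xs]]] := rep_ex x Uu.
exists V, s; split=> //; apply: (rep_mul (rep_one (rep_sub xs)) xs _).
by apply: weq_sym; exact: wmul1l.
Qed.

Lemma shmul1r U (x : sheafify P U) : shmul x (shone U) = x.
Proof.
apply: shsec_eq => u Uu; have [V [s [Vx xs]]] := rep_ex x Uu.
exists V, s; split=> //; apply: (rep_mul xs (rep_one (rep_sub xs)) _).
by apply: weq_sym; exact: wmul1r.
Qed.

Lemma shmulDl U a (x y z : sheafify P U) :
  shmul (a *: x + y) z = a *: shmul x z + shmul y z.
Proof.
apply: shsec_eq => u Uu; have [V [s [t [r [Vx xs yt zr]]]]] := rep3_ex x y z Uu.
have h := rep_sub xs.
exists V, (wmul (wadd (wscale (rres O h a) s) t) r); split=> //.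
  apply: (rep_mul _ zr (weq_refl _)); apply: (rep_add _ yt (weq_refl _)).
  exact: (rep_scale (h := h) xs (weq_refl _)).
apply: (rep_add _ _ (wmulDl _ _ _ _)); last exact: (rep_mul yt zr (weq_refl _)).
by apply: (rep_scale (h := h) _ (weq_refl _)); exact: (rep_mul xs zr (weq_refl _)).
Qed.

Lemma shmulDr U a (x y z : sheafify P U) :
  shmul z (a *: x + y) = a *: shmul z x + shmul z y.
Proof.
apply: shsec_eq => u Uu; have [V [s [t [r [Vx xs yt zr]]]]] := rep3_ex x y z Uu.
have h := rep_sub xs.
exists V, (wmul r (wadd (wscale (rres O h a) s) t)); split=> //.
  apply: (rep_mul zr _ (weq_refl _)); apply: (rep_add _ yt (weq_refl _)).
  exact: (rep_scale (h := h) xs (weq_refl _)).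
apply: (rep_add _ _ (wmulDr _ _ _ _)); last exact: (rep_mul zr yt (weq_refl _)).
by apply: (rep_scale (h := h) _ (weq_refl _)); exact: (rep_mul zr xs (weq_refl _)).
Qed.

Lemma shres1 U V (h : V <<= U) : mres (m := sheafify P) h (shone U) = shone V.
Proof.
apply: shsec_eq => u Uu; exists V, (wone P V); split=> //.
  by apply/rep_shres; split=> //; exact: rep_one.
exact: rep_one.
Qed.

Lemma shresM U V (h : V <<= U) (x y : sheafify P U) :
  mres (m := sheafify P) h (shmul x y) = shmul (mres h x) (mres h y).
Proof.
apply: shsec_eq => u Vu.
have [W [s [t [Wx k /rep_shres[_ xs] /rep_shres[_ yt]]]]] :=
  rep2_ex (shres h x) (shres h y) Vu.
exists W, (wmul s t); split=> //.
  by apply/rep_shres; split=> //; exact: (rep_mul xs yt (weq_refl _)).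
by apply: (rep_mul _ _ (weq_refl (wmul s t))); apply/rep_shres; split.
Qed.

Definition sheafify_alg : alg O :=
  Alg (AlgStruct shmulA shmul1l shmul1r shmulDl shmulDr shres1 shresM).

End SheafifyAlg.

Inductive mterm (R G : Type) : Type :=
| Tzero
| Tgen of G
| Tadd of mterm R G & mterm R G
| Tscale of R & mterm R G.
Arguments Tzero {R G}.
Arguments Tgen {R G}.

Fixpoint tmap (R R' G G' : Type) (f : R -> R') (g : G -> G') (t : mterm R G) :
    mterm R' G' :=
  match t with
  | Tzero => Tzero
  | Tgen x => Tgen (g x)
  | Tadd s t => Tadd (tmap f g s) (tmap f g t)
  | Tscale a t => Tscale (f a) (tmap f g t)
  end.

Inductive teq (R : pzRingType) (G : Type) (rel : mterm R G -> mterm R G -> Prop) :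
    mterm R G -> mterm R G -> Prop :=
| teq_rel s t : rel s t -> teq rel s t
| teq_refl s : teq rel s s
| teq_sym s t : teq rel s t -> teq rel t s
| teq_trans s t r : teq rel s t -> teq rel t r -> teq rel s r
| teq_add s s' t t' :
    teq rel s s' -> teq rel t t' -> teq rel (Tadd s t) (Tadd s' t')
| teq_scale a s s' : teq rel s s' -> teq rel (Tscale a s) (Tscale a s')
| teq_addA s t r : teq rel (Tadd s (Tadd t r)) (Tadd (Tadd s t) r)
| teq_addC s t : teq rel (Tadd s t) (Tadd t s)
| teq_add0 s : teq rel (Tadd Tzero s) s
| teq_addN s : teq rel (Tadd (Tscale (- 1) s) s) Tzero
| teq_scaleA a b s : teq rel (Tscale a (Tscale b s)) (Tscale (a * b) s)
| teq_scale1 s : teq rel (Tscale 1 s) s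
| teq_scaleDr a s t :
    teq rel (Tscale a (Tadd s t)) (Tadd (Tscale a s) (Tscale a t))
| teq_scaleDl a b s :
    teq rel (Tscale (a + b) s) (Tadd (Tscale a s) (Tscale b s)).

Section Presentation.
Variables (X : topologicalType) (O : rpsh X).

Record pres := Pres {
  pgen :> opn X -> Type;
  pres_res : forall U V : opn X, V <<= U -> pgen U -> pgen V;
  prel : forall U, mterm (O U) (pgen U) -> mterm (O U) (pgen U) -> Prop;
  pres_id : forall U (h : U <<= U) x, pres_res h x = x;
  pres_comp : forall U V W (h : V <<= U) (k : W <<= V) (l : W <<= U) x,
    pres_res k (pres_res h x) = pres_res l x;
  prel_res : forall U V (h : V <<= U) s t, prel s t ->
    prel (tmap (rres O h) (pres_res h) s) (tmap (rres O h) (pres_res h) t) }.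

Variable G : pres.

Definition ptres U V (h : V <<= U) : mterm (O U) (G U) -> mterm (O V) (G V) :=
  tmap (rres O h) (pres_res h).

Lemma ptres_eq U V (h : V <<= U) (s t : mterm (O U) (G U)) :
  teq (@prel G U) s t -> teq (@prel G V) (ptres h s) (ptres h t).
Proof.
elim=> {s t} /=.
- by move=> s t r; apply: teq_rel; exact: prel_res.
- by move=> s; exact: teq_refl.
- by move=> s t _ e; exact: teq_sym.
- by move=> s t r _ e _ f; exact: (teq_trans e f).
- by move=> s s' t t' _ e _ f; exact: teq_add.
- by move=> a s s' _ e; exact: teq_scale.
- by move=> s t r; exact: teq_addA.
- by move=> s t; exact: teq_addC.
- by move=> s; exact: teq_add0.
- by move=> s; rewrite /ptres /= rmorphN1; exact: teq_addN.
- by move=> a b s; rewrite /ptres /= rmorphM; exact: teq_scaleA.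
- by move=> s; rewrite /ptres /= rmorph1; exact: teq_scale1.
- by move=> a s t; exact: teq_scaleDr.
- by move=> a b s; rewrite /ptres /= rmorphD; exact: teq_scaleDl.
Qed.

Lemma ptres_id U (h : U <<= U) s : ptres h s = s.
Proof.
elim: s => //= [x|s es t et|a s es]; rewrite /ptres /=.
- by rewrite pres_id.
- by congr Tadd.
- by rewrite rres_id; congr Tscale.
Qed.

Lemma ptres_comp U V W (h : V <<= U) (k : W <<= V) (l : W <<= U) s :
  ptres k (ptres h s) = ptres l s.
Proof.
elim: s => //= [x|s es t et|a s es]; rewrite /ptres /=.
- by rewrite (pres_comp h k l).
- by congr Tadd.
- by rewrite (rres_comp h k l); congr Tscale.
Qed.

Definition rawpres : rawmod O.
Proof.
apply: (@RawMod X O (fun U => mterm (O U) (G U)) ptres (fun U => teq (@prel G U))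
  (fun U => Tzero) (fun U => @Tadd _ _) (fun U => @Tscale _ _)).
- by move=> U; exact: teq_refl.
- by move=> U; exact: teq_sym.
- by move=> U; exact: teq_trans.
- by move=> U; exact: teq_add.
- by move=> U; exact: teq_scale.
- exact: ptres_eq.
- by move=> U; exact: teq_addA.
- by move=> U; exact: teq_addC.
- by move=> U; exact: teq_add0.
- by move=> U; exact: teq_addN.
- by move=> U; exact: teq_scaleA.
- by move=> U; exact: teq_scale1.
- by move=> U; exact: teq_scaleDr.
- by move=> U; exact: teq_scaleDl.
- by move=> U h x; rewrite ptres_id; exact: teq_refl.
- by move=> U V W h k l x; rewrite (ptres_comp h k l); exact: teq_refl.
- by move=> U V h; exact: teq_refl.
- by move=> U V h x y; exact: teq_refl.
- by move=> U V h a x; exact: teq_refl.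
Defined.

Definition presented : mpsh O := sheafify rawpres.

Definition pgenerator U (x : G U) : presented U :=
  shunit (P := rawpres) (Tgen x).

End Presentation.

Section Tensor.
Variables (X : topologicalType) (O : rpsh X) (M N : mpsh O).

Inductive bilin_rel U :
    mterm (O U) (M U * N U) -> mterm (O U) (M U * N U) -> Prop :=
| bilin_l a x x' y : bilin_rel (Tgen (a *: x + x', y))
    (Tadd (Tscale a (Tgen (x, y))) (Tgen (x', y)))
| bilin_r a x y y' : bilin_rel (Tgen (x, a *: y + y'))
    (Tadd (Tscale a (Tgen (x, y))) (Tgen (x, y'))).

Definition tens_pres : pres O.
Proof.
apply: (@Pres X O (fun U => (M U * N U)%type)
  (fun U V h xy => (mres h xy.1, mres h xy.2)) bilin_rel).
- by move=> U h [x y] /=; rewrite !mres_id.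
- by move=> U V W h k l [x y] /=; rewrite !(mres_comp h k l).
- by move=> U V h s t [] a x y z /=; rewrite mres_lin; constructor.
Defined.

Definition tens : mpsh O := presented tens_pres.
Definition ten U (x : M U) (y : N U) : tens U := pgenerator (G := tens_pres) (x, y).

End Tensor.

Section TensorAlgebra.
Variables (X : topologicalType) (O : rpsh X) (M : mpsh O).

(* T(M) is the direct sum of the tensor powers of M: the i-th one is generated
   by the words of length i, subject to multilinearity. *)
Inductive word_rel U :
    mterm (O U) (seq (M U)) -> mterm (O U) (seq (M U)) -> Prop :=
| word_lin w1 w2 a x y : word_rel (Tgen (w1 ++ (a *: x + y) :: w2))
    (Tadd (Tscale a (Tgen (w1 ++ x :: w2))) (Tgen (w1 ++ y :: w2))).

Definition word_pres : pres O.
Proof.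
apply: (@Pres X O (fun U => seq (M U)) (fun U V h => map (mres h)) word_rel).
- by move=> U h w; rewrite (eq_map (mres_id h)) map_id.
- by move=> U V W h k l w; rewrite -map_comp; apply: eq_map => x; exact: mres_comp.
- move=> U V h s t [] w1 w2 a x y /=.
  by rewrite !map_cat /= mres_lin; constructor.
Defined.

Let W := rawpres word_pres.

Definition tprefix U (w : seq (M U)) : W U -> W U := tmap id (cat w).

Fixpoint tmul U (s t : W U) : W U :=
  match s with
  | Tzero => Tzero
  | Tgen w => tprefix w t
  | Tadd s1 s2 => Tadd (tmul s1 t) (tmul s2 t)
  | Tscale a s1 => Tscale a (tmul s1 t)
  end.

Lemma tprefix_eq U w (s t : W U) : weq s t -> weq (tprefix w s) (tprefix w t).
Proof.
elim=> {s t} /=.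
- move=> s t [] w1 w2 a x y; rewrite /tprefix /= !catA; apply: teq_rel; constructor.
- by move=> s; exact: teq_refl.
- by move=> s t _ e; exact: teq_sym.
- by move=> s t r _ e _ f; exact: (teq_trans e f).
- by move=> s s' t t' _ e _ f; exact: teq_add.
- by move=> a s s' _ e; exact: teq_scale.
- by move=> s t r; exact: teq_addA.
- by move=> s t; exact: teq_addC.
- by move=> s; exact: teq_add0.
- by move=> s; exact: teq_addN.
- by move=> a b s; exact: teq_scaleA.
- by move=> s; exact: teq_scale1.
- by move=> a s t; exact: teq_scaleDr.
- by move=> a b s; exact: teq_scaleDl.
Qed.

Lemma tmul_eqr U (s t t' : W U) : weq t t' -> weq (tmul s t) (tmul s t').
Proof.
move=> e; elim: s => /= [|w|s es r er|a s es].
- exact: teq_refl.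
- exact: tprefix_eq.
- exact: teq_add.
- exact: teq_scale.
Qed.

Lemma teq_scale0 (R : pzRingType) (G : Type) rel (a : R) :
  @teq R G rel (Tscale a Tzero) Tzero.
Proof.
have e0 : @teq R G rel (Tscale 0 Tzero) Tzero.
  rewrite -[X in Tscale X _](addNr 1); apply: (teq_trans (teq_scaleDl _ _ _ _) _).
  apply: (teq_trans (teq_add (teq_refl _ _) (teq_scale1 _ _)) _).
  exact: teq_addN.
apply: (teq_trans (teq_scale a (teq_sym e0)) _).
by apply: (teq_trans (teq_scaleA _ _ _ _) _); rewrite mulr0.
Qed.

Lemma teq_lin4 (R : pzRingType) (G : Type) rel a b (x y x' y' : mterm R G) :
  a * b = b * a ->
  teq rel (Tadd (Tadd (Tscale a x) x') (Tscale b (Tadd (Tscale a y) y')))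
          (Tadd (Tscale a (Tadd x (Tscale b y))) (Tadd x' (Tscale b y'))).
Proof.
move=> ab.
apply: (teq_trans (teq_add (teq_refl _ _) (teq_scaleDr _ _ _ _)) _).
apply: (teq_trans (teq_add (teq_refl _ _) (teq_add (teq_scaleA _ _ _ _) (teq_refl _ _))) _).
apply: (teq_trans _ (teq_add (teq_sym (teq_scaleDr _ _ _ _)) (teq_refl _ _))).
apply: (teq_trans _ (teq_add (teq_add (teq_refl _ _) (teq_sym (teq_scaleA _ _ _ _))) (teq_refl _ _))).
rewrite ab; set p := Tscale a x; set q := Tscale (b * a) y; set r := Tscale b y'.
apply: (teq_trans (teq_sym (teq_addA _ _ _ _)) _).
apply: (teq_trans _ (teq_addA _ _ _ _)); apply: teq_add; first exact: teq_refl.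
apply: (teq_trans (teq_addA _ _ _ _) _).
apply: (teq_trans (teq_add (teq_addC _ _ _) (teq_refl _ _)) _).
exact: (teq_sym (teq_addA _ _ _ _)).
Qed.

Lemma tprefix_lin U w1 w2 a x y (t : W U) :
  weq (tprefix (w1 ++ (a *: x + y) :: w2) t)
      (wadd (wscale a (tprefix (w1 ++ x :: w2) t)) (tprefix (w1 ++ y :: w2) t)).
Proof.
elim: t => /= [|w|s es t et|b s es].
- apply: teq_sym; apply: (teq_trans (teq_add (teq_scale0 _ _) (teq_refl _ _)) _).
  exact: teq_add0.
- by rewrite /tprefix /= -!catA; apply: teq_rel; constructor.
- apply: (teq_trans (teq_add es et) _).
  set p := tprefix _ s; set q := tprefix _ s; set p' := tprefix _ t.
  set q' := tprefix _ t.
  have H := teq_lin4 (@prel _ _ word_pres U) p p' q q' (mulrC a 1).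
  apply: (teq_trans (teq_add (teq_refl _ _) (teq_sym (teq_scale1 _ _))) _).
  apply: (teq_trans H _); apply: teq_add; last first.
    by apply: teq_add; [exact: teq_refl|exact: teq_scale1].
  by apply: teq_scale; apply: teq_add; [exact: teq_refl|exact: teq_scale1].
- apply: (teq_trans (teq_scale _ es) _).
  apply: (teq_trans (teq_scaleDr _ _ _ _) _); apply: teq_add; last exact: teq_refl.
  apply: (teq_trans (teq_scaleA _ _ _ _) _); rewrite mulrC.
  exact: (teq_sym (teq_scaleA _ _ _ _)).
Qed.

Lemma tmul_eql U (s s' t : W U) : weq s s' -> weq (tmul s t) (tmul s' t).
Proof.
elim=> {s s'} /=.
- by move=> s s' [] w1 w2 a x y /=; exact: tprefix_lin.
- by move=> s; exact: teq_refl.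
- by move=> s s' _ e; exact: teq_sym.
- by move=> s s' r _ e _ f; exact: (teq_trans e f).
- by move=> s s' r r' _ e _ f; exact: teq_add.
- by move=> a s s' _ e; exact: teq_scale.
- by move=> s s' r; exact: teq_addA.
- by move=> s s'; exact: teq_addC.
- by move=> s; exact: teq_add0.
- by move=> s; exact: teq_addN.
- by move=> a b s; exact: teq_scaleA.
- by move=> s; exact: teq_scale1.
- by move=> a s s'; exact: teq_scaleDr.
- by move=> a b s; exact: teq_scaleDl.
Qed.

Lemma tprefix_cat U w w' (t : W U) :
  tprefix w (tprefix w' t) = tprefix (w ++ w') t.
Proof.
elim: t => //= [v|s es t et|a s es]; first by rewrite /tprefix /= catA.
  by congr Tadd.
by congr Tscale.
Qed.

Lemma tprefix_mul U w (s t : W U) : tmul (tprefix w s) t = tprefix w (tmul s t).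
Proof.
elim: s => //= [v|s es r er|a s es]; first by rewrite tprefix_cat.
  by congr Tadd.
by congr Tscale.
Qed.

Lemma tmulA U (s t r : W U) : tmul s (tmul t r) = tmul (tmul s t) r.
Proof.
elim: s => //= [w|s es s' es'|a s es]; first by rewrite tprefix_mul.
  by rewrite es es'.
by rewrite es.
Qed.

Lemma tmul1l U (t : W U) : tmul (Tgen [::]) t = t.
Proof. by elim: t => //= [s es t et|a s es]; [congr Tadd|congr Tscale]. Qed.

Lemma tmul1r U (t : W U) : tmul t (Tgen [::]) = t.
Proof.
by elim: t => //= [w|s es t et|a s es]; [rewrite /tprefix /= cats0|rewrite es et|rewrite es].
Qed.

Lemma tmulDr U a (x y z : W U) :
  weq (tmul z (Tadd (Tscale a x) y)) (Tadd (Tscale a (tmul z x)) (tmul z y)).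
Proof.
elim: z => /= [|w|s es t et|b s es].
- apply: teq_sym; apply: (teq_trans (teq_add (teq_scale0 _ _) (teq_refl _ _)) _).
  exact: teq_add0.
- exact: teq_refl.
- apply: (teq_trans (teq_add es et) _).
  apply: (teq_trans (teq_add (teq_refl _ _) (teq_sym (teq_scale1 _ _))) _).
  apply: (teq_trans (teq_lin4 _ _ _ _ _ (mulrC a 1)) _); apply: teq_add; last first.
    by apply: teq_add; [exact: teq_refl|exact: teq_scale1].
  by apply: teq_scale; apply: teq_add; [exact: teq_refl|exact: teq_scale1].
- apply: (teq_trans (teq_scale _ es) _).
  apply: (teq_trans (teq_scaleDr _ _ _ _) _); apply: teq_add; last exact: teq_refl.
  apply: (teq_trans (teq_scaleA _ _ _ _) _); rewrite mulrC.
  exact: (teq_sym (teq_scaleA _ _ _ _)).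
Qed.

Lemma tmul_res U V (h : V <<= U) (s t : W U) :
  ptres h (tmul s t) = tmul (ptres h s) (ptres h t).
Proof.
elim: s => //= [w|s es r er|a s es]; last 2 first.
- by rewrite /ptres /=; congr Tadd.
- by rewrite /ptres /=; congr Tscale.
elim: t => //= [v|s es t et|a s es]; rewrite /ptres /=.
- by rewrite map_cat.
- by congr Tadd.
- by congr Tscale.
Qed.

Definition rawtalg : rawalg O.
Proof.
apply: (@RawAlg X O W (fun U => Tgen [::]) tmul).
- by move=> U x x' y y' e f; apply: (teq_trans (tmul_eql y e) (tmul_eqr x' f)).
- by move=> U x y z; rewrite tmulA; exact: weq_refl.
- by move=> U x; rewrite tmul1l; exact: weq_refl.
- by move=> U x; rewrite tmul1r; exact: weq_refl.
- by move=> U a x y z; exact: weq_refl.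
- by move=> U a x y z; exact: tmulDr.
- by move=> U V h; exact: weq_refl.
- by move=> U V h x y; rewrite /= tmul_res; exact: teq_refl.
Defined.

Definition talg : alg O := sheafify_alg rawtalg.

Definition tin_app U (x : M U) : talg U := pgenerator (G := word_pres) [:: x].

Lemma tin_lin U a (x y : M U) : tin_app (a *: x + y) = a *: tin_app x + tin_app y.
Proof.
rewrite /tin_app /pgenerator.
have e : weq (Tgen [:: a *: x + y] : W U)
             (wadd (wscale a (Tgen [:: x] : W U)) (Tgen [:: y])).
  by apply: teq_rel; exact: (@word_lin U [::] [::] a x y).
by rewrite (shunit_eq e) shunitD shunitZ.
Qed.

Lemma tin_nat U V (h : V <<= U) (x : M U) : tin_app (mres h x) = mres h (tin_app x).
Proof. by rewrite /tin_app /pgenerator -[RHS]shunit_res. Qed.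

Definition tin : hom M talg := Hom tin_lin tin_nat.

End TensorAlgebra.

Section Quotients.
Variables (X : topologicalType) (O : rpsh X).

(* J is a family of local sections, so restrictions of its members are included. *)
Inductive comb (M : mpsh O) (J : forall U, M U -> Prop) U : M U -> Prop :=
| comb0 : comb J 0
| comb_cons V (h : U <<= V) a j x :
    J V j -> comb J x -> comb J (a *: mres h j + x).

Lemma combD (M : mpsh O) (J : forall U, M U -> Prop) U (x y : M U) :
  comb J x -> comb J y -> comb J (x + y).
Proof.
elim=> [|V h a j z Jj _ IH] cy; first by rewrite add0r.
by rewrite -addrA; constructor=> //; exact: IH.
Qed.

Lemma comb_eq (M : mpsh O) (J : forall U, M U -> Prop) U (x y : M U) :
  x = y -> comb J (x - y).
Proof. by move=> ->; rewrite subrr; constructor. Qed.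

Lemma combZ (M : mpsh O) (J : forall U, M U -> Prop) U a (x : M U) :
  comb J x -> comb J (a *: x).
Proof.
elim=> [|V h b j z Jj _ IH]; first by rewrite scaler0; constructor.
by rewrite scalerDr scalerA; constructor.
Qed.

Lemma comb_res (M : mpsh O) (J : forall U, M U -> Prop) U V (h : V <<= U) (x : M U) :
  comb J x -> comb J (mres h x).
Proof.
elim=> [|W k a j z Jj _ IH]; first by rewrite mres0; constructor.
have l : V <<= W by move=> u /h /k.
by rewrite mres_lin (mres_comp k h l); constructor.
Qed.

Section Span.
Variables (M : mpsh O) (J : forall U, M U -> Prop).

Definition in_span U (x : M U) : Prop :=
  locally (fun W (h : W <<= U) => comb J (mres h x)).

Record spsec U := SpSec { spval : M U; spvalP : in_span spval }.

HB.instance Definition _ U := gen_eqMixin (spsec U).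
HB.instance Definition _ U := gen_choiceMixin (spsec U).

Lemma spval_inj U : injective (@spval U).
Proof.
by move=> [x px] [y py] /= e; subst y; congr SpSec; exact: Prop_irrelevance.
Qed.

Lemma in_span_lin U a (x y : M U) : in_span x -> in_span y -> in_span (a *: x + y).
Proof.
move=> px py z Uz; have [W [h [Wz cx]]] := px z Uz; have [W' [h' [Wz' cy]]] := py z Uz.
have l : oI W W' <<= U by move=> u [/h].
exists (oI W W'), l; split=> //; rewrite mres_lin; apply: combD.
  by apply: combZ; rewrite -(mres_comp h (@oI_l _ _ _) l); exact: comb_res.
by rewrite -(mres_comp h' (@oI_r _ _ _) l); exact: comb_res.
Qed.

Lemma in_span0 U : in_span (0 : M U).
Proof.
by move=> z Uz; exists U, (@sub_refl _ U); split=> //; rewrite mres0; constructor.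
Qed.

Lemma in_spanD U (x y : M U) : in_span x -> in_span y -> in_span (x + y).
Proof. by move=> px; rewrite -[x]scale1r; exact: in_span_lin. Qed.

Lemma in_spanZ U a (x : M U) : in_span x -> in_span (a *: x).
Proof. by move=> px; rewrite -(addr0 (_ *: x)); exact: (in_span_lin _ px (@in_span0 U)). Qed.

Lemma in_spanN U (x : M U) : in_span x -> in_span (- x).
Proof. by rewrite -scaleN1r; exact: in_spanZ. Qed.

Lemma in_span_res U V (h : V <<= U) (x : M U) : in_span x -> in_span (mres h x).
Proof.
move=> px z Vz; have [W [k [Wz cx]]] := px z (h z Vz).
exists (oI V W), (@oI_l _ V W); split=> //.
have l : oI V W <<= U by move=> u [/h].
rewrite (mres_comp h _ l) -(mres_comp k (@oI_r _ V W) l); exact: comb_res.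
Qed.

Definition sp0 U : spsec U := SpSec (@in_span0 U).
Definition spadd U (x y : spsec U) : spsec U := SpSec (in_spanD (spvalP x) (spvalP y)).
Definition spopp U (x : spsec U) : spsec U := SpSec (in_spanN (spvalP x)).
Definition spscale U (a : O U) (x : spsec U) : spsec U := SpSec (in_spanZ a (spvalP x)).

Lemma spaddA U : associative (@spadd U).
Proof. by move=> x y z; apply: spval_inj; exact: addrA. Qed.
Lemma spaddC U : commutative (@spadd U).
Proof. by move=> x y; apply: spval_inj; exact: addrC. Qed.
Lemma spadd0 U : left_id (sp0 U) (@spadd U).
Proof. by move=> x; apply: spval_inj; exact: add0r. Qed.
Lemma spaddN U : left_inverse (sp0 U) (@spopp U) (@spadd U).
Proof. by move=> x; apply: spval_inj; exact: addNr. Qed.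

HB.instance Definition _ U :=
  GRing.isZmodule.Build (spsec U) (@spaddA U) (@spaddC U) (@spadd0 U) (@spaddN U).

Lemma spscaleA U (a b : O U) (x : spsec U) :
  spscale a (spscale b x) = spscale (a * b) x.
Proof. by apply: spval_inj; exact: scalerA. Qed.
Lemma spscale1 U : left_id (1 : O U) (@spscale U).
Proof. by move=> x; apply: spval_inj; exact: scale1r. Qed.
Lemma spscaleDr U : right_distributive (@spscale U) +%R.
Proof. by move=> a x y; apply: spval_inj; exact: scalerDr. Qed.
Lemma spscaleDl U (x : spsec U) : {morph (@spscale U)^~ x : a b / a + b >-> a + b}.
Proof. by move=> a b; apply: spval_inj; exact: scalerDl. Qed.

HB.instance Definition _ U :=
  GRing.Zmodule_isLmodule.Build (O U) (spsec U) (@spscaleA U) (@spscale1 U)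
    (@spscaleDr U) (@spscaleDl U).

Definition spres U V (h : V <<= U) (x : spsec U) : spsec V :=
  SpSec (in_span_res h (spvalP x)).

Lemma spres_lin U V (h : V <<= U) a (x y : spsec U) :
  spres h (a *: x + y) = rres O h a *: spres h x + spres h y.
Proof. by apply: spval_inj; exact: mres_lin. Qed.
Lemma spres_id U (h : U <<= U) x : spres h x = x.
Proof. by apply: spval_inj; exact: mres_id. Qed.
Lemma spres_comp U V W (h : V <<= U) (k : W <<= V) (l : W <<= U) x :
  spres k (spres h x) = spres l x.
Proof. by apply: spval_inj; exact: mres_comp. Qed.

Definition span : mpsh O := MPsh spres_lin spres_id spres_comp.

End Span.

Section ModQuotient.
Variables (M : mpsh O) (J : forall U, M U -> Prop).

Definition rawmquo : rawmod O.
Proof.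
apply: (@RawMod X O (fun U => M U) (fun U V h => @mres _ _ M U V h)
  (fun U x y => comb J (x - y)) (fun U => 0)
  (fun U x y => x + y) (fun U a x => a *: x)).
- by move=> U x; apply: comb_eq.
- by move=> U x y c; rewrite -opprB -scaleN1r; exact: combZ.
- by move=> U x y z c d; rewrite -(subrKA y); exact: combD.
- by move=> U x x' y y' c d; rewrite opprD addrACA; exact: combD.
- by move=> U a x x' c; rewrite -scalerBr; exact: combZ.
- by move=> U V h x x' c; rewrite -mresB; exact: comb_res.
- by move=> U x y z; apply: comb_eq; rewrite addrA.
- by move=> U x y; apply: comb_eq; rewrite addrC.
- by move=> U x; apply: comb_eq; rewrite add0r.
- by move=> U x; apply: comb_eq; rewrite scaleN1r addNr.
- by move=> U a b x; apply: comb_eq; rewrite scalerA.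
- by move=> U x; apply: comb_eq; rewrite scale1r.
- by move=> U a x y; apply: comb_eq; rewrite scalerDr.
- by move=> U a b x; apply: comb_eq; rewrite scalerDl.
- by move=> U h x; apply: comb_eq; rewrite mres_id.
- by move=> U V W h k l x; apply: comb_eq; rewrite (mres_comp h k l).
- by move=> U V h; apply: comb_eq; rewrite mres0.
- by move=> U V h x y; apply: comb_eq; rewrite mresD.
- by move=> U V h a x; apply: comb_eq; rewrite mresZ.
Defined.

Definition mquo : mpsh O := sheafify rawmquo.
Definition mquo_proj U (x : M U) : mquo U := shunit (P := rawmquo) x.

End ModQuotient.

Section AlgQuotient.
Variables (A : alg O) (J : forall U, A U -> Prop).

Definition ideal_gen U (x : A U) : Prop :=
  exists V (h : U <<= V) (j : A V) (y z : A U),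
    J j /\ x = mul (mul y (mres h j)) z.

Lemma mul_linl U a (x y z : A U) :
  mul (a *: x + y) z = a *: mul x z + mul y z.
Proof. exact: amulDl. Qed.

Lemma mul_linr U a (x y z : A U) :
  mul z (a *: x + y) = a *: mul z x + mul z y.
Proof. exact: amulDr. Qed.

Lemma mul0l U (z : A U) : mul 0 z = 0.
Proof.
have := mul_linl 1 0 0 z; rewrite scaler0 addr0 scale1r => e.
by apply: (@addrI _ (mul 0 z)); rewrite -e addr0.
Qed.

Lemma mul0r U (z : A U) : mul z 0 = 0.
Proof.
have := mul_linr 1 0 0 z; rewrite scaler0 addr0 scale1r => e.
by apply: (@addrI _ (mul z 0)); rewrite -e addr0.
Qed.

Lemma mul_subl U (x y z : A U) : mul (x - y) z = mul x z - mul y z.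
Proof. by rewrite addrC -scaleN1r mul_linl scaleN1r addrC. Qed.

Lemma mul_subr U (x y z : A U) : mul z (x - y) = mul z x - mul z y.
Proof. by rewrite addrC -scaleN1r mul_linr scaleN1r addrC. Qed.

Lemma mul_res U V (h : V <<= U) (x y : A U) :
  mres h (mul x y) = mul (mres h x) (mres h y).
Proof. exact: aresM. Qed.

Lemma comb_idl U (x y : A U) : comb ideal_gen x -> comb ideal_gen (mul y x).
Proof.
elim=> [|V h a j z Jj _ IH]; first by rewrite mul0r; constructor.
rewrite mul_linr; have [W [k [j' [u [v [J' ->]]]]]] := Jj.
have l : U <<= W by move=> p /h /k.
rewrite -(mres_id (@sub_refl _ U) (mul y _)); constructor=> //.
exists W, l, j', (mul y (mres h u)), (mres h v); split=> //.
by rewrite !mul_res (mres_comp k h l) /mul !amulA.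
Qed.

Lemma comb_idr U (x y : A U) : comb ideal_gen x -> comb ideal_gen (mul x y).
Proof.
elim=> [|V h a j z Jj _ IH]; first by rewrite mul0l; constructor.
rewrite mul_linl; have [W [k [j' [u [v [J' ->]]]]]] := Jj.
have l : U <<= W by move=> p /h /k.
rewrite -(mres_id (@sub_refl _ U) (mul (mres h _) y)); constructor=> //.
exists W, l, j', (mres h u), (mul (mres h v) y); split=> //.
by rewrite !mul_res (mres_comp k h l) /mul !amulA.
Qed.

Let Q := rawmquo ideal_gen.

Lemma quo_refl U (x : Q U) : weq x x. Proof. exact: weq_refl. Qed.

Definition rawquo : rawalg O.
Proof.
apply: (@RawAlg X O Q (one A) (@mul _ _ A)).
- move=> U x x' y y' c d /=; rewrite -(subrKA (mul x' y)); apply: combD.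
    by rewrite -mul_subl; exact: comb_idr.
  by rewrite -mul_subr; exact: comb_idl.
- by move=> U x y z; rewrite /mul amulA; exact: quo_refl.
- by move=> U x; rewrite /mul amul1l; exact: quo_refl.
- by move=> U x; rewrite /mul amul1r; exact: quo_refl.
- by move=> U a x y z ; apply: comb_eq; rewrite mul_linl.
- by move=> U a x y z ; apply: comb_eq; rewrite mul_linr.
- by move=> U V h ; apply: comb_eq; exact: ares1.
- by move=> U V h x y ; apply: comb_eq; exact: mul_res.
Defined.

Definition quo : alg O := sheafify_alg rawquo.

Definition quo_app U (x : A U) : quo U := shunit (P := rawquo) x.

Lemma quo_lin U a (x y : A U) : quo_app (a *: x + y) = a *: quo_app x + quo_app y.
Proof. by rewrite /quo_app -shunitZ -shunitD. Qed.

Lemma quo_nat U V (h : V <<= U) (x : A U) : quo_app (mres h x) = mres h (quo_app x).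
Proof. by rewrite /quo_app -[RHS]shunit_res. Qed.

Definition quo_proj : hom A quo := Hom quo_lin quo_nat.

End AlgQuotient.

(* The subsheaf of an algebra A generated by the i-fold products of sections
   coming from M: the component of degree i when A is a graded quotient of T(M). *)
Section Degree.
Variables (M : mpsh O) (A : alg O) (j : hom M A).

Definition mprod U (w : seq (M U)) : A U :=
  foldr (fun v x => mul (j U v) x) (one A U) w.

Definition deg (i : nat) : mpsh O :=
  span (fun U x => exists2 w : seq (M U), size w = i & x = mprod w).

End Degree.

End Quotients.

(* The dual sheaf Hom(L, O): a section over U is a morphism L|U -> O|U. *)
Section Dual.
Variables (X : topologicalType) (O : rpsh X) (L : mpsh O).

Record dsec (U : opn X) := DSec {
  dapp : forall V : opn X, V <<= U -> L V -> O V;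
  dlin : forall V (h : V <<= U) a x y, dapp h (a *: x + y) = a * dapp h x + dapp h y;
  dnat : forall V W (h : V <<= U) (k : W <<= V) (l : W <<= U) x,
    dapp l (mres k x) = rres O k (dapp h x) }.

HB.instance Definition _ U := gen_eqMixin (dsec U).
HB.instance Definition _ U := gen_choiceMixin (dsec U).

Lemma dsec_eq U (f g : dsec U) :
  (forall V (h : V <<= U) x, dapp f h x = dapp g h x) -> f = g.
Proof.
move=> H; have E : dapp f = dapp g.
  apply: functional_extensionality_dep => V.
  apply: functional_extensionality_dep => h; apply/funext => x; exact: H.
case: f g E {H} => f a b [g c d] /= E; subst g.
by congr DSec; exact: Prop_irrelevance.
Qed.

Definition dadd U (f g : dsec U) : dsec U.
Proof.
exists (fun V h x => dapp f h x + dapp g h x).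
- by move=> V h a x y; rewrite !dlin mulrDr addrACA.
- by move=> V W h k l x; rewrite !(dnat _ h k l) rmorphD.
Defined.

Definition dscale U (c : O U) (f : dsec U) : dsec U.
Proof.
exists (fun V h x => rres O h c * dapp f h x).
- by move=> V h a x y; rewrite dlin mulrDr mulrCA.
- by move=> V W h k l x; rewrite (dnat _ h k l) rmorphM (rres_comp h k l).
Defined.

Definition dzero U : dsec U.
Proof.
exists (fun V h x => 0).
- by move=> V h a x y; rewrite mulr0 addr0.
- by move=> V W h k l x; rewrite rmorph0.
Defined.

Lemma daddA U : associative (@dadd U).
Proof. by move=> f g k; apply: dsec_eq => V h x /=; rewrite addrA. Qed.
Lemma daddC U : commutative (@dadd U).
Proof. by move=> f g; apply: dsec_eq => V h x /=; rewrite addrC. Qed.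
Lemma dadd0 U : left_id (dzero U) (@dadd U).
Proof. by move=> f; apply: dsec_eq => V h x /=; rewrite add0r. Qed.
Lemma daddN U : left_inverse (dzero U) (@dscale U (- 1)) (@dadd U).
Proof.
by move=> f; apply: dsec_eq => V h x /=; rewrite rmorphN1 mulN1r addNr.
Qed.

HB.instance Definition _ U :=
  GRing.isZmodule.Build (dsec U) (@daddA U) (@daddC U) (@dadd0 U) (@daddN U).

Lemma dscaleA U (a b : O U) (f : dsec U) : dscale a (dscale b f) = dscale (a * b) f.
Proof. by apply: dsec_eq => V h x /=; rewrite rmorphM mulrA. Qed.
Lemma dscale1 U : left_id (1 : O U) (@dscale U).
Proof. by move=> f; apply: dsec_eq => V h x /=; rewrite rmorph1 mul1r. Qed.
Lemma dscaleDr U : right_distributive (@dscale U) +%R.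
Proof. by move=> a f g; apply: dsec_eq => V h x /=; rewrite mulrDr. Qed.
Lemma dscaleDl U (f : dsec U) : {morph (@dscale U)^~ f : a b / a + b >-> a + b}.
Proof. by move=> a b; apply: dsec_eq => V h x /=; rewrite rmorphD mulrDl. Qed.

HB.instance Definition _ U :=
  GRing.Zmodule_isLmodule.Build (O U) (dsec U) (@dscaleA U) (@dscale1 U)
    (@dscaleDr U) (@dscaleDl U).

Lemma dsub_trans (U V W : opn X) : W <<= V -> V <<= U -> W <<= U.
Proof. by move=> h k x /h /k. Qed.

Definition dres U V (h : V <<= U) (f : dsec U) : dsec V.
Proof.
exists (fun W (k : W <<= V) x => dapp f (dsub_trans k h) x).
- by move=> W k a x y; rewrite dlin.
- by move=> W W' k l m x; exact: dnat.
Defined.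

Lemma dres_lin U V (h : V <<= U) a (f g : dsec U) :
  dres h (a *: f + g) = rres O h a *: dres h f + dres h g.
Proof. by apply: dsec_eq => W k x /=; rewrite (rres_comp h k (dsub_trans k h)). Qed.

Lemma dres_id U (h : U <<= U) (f : dsec U) : dres h f = f.
Proof.
by apply: dsec_eq => W k x /=; rewrite (Prop_irrelevance (dsub_trans k h) k).
Qed.

Lemma dres_comp U V W (h : V <<= U) (k : W <<= V) (l : W <<= U) (f : dsec U) :
  dres k (dres h f) = dres l f.
Proof.
apply: dsec_eq => W' m x /=; congr (dapp f _ x); exact: Prop_irrelevance.
Qed.

Definition dual : mpsh O := MPsh dres_lin dres_id dres_comp.

Definition ev U (f : dual U) (x : L U) : O U := dapp (f : dsec U) (@sub_refl _ U) x.

End Dual.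

(* The colimit of F 0 -> F 1 -> F 2 -> ...: the sheaf associated with the direct
   sum of the F m modulo the relations x = tau m x. *)
Section Colimit.
Variables (X : topologicalType) (O : rpsh X).
Variables (F : nat -> mpsh O) (tau : forall m, hom (F m) (F m.+1)).

Definition csec U := {m : nat & F m U}.
Definition cgen U m (x : F m U) : csec U := existT (fun m => F m U : Type) m x.

Inductive colim_rel U : mterm (O U) (csec U) -> mterm (O U) (csec U) -> Prop :=
| colim_lin m a (x y : F m U) : colim_rel (Tgen (cgen (a *: x + y)))
    (Tadd (Tscale a (Tgen (cgen x))) (Tgen (cgen y)))
| colim_tau m (x : F m U) : colim_rel (Tgen (cgen x)) (Tgen (cgen (tau m U x))).

Definition colim_pres : pres O.
Proof.
apply: (@Pres X O csec (fun U V h x => cgen (mres h (projT2 x))) colim_rel).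
- by move=> U h [m x] /=; rewrite mres_id.
- by move=> U V W h k l [m x] /=; rewrite (mres_comp h k l).
- move=> U V h s t [m a x y|m x] /=; first by rewrite mres_lin; constructor.
  by rewrite -hnat; constructor.
Defined.

Definition colim : mpsh O := presented colim_pres.
Definition cin m U (x : F m U) : colim U := pgenerator (G := colim_pres) (cgen x).

End Colimit.

Section Clifford.
Variables (X : topologicalType) (O : rpsh X) (E L : mpsh O).

Record quad_form := QuadForm {
  qapp :> forall U, E U -> L U;
  qnat : forall U V (h : V <<= U) (v : E U), qapp (mres h v) = mres h (qapp v);
  qscale : forall U a (v : E U), qapp (a *: v) = a ^+ 2 *: qapp v;
  qbilinl : forall U a (u v w : E U),
    let b x y := qapp (x + y) - qapp x - qapp y in
    b (a *: u + v) w = a *: b u w + b v w;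
  qbilinr : forall U a (u v w : E U),
    let b x y := qapp (x + y) - qapp x - qapp y in
    b w (a *: u + v) = a *: b w u + b w v }.

Variable q : quad_form.

Definition EEL : mpsh O := tens (tens E E) (dual L).

Definition pure U (u v : E U) (f : dual L U) : talg EEL U :=
  tin EEL U (ten (ten u v) f).

Definition J1 U (x : talg EEL U) : Prop :=
  exists (v : E U) (f : dual L U),
    x = pure v v f - ev f (q U v) *: one (talg EEL) U.

Definition J2 U (x : talg EEL U) : Prop :=
  exists (u v w : E U) (f g : dual L U),
    x = mul (pure u v f) (pure v w g) - ev f (q U v) *: pure u w g.

Definition C0 : alg O := quo (fun U x => @J1 U x \/ @J2 U x).

(* E (x) E is realized as the degree 2 part of the tensor algebra. *)

Definition T2 : mpsh O := deg (tin E) 2.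

Definition is_square U (s : T2 U) : Prop :=
  exists v : E U, spval s = mul (tin E U v) (tin E U v).

Definition S2 : mpsh O := span is_square.

(* The O-linear form S_2 E -> L of q, v (x) v |-> q(v): as S_2 E is generated by
   squares it is unique, and it exists when E is locally free. *)
Definition q2 : hom S2 L :=
  the (hom0 S2 L) (fun g => forall U (v : E U) (s : S2 U),
    spval (spval s) = mul (tin E U v) (tin E U v) -> g U s = q U v).

Definition I2 U (x : talg E U) : Prop :=
  exists s : S2 U, q2 U s = 0 /\ x = spval (spval s).

Definition B : alg O := quo I2.
Definition piB : hom (talg E) B := quo_proj I2.

Definition Bin_app U (v : E U) : B U := piB U (tin E U v).

Lemma Bin_lin U a (x y : E U) : Bin_app (a *: x + y) = a *: Bin_app x + Bin_app y.
Proof. by rewrite /Bin_app !hlin. Qed.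

Lemma Bin_nat U V (h : V <<= U) (x : E U) : Bin_app (mres h x) = mres h (Bin_app x).
Proof. by rewrite /Bin_app !hnat. Qed.

Definition Bin : hom E B := Hom Bin_lin Bin_nat.

Definition Bdeg (i : nat) : mpsh O := deg Bin i.

Definition wedge2 : mpsh O := mquo is_square.

(* The morphism of exact sequences
     0 -> S_2 E -> T^2(E) -> wedge^2 E -> 0
           | q       |          ||
     0 ->  L   ->   B_2   -> wedge^2 E -> 0
   with T^2(E) -> B_2 the projection.  As the left square commutes and the lower
   row is exact, such data exist exactly when q : S_2 E -> L is surjective. *)
Record B2_sequence := B2Sequence {
  iota : hom L (Bdeg 2);
  wp : hom (Bdeg 2) wedge2;
  iota_q2 : forall U (s : S2 U), spval (iota U (q2 U s)) = piB U (spval (spval s));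
  wp_piB : forall U (t : T2 U) (b : Bdeg 2 U),
    spval b = piB U (spval t) -> wp U b = mquo_proj is_square t;
  iota_inj : forall U, injective (iota U);
  iota_wp : forall U (b : Bdeg 2 U), wp U b = 0 <-> exists l, iota U l = b;
  wp_surj : forall U (w : wedge2 U),
    locally (fun W (h : W <<= U) => exists b : Bdeg 2 W, wp W b = mres h w) }.

Variable Bs : B2_sequence.

(* B_{2m} (x) (L^vee)^{(x) m}, with the tensor power of the dual realized as the
   degree m part of its tensor algebra. *)
Definition Tdual (m : nat) : mpsh O := deg (tin (dual L)) m.
Definition F (m : nat) : mpsh O := tens (Bdeg m.*2) (Tdual m).

(* The canonical morphism
     B_{2m} (x) (L^vee)^{(x) m} = B_{2m} (x) L (x) (L^vee)^{(x) m+1}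
       -> B_{2m+2} (x) (L^vee)^{(x) m+1},
   the equality being the evaluation isomorphism L (x) L^vee = O and the arrow
   being multiplication by L: it sends f(l) b (x) phi to b l (x) (phi (x) f). *)
Definition tau (m : nat) : hom (F m) (F m.+1) :=
  the (hom0 (F m) (F m.+1)) (fun g => forall U (b : Bdeg m.*2 U) (phi : Tdual m U)
      (l : L U) (f : dual L U) (b' : Bdeg m.+1.*2 U) (phi' : Tdual m.+1 U),
    spval b' = mul (spval b) (spval (iota Bs U l)) ->
    spval phi' = mul (spval phi) (tin (dual L) U f) ->
    g U (ev f l *: ten b phi) = ten b' phi').

Definition B0 : mpsh O := colim tau.

Definition B0in (m : nat) U (b : Bdeg m.*2 U) (phi : Tdual m U) : B0 U :=
  cin (m := m) tau (ten b phi).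

(* The algebra structure on the colimit is the one induced from B.  There is at
   most one such structure, as B0 is locally generated by the sections B0in. *)
Definition induced_from_B (s : alg_struct B0) : Prop :=
  (forall U (b : Bdeg 0 U) (phi : Tdual 0 U),
     spval b = one B U -> spval phi = one (talg (dual L)) U ->
     aone s U = B0in (m := 0) b phi) /\
  (forall U m k (b : Bdeg m.*2 U) (phi : Tdual m U) (c : Bdeg k.*2 U)
      (psi : Tdual k U) (b' : Bdeg (m + k).*2 U) (phi' : Tdual (m + k) U),
     spval b' = mul (spval b) (spval c) -> spval phi' = mul (spval phi) (spval psi) ->
     amul s (B0in b phi) (B0in c psi) = B0in b' phi').

End Clifford.

(* Main.v *)
From HB Require Import structures.
From mathcomp Require Import all_boot all_algebra.
From mathcomp Require Import all_classical topology.
Require Import Defs.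

(* The word (u (x) v (x) f) goes to the class of uv (x) f in B_2 (x) L^vee; this
   respects the relations J1 and J2 because the square of v in B is the image of q(v)
   under L -> B_2, because L is central in B, and because the tensor algebra of L^vee
   is commutative.  In the other direction u_1 v_1 ... u_m v_m (x) f_1 ... f_m goes to
   the product of the u_i v_i f_i: inside a word, a square at an even position is removed
   by J1 and a square at an odd position by J2, so this factors through B.  The two maps
   are inverse to each other on generators.

   Centrality of L: exactness of the two rows forces q(E) to generate L locally.  Let z
   be the image in B of a local generator of L and write q(v) also for the coordinate
   of q(v), so that v^2 = q(v) z.  From vw + wv = b(v,w) z and q(v)[z,v] = [v^2,v] = 0
   one gets q(v)^2 [z,w] = 0 for all v, w, and the q(v) generate the unit ideal. *)

Set Implicit Arguments.
Unset Strict Implicit.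
Unset Printing Implicit Defensive.

Import GRing.Theory.
Local Open Scope classical_set_scope.
Local Open Scope ring_scope.

(** * Gluing and local generation *)

(** [q2] and [tau] are given by definite description with the zero map as default, so nothing can be
    used about them before a map as described is shown to exist. For [q2] this comes out of
    exactness of the rows; for [tau] it comes from gluing local maps attached to trivializations of
    [L].

    The delicate direction is from B_0 to C_0. A homogeneous component of [B] is a subsheaf of [B],
    not a sheaf given by generators and relations, so a map on it cannot be prescribed by its values
    on words. The formula on words is therefore extended by zero to words of all lengths, which
    yields a bilinear pairing of the full algebras T(E) and T(L^vee). It descends to [B] in the
    first variable and is only then restricted to components.

    In the argument for centrality no single q(v) need be a unit or a nonzerodivisor, so q(v)[z,v] =
    0 cannot be simplified. It is used after multiplying by q(v) once more, and the resulting
    squares are cancelled all together at the end. *)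

Section Sheaves.
Variables (X : topologicalType) (O : rpsh X).
Implicit Types (M N K : mpsh O) (U V W : opn X).

Lemma mres_irr M U V (h k : V <<= U) (x : M U) : mres h x = mres k x.
Proof. by rewrite (Prop_irrelevance h k). Qed.

(** Cover [U] by all opens on which [x] and [y] agree. Both amalgamate the family of restrictions of
    [x], so the uniqueness half of the sheaf axiom identifies them. *)
Lemma sheaf_sep M (sM : is_sheaf M) U (x y : M U) :
  locally (fun W (h : W <<= U) => mres h x = mres h y) -> x = y.
Proof.
move=> H; pose I := {W : opn X | exists h : W <<= U, mres h x = mres h y}.
have CU (i : I) : sval i <<= U by case: i => W [].
have cov u : U u -> exists i : I, sval i u.
  move=> /H[W [h [Wu e]]].
  by exists (exist _ W (ex_intro (fun h : W <<= U => _) h e)).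
have cmp (i j : I) W (hi : W <<= sval i) (hj : W <<= sval j) :
    mres hi (mres (CU i) x) = mres hj (mres (CU j) x).
  have l : W <<= U by move=> u /hi /CU.
  by rewrite !(@mres_comp _ _ _ _ _ _ _ _ l).
have [t [_ tu]] := sM U I _ CU cov _ cmp.
have <- : t = x by apply: tu.
apply: tu => i; have [h e] : exists h : sval i <<= U, mres h x = mres h y.
  by case: (i).
by rewrite (mres_irr _ h) -e; exact: mres_irr.
Qed.

(** The cover is indexed by all pairs of an open set and a section there satisfying [R], so no local
    sections have to be chosen. [R] acts as a functional relation that is defined only locally. *)
Lemma glue M (sM : is_sheaf M) U (R : forall V, M V -> Prop) :
  (forall u, U u -> exists V (n : M V), [/\ V u, V <<= U & R V n]) ->
  (forall V W (k : W <<= V) (n : M V), R V n -> R W (mres k n)) ->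
  (forall V (n n' : M V), V <<= U -> R V n -> R V n' -> n = n') ->
  exists t : M U, forall V (h : V <<= U) (n : M V), R V n -> mres h t = n.
Proof.
move=> ex res uniq.
pose I := {V : opn X & {n : M V | V <<= U /\ R V n}}.
have CU (i : I) : projT1 i <<= U by case: i => V [n []].
have cov u : U u -> exists i : I, projT1 i u.
  by move=> /ex[V [n [Vu VU r]]]; exists (existT _ V (exist _ n (conj VU r))).
have cmp (i j : I) W (hi : W <<= projT1 i) (hj : W <<= projT1 j) :
    mres hi (sval (projT2 i)) = mres hj (sval (projT2 j)).
  apply: uniq; first by move=> u /hi /CU.
    by apply: res; case: (i) => V [n []].
  by apply: res; case: (j) => V [n []].
have [t [ht _]] := sM U I _ CU cov _ cmp; exists t => V h n r.
by have := ht (existT _ V (exist _ n (conj h r))); rewrite (mres_irr _ h).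
Qed.

Lemma locally_all U (Q : forall W, W <<= U -> Prop) :
  (forall W (h : W <<= U), Q W h) -> locally Q.
Proof. by move=> H u Uu; exists U, (@sub_refl _ U). Qed.

Lemma hom_add M N (f : hom M N) U (x y : M U) : f U (x + y) = f U x + f U y.
Proof. by have := hlin f 1 x y; rewrite !scale1r. Qed.

Lemma hom_zero M N (f : hom M N) U : f U 0 = 0.
Proof. by apply: (@addrI _ (f U 0)); rewrite -hom_add !addr0. Qed.

Lemma hom_scale M N (f : hom M N) U a (x : M U) : f U (a *: x) = a *: f U x.
Proof. by have := hlin f a x 0; rewrite hom_zero !addr0. Qed.

Lemma hom_sub M N (f : hom M N) U (x y : M U) : f U (x - y) = f U x - f U y.
Proof. by rewrite -scaleN1r hom_add hom_scale scaleN1r. Qed.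

(** Kept apart from morphisms out of [tens]: products and the pairing of words take arguments in
    sheaves presented in different ways, and in this form they can be built and compared on pairs of
    generators. *)
Record bil M N K := Bil {
  bapp :> forall U, M U -> N U -> K U;
  blinl : forall U a (x x' : M U) (y : N U),
    bapp (a *: x + x') y = a *: bapp x y + bapp x' y;
  blinr : forall U a (x : M U) (y y' : N U),
    bapp x (a *: y + y') = a *: bapp x y + bapp x y';
  bnat : forall U V (h : V <<= U) (x : M U) (y : N U),
    bapp (mres h x) (mres h y) = mres h (bapp x y) }.

Lemma bil_addl M N K (b : bil M N K) U (x x' : M U) (y : N U) :
  b U (x + x') y = b U x y + b U x' y.
Proof. by have := blinl b 1 x x' y; rewrite !scale1r. Qed.

Lemma bil_addr M N K (b : bil M N K) U (x : M U) (y y' : N U) :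
  b U x (y + y') = b U x y + b U x y'.
Proof. by have := blinr b 1 x y y'; rewrite !scale1r. Qed.

Lemma bil0l M N K (b : bil M N K) U (y : N U) : b U 0 y = 0.
Proof. by apply: (@addrI _ (b U 0 y)); rewrite -bil_addl !addr0. Qed.

Lemma bil0r M N K (b : bil M N K) U (x : M U) : b U x 0 = 0.
Proof. by apply: (@addrI _ (b U x 0)); rewrite -bil_addr !addr0. Qed.

Lemma bil_scalel M N K (b : bil M N K) U a (x : M U) (y : N U) :
  b U (a *: x) y = a *: b U x y.
Proof. by have := blinl b a x 0 y; rewrite bil0l !addr0. Qed.

Lemma bil_scaler M N K (b : bil M N K) U a (x : M U) (y : N U) :
  b U x (a *: y) = a *: b U x y.
Proof. by have := blinr b a x y 0; rewrite bil0r !addr0. Qed.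

(** * Maps out of associated sheaves, in two variables and in one *)

Section Lift2.
Variables (P P' : rawmod O) (N : mpsh O) (sN : is_sheaf N).
Variable e : forall U, P U -> P' U -> N U.
Hypothesis e_eq : forall U (x x' : P U) (y y' : P' U),
  weq x x' -> weq y y' -> e x y = e x' y'.
Hypothesis e_res : forall U V (h : V <<= U) (x : P U) (y : P' U),
  e (wres h x) (wres h y) = mres h (e x y).

(** Representatives of one section agree only locally, so the raw values [e x y] do so as well.
    Separatedness of [N] turns this into the uniqueness that [glue] asks for. *)
Lemma lift2_ex U (F : shsec P U) (G : shsec P' U) :
  exists n : N U, forall V (h : V <<= U) (x : P V) (y : P' V),
    rep F x -> rep G y -> mres h n = e x y.
Proof.
pose R V (n : N V) := exists x y, [/\ rep F x, rep G y & n = e x y].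
have [] := @glue N sN U R.
- move=> u Uu; have [V [x [Vu Fx]]] := rep_ex F Uu.
  have [W [y [Wu Gy]]] := rep_ex G Uu.
  exists (oI V W), (e (wres (@oI_l _ V W) x) (wres (@oI_r _ V W) y)).
  split=> //; first by move=> w [/(rep_sub Fx)].
  by exists (wres (@oI_l _ V W) x), (wres (@oI_r _ V W) y); split=> //;
    exact: rep_res.
- move=> V W k _ [x [y [Fx Gy ->]]]; exists (wres k x), (wres k y).
  by rewrite e_res; split=> //; exact: rep_res.
- move=> V n n' VU [x [y [Fx Gy ->]]] [x' [y' [Fx' Gy' ->]]].
  apply: (sheaf_sep sN) => u Vu.
  have [W [h [Wu exx]]] := rep_uniq Fx Fx' Vu.
  have [W' [h' [Wu' eyy]]] := rep_uniq Gy Gy' Vu.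
  have l : oI W W' <<= V by move=> w [/h].
  exists (oI W W'), l; split=> //.
  rewrite -!e_res; apply: e_eq.
    apply: (weq_trans (weq_sym (wres_comp h (@oI_l _ _ _) l x))).
    apply: (weq_trans (weq_res _ exx)); exact: wres_comp.
  apply: (weq_trans (weq_sym (wres_comp h' (@oI_r _ _ _) l y))).
  apply: (weq_trans (weq_res _ eyy)); exact: wres_comp.
- by move=> t ht; exists t => V h x y Fx Gy; apply: ht; exists x, y.
Qed.

Definition lift2 U (F : sheafify P U) (G : sheafify P' U) : N U :=
  projT1 (cid (lift2_ex F G)).

Lemma lift2P U (F : sheafify P U) (G : sheafify P' U) V (h : V <<= U) x y :
  rep F x -> rep G y -> mres h (lift2 F G) = e (x : P V) y.
Proof. exact: (projT2 (cid (lift2_ex F G))). Qed.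

Lemma lift2_unit U (x : P U) (y : P' U) :
  lift2 (shunit x : sheafify P U) (shunit y : sheafify P' U) = e x y.
Proof.
rewrite -(lift2P (@sub_refl _ U) (rep_shunitP x) (rep_shunitP y)).
by rewrite mres_id.
Qed.

Lemma lift2_nat U V (h : V <<= U) (F : sheafify P U) (G : sheafify P' U) :
  lift2 (mres h F) (mres h G) = mres h (lift2 F G).
Proof.
apply: (sheaf_sep sN) => u Vu.
have [W [x [Wu Fx]]] := rep_ex (mres h F : shsec P V) Vu.
have [W' [y [Wu' Gy]]] := rep_ex (mres h G : shsec P' V) Vu.
have WV := rep_sub Fx; have l : oI W W' <<= V by move=> w [/WV].
have m : oI W W' <<= U by move=> w /l /h.
exists (oI W W'), l; split=> //; rewrite (mres_comp h l m).
have Fx' := rep_res (@oI_l _ W W') Fx; have Gy' := rep_res (@oI_r _ W W') Gy.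
rewrite (lift2P l Fx' Gy'); symmetry; apply: lift2P.
  by move/rep_shres: Fx' => [].
by move/rep_shres: Gy' => [].
Qed.

Hypothesis e_linl : forall U a (x x' : P U) (y : P' U),
  e (wadd (wscale a x) x') y = a *: e x y + e x' y.

Lemma lift2_linl U a (F F' : sheafify P U) (G : sheafify P' U) :
  lift2 (a *: F + F') G = a *: lift2 F G + lift2 F' G.
Proof.
apply: (sheaf_sep sN) => u Uu.
have [V [x [x' [Vu VU Fx Fx']]]] := rep2_ex F F' Uu.
have [W [y [Wu Gy]]] := rep_ex G Uu.
have l : oI V W <<= U by move=> w [/VU].
exists (oI V W), l; split=> //.
have Fx1 := rep_res (@oI_l _ V W) Fx; have Fx1' := rep_res (@oI_l _ V W) Fx'.
have Gy1 := rep_res (@oI_r _ V W) Gy.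
rewrite mres_lin (lift2P l Fx1 Gy1) (lift2P l Fx1' Gy1) -e_linl.
apply: lift2P => //; apply: (rep_add _ Fx1' (weq_refl _)).
exact: (rep_scale (h := l) Fx1 (weq_refl _)).
Qed.

Hypothesis e_linr : forall U a (x : P U) (y y' : P' U),
  e x (wadd (wscale a y) y') = a *: e x y + e x y'.

Lemma lift2_linr U a (F : sheafify P U) (G G' : sheafify P' U) :
  lift2 F (a *: G + G') = a *: lift2 F G + lift2 F G'.
Proof.
apply: (sheaf_sep sN) => u Uu.
have [V [y [y' [Vu VU Gy Gy']]]] := rep2_ex G G' Uu.
have [W [x [Wu Fx]]] := rep_ex F Uu.
have l : oI V W <<= U by move=> w [/VU].
exists (oI V W), l; split=> //.
have Gy1 := rep_res (@oI_l _ V W) Gy; have Gy1' := rep_res (@oI_l _ V W) Gy'.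
have Fx1 := rep_res (@oI_r _ V W) Fx.
rewrite mres_lin (lift2P l Fx1 Gy1) (lift2P l Fx1 Gy1') -e_linr.
apply: lift2P => //; apply: (rep_add _ Gy1' (weq_refl _)).
exact: (rep_scale (h := l) Gy1 (weq_refl _)).
Qed.

Definition lift_bil : bil (sheafify P) (sheafify P') N :=
  Bil lift2_linl lift2_linr lift2_nat.

End Lift2.

Section Lift1.
Variables (P : rawmod O) (N : mpsh O) (sN : is_sheaf N).
Variable e : forall U, P U -> N U.
Hypothesis e_eq : forall U (x x' : P U), weq x x' -> e x = e x'.
Hypothesis e_res : forall U V (h : V <<= U) (x : P U), e (wres h x) = mres h (e x).
Hypothesis e_lin : forall U a (x x' : P U),
  e (wadd (wscale a x) x') = a *: e x + e x'.

(** The one-variable lift is the two-variable one with a dummy second argument, which is then fed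
    the section [0]. *)
Let e2 U (x _ : P U) := e x.
Let e2_eq U (x x' y y' : P U) (c : weq x x') (_ : weq y y') : e2 x y = e2 x' y' :=
  e_eq c.
Let e2_res U V (h : V <<= U) (x y : P U) : e2 (wres h x) (wres h y) = mres h (e2 x y) :=
  e_res h x.

Definition lift1 U (F : sheafify P U) : N U := lift2 sN e2_eq e2_res F (0 : sheafify P U).

Lemma lift1_lin U a (F F' : sheafify P U) : lift1 (a *: F + F') = a *: lift1 F + lift1 F'.
Proof. by apply: lift2_linl => V b x x' y; exact: e_lin. Qed.

Lemma lift1_nat U V (h : V <<= U) (F : sheafify P U) :
  lift1 (mres h F) = mres h (lift1 F).
Proof. by rewrite /lift1 -lift2_nat mres0. Qed.

Definition lift_hom : hom (sheafify P) N := Hom lift1_lin lift1_nat.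

Lemma lift_hom_unit U (x : P U) : lift_hom U (shunit x) = e x.
Proof. exact: (lift2_unit sN e2_eq e2_res x (wzero P U)). Qed.

End Lift1.

Lemma sheafify_locE (P : rawmod O) U (F : sheafify P U) :
  locally (fun W (h : W <<= U) => exists x : P W, mres h F = shunit x).
Proof.
move=> u Uu; have [V [x [Vu Fx]]] := rep_ex F Uu.
exists V, (rep_sub Fx); split=> //; exists x.
apply: shsec_eq => v Vv; exists V, x; split=> //; last exact: rep_shunitP.
by apply/(rep_shres (rep_sub Fx) F); split.
Qed.

Lemma shunit_loc_eq (P : rawmod O) U (x y : P U) :
  shunit x = shunit y -> loc_eq x y.
Proof.
by move=> e; apply: (rep_uniq (rep_shunitP x)); rewrite e; exact: rep_shunitP.
Qed.

(** * Local generators and induction over them *)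

Definition gens M (J : forall U, M U -> Prop) : Prop := forall U (x : M U), in_span J x.

Lemma in_span_local M (J : forall U, M U -> Prop) U (x : M U) :
  locally (fun W (h : W <<= U) => in_span J (mres h x)) -> in_span J x.
Proof.
move=> H u Uu; have [V [h [Vu s]]] := H u Uu; have [W [k [Wu c]]] := s u Vu.
have l : W <<= U by move=> w /k /h.
by exists W, l; split=> //; rewrite -(mres_comp h k l).
Qed.

Lemma in_span_gen M (J : forall U, M U -> Prop) U (x : M U) : J U x -> in_span J x.
Proof.
move=> Jx; apply: locally_all => W h; rewrite -[mres h x]scale1r -[_ *: _]addr0.
by constructor=> //; constructor.
Qed.

(** Induction over a local linear combination of generators. The second hypothesis, locality of [Q],
    brings the conclusion back from the small opens on which such a combination exists; when [Q] is
    an identity in a sheaf, it is an instance of [sheaf_sep]. *)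
Lemma gen_ind M (J : forall U, M U -> Prop) (Q : forall U, M U -> Prop) :
  gens J ->
  (forall U (x : M U), locally (fun W (h : W <<= U) => Q W (mres h x)) -> Q U x) ->
  (forall U, Q U 0) ->
  (forall U a (x y : M U), Q U x -> Q U y -> Q U (a *: x + y)) ->
  (forall U V (h : V <<= U) (x : M U), J U x -> Q V (mres h x)) ->
  forall U (x : M U), Q U x.
Proof.
move=> gJ loc q0 ql qJ U x; apply: loc => u Uu; have [W [h [Wu c]]] := gJ U x u Uu.
exists W, h; split=> //; elim: c => // V k a j y Jj _ IH.
by apply: ql => //; exact: qJ.
Qed.

Lemma in_span_hom M N (J : forall U, M U -> Prop) (K : forall U, N U -> Prop)
    (f : hom M N) :
  gens J -> (forall U (x : M U), J U x -> in_span K (f U x)) ->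
  forall U (x : M U), in_span K (f U x).
Proof.
move=> gJ H; apply: (gen_ind gJ).
- move=> U x l; apply: in_span_local => u Uu; have [W [h [Wu s]]] := l u Uu.
  by exists W, h; rewrite -hnat.
- by move=> U; rewrite hom_zero; exact: in_span0.
- by move=> U a x y sx sy; rewrite hlin; exact: in_span_lin.
- by move=> U V h x Jx; rewrite hnat; apply: in_span_res; exact: H.
Qed.

Lemma hom_ext M N (sN : is_sheaf N) (J : forall U, M U -> Prop) (f g : hom M N) :
  gens J -> (forall U (x : M U), J U x -> f U x = g U x) ->
  forall U (x : M U), f U x = g U x.
Proof.
move=> gJ H; apply: (gen_ind gJ).
- move=> U x l; apply: (sheaf_sep sN) => u Uu; have [W [h [Wu e]]] := l u Uu.
  by exists W, h; rewrite -!hnat.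
- by move=> U; rewrite !hom_zero.
- by move=> U a x y ex ey; rewrite !hlin ex ey.
- by move=> U V h x Jx; rewrite !hnat H.
Qed.

Definition comp_hom M N K (g : hom N K) (f : hom M N) : hom M K.
Proof.
apply: (@Hom _ _ M K (fun U x => g U (f U x))).
- by move=> U a x y; rewrite !hlin.
- by move=> U V h x; rewrite !hnat.
Defined.

Definition id_hom M : hom M M :=
  @Hom _ _ M M (fun U x => x) (fun U a x y => erefl) (fun U V h x => erefl).

Definition span_incl M (J : forall U, M U -> Prop) : hom (span J) M :=
  @Hom _ _ (span J) M (@spval _ _ _ J) (fun U a x y => erefl) (fun U V h x => erefl).

Lemma span_is_sheaf M (J : forall U, M U -> Prop) : is_sheaf M -> is_sheaf (span J).
Proof.
move=> sM U I C CU cov s cmp.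
have cmp' i j W (hi : W <<= C i) (hj : W <<= C j) :
    mres hi (spval (s i)) = mres hj (spval (s j)).
  exact: (congr1 (@spval _ _ _ _ _) (cmp i j W hi hj)).
have [t [ht tu]] := sM U I C CU cov _ cmp'.
have pt : in_span J t.
  apply: in_span_local => u Uu; have [i Cu] := cov u Uu.
  by exists (C i), (CU i); rewrite ht; split=> //; exact: spvalP.
exists (SpSec pt); split; first by move=> i; apply: spval_inj; exact: ht.
move=> x hx; apply: spval_inj; apply: tu => i.
exact: (congr1 (@spval _ _ _ _ _) (hx i)).
Qed.

Lemma gens_span M (J : forall U, M U -> Prop) :
  @gens (span J) (fun U x => J U (spval x)).
Proof.
(* A combination in [M] lifts to [span J] term by term, because each tail of the sum again lies in
   the span. *)
have H U (c : M U) : comb J c -> forall x : span J U, spval x = c ->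
    comb (M := span J) (fun U x => J U (spval x)) x.
  elim=> [|V h a j y Jj cy IH] x ex.
    have -> : x = 0 by apply: spval_inj.
    by constructor.
  have py : in_span J y.
    by apply: locally_all => W k; exact: comb_res.
  have -> : x = a *: mres h (SpSec (in_span_gen Jj) : span J V) + SpSec py.
    exact: spval_inj.
  by constructor; last exact: IH.
move=> U x u Uu; have [W [h [Wu c]]] := spvalP x Uu.
by exists W, h; split=> //; exact: (H W _ c).
Qed.

End Sheaves.

(** * Homomorphisms out of presented sheaves *)

Section GenInd2.
Variables (X : topologicalType) (O : rpsh X) (M N : mpsh O).

Definition res_stable (M' : mpsh O) (J : forall U, M' U -> Prop) : Prop :=
  forall U V (h : V <<= U) (x : M' U), J U x -> J V (mres h x).

(** Two nested inductions: over [y] for a fixed generator [x], then over [x]. Shrinking the open set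
    restricts both arguments, so being a generator has to survive restriction. *)
Lemma gen_ind2 (J : forall U, M U -> Prop) (J' : forall U, N U -> Prop)
    (Q : forall U, M U -> N U -> Prop) :
  gens J -> gens J' -> res_stable J -> res_stable J' ->
  (forall U (x : M U) (y : N U),
     locally (fun W (h : W <<= U) => Q W (mres h x) (mres h y)) -> Q U x y) ->
  (forall U (y : N U), Q U 0 y) -> (forall U (x : M U), Q U x 0) ->
  (forall U a (x x' : M U) (y : N U), Q U x y -> Q U x' y -> Q U (a *: x + x') y) ->
  (forall U a (x : M U) (y y' : N U), Q U x y -> Q U x y' -> Q U x (a *: y + y')) ->
  (forall U (x : M U) (y : N U), J U x -> J' U y -> Q U x y) ->
  forall U (x : M U) (y : N U), Q U x y.
Proof.
move=> gJ gJ' sJ sJ' loc q0l q0r qll qlr qJ.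
have Q1 : forall U (y : N U) (x : M U), J U x -> Q U x y.
  apply: (gen_ind gJ').
  - move=> U y l x Jx; apply: loc => u Uu; have [W [h [Wu q]]] := l u Uu.
    by exists W, h; split=> //; apply: q; exact: sJ.
  - by move=> U x _.
  - by move=> U a y y' qy qy' x Jx; apply: qlr; [exact: qy|exact: qy'].
  - by move=> U V h y Jy x Jx; apply: qJ => //; exact: sJ'.
have Q2 : forall U (x : M U) (y : N U), Q U x y.
  apply: (gen_ind gJ).
  - move=> U x l y; apply: loc => u Uu; have [W [h [Wu q]]] := l u Uu.
    by exists W, h; split.
  - by [].
  - by move=> U a x x' qx qx' y; exact: qll.
  - by move=> U V h x Jx y; apply: Q1; exact: sJ.
exact: Q2.
Qed.

Lemma bil_span (K : mpsh O) (b : bil M N K) (J : forall U, M U -> Prop)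
    (J' : forall U, N U -> Prop) (L : forall U, K U -> Prop) :
  gens J -> gens J' -> res_stable J -> res_stable J' ->
  (forall U (x : M U) (y : N U), J U x -> J' U y -> in_span L (b U x y)) ->
  forall U (x : M U) (y : N U), in_span L (b U x y).
Proof.
move=> gJ gJ' sJ sJ' H; apply: (gen_ind2 gJ gJ' sJ sJ') => //.
- move=> U x y l; apply: in_span_local => u Uu; have [W [h [Wu s]]] := l u Uu.
  by exists W, h; rewrite -bnat.
- by move=> U y; rewrite bil0l; exact: in_span0.
- by move=> U x; rewrite bil0r; exact: in_span0.
- by move=> U a x x' y s s'; rewrite blinl; exact: in_span_lin.
- by move=> U a x y y' s s'; rewrite blinr; exact: in_span_lin.
Qed.

Lemma bil_ext (K : mpsh O) (sK : is_sheaf K) (b b' : bil M N K)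
    (J : forall U, M U -> Prop) (J' : forall U, N U -> Prop) :
  gens J -> gens J' -> res_stable J -> res_stable J' ->
  (forall U (x : M U) (y : N U), J U x -> J' U y -> b U x y = b' U x y) ->
  forall U (x : M U) (y : N U), b U x y = b' U x y.
Proof.
move=> gJ gJ' sJ sJ' H; apply: (gen_ind2 gJ gJ' sJ sJ') => //.
- move=> U x y l; apply: (sheaf_sep sK) => u Uu; have [W [h [Wu e]]] := l u Uu.
  by exists W, h; rewrite -!bnat.
- by move=> U y; rewrite !bil0l.
- by move=> U x; rewrite !bil0r.
- by move=> U a x x' y e e'; rewrite !blinl e e'.
- by move=> U a x y y' e e'; rewrite !blinr e e'.
Qed.

End GenInd2.

Section Precompose.
Variables (X : topologicalType) (O : rpsh X) (M M' N N' K : mpsh O).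

Definition bil_postcomp (g : hom K M') (b : bil M N K) : bil M N M'.
Proof.
apply: (@Bil _ _ M N M' (fun U x y => g U (b U x y))).
- by move=> U a x x' y; rewrite blinl hlin.
- by move=> U a x y y'; rewrite blinr hlin.
- by move=> U V h x y; rewrite bnat hnat.
Defined.

Definition bil_precompl (b : bil M N K) (f : hom M' M) : bil M' N K.
Proof.
apply: (@Bil _ _ M' N K (fun U x y => b U (f U x) y)).
- by move=> U a x x' y; rewrite hlin blinl.
- by move=> U a x y y'; rewrite blinr.
- by move=> U V h x y; rewrite hnat bnat.
Defined.

Definition bil_precompr (b : bil M N K) (f : hom N' N) : bil M N' K.
Proof.
apply: (@Bil _ _ M N' K (fun U x y => b U x (f U y))).
- by move=> U a x x' y; rewrite blinl.
- by move=> U a x y y'; rewrite hlin blinr.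
- by move=> U V h x y; rewrite hnat bnat.
Defined.

End Precompose.

(** * Evaluation of formal linear combinations *)

Section TermValue.
Variable R : comPzRingType.

Fixpoint teval (V : lmodType R) (G : Type) (g : G -> V) (t : mterm R G) : V :=
  match t with
  | Tzero => 0
  | Tgen x => g x
  | Tadd s t => teval g s + teval g t
  | Tscale a s => a *: teval g s
  end.

Lemma teval_eq (V : lmodType R) (G : Type) (g : G -> V) rel (s t : mterm R G) :
  (forall s t, rel s t -> teval g s = teval g t) ->
  teq rel s t -> teval g s = teval g t.
Proof.
move=> H; elim=> {s t} //=.
- by move=> s t r _ -> _ ->.
- by move=> s s' t t' _ -> _ ->.
- by move=> a s s' _ ->.
- by move=> s t r; rewrite addrA.
- by move=> s t; rewrite addrC.
- by move=> s; rewrite add0r.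
- by move=> s; rewrite scaleN1r addNr.
- by move=> a b s; rewrite scalerA.
- by move=> s; rewrite scale1r.
- by move=> a s t; rewrite scalerDr.
- by move=> a b s; rewrite scalerDl.
Qed.

Lemma teval_lin (V : lmodType R) (G : Type) (f g : G -> V) a (t : mterm R G) :
  teval (fun x => a *: f x + g x) t = a *: teval f t + teval g t.
Proof.
elim: t => /= [|//|s -> t ->|b s ->]; first by rewrite scaler0 addr0.
  by rewrite scalerDr addrACA.
by rewrite scalerDr !scalerA mulrC.
Qed.

Lemma teval0 (V : lmodType R) (G : Type) (t : mterm R G) :
  teval (fun=> 0 : V) t = 0.
Proof. by elim: t => //= [s -> t ->|a s ->]; rewrite ?addr0 ?scaler0. Qed.

Lemma teval_ext (V : lmodType R) (G : Type) (f g : G -> V) (t : mterm R G) :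
  f =1 g -> teval f t = teval g t.
Proof. by move=> /funext ->. Qed.

End TermValue.

Section Presented.
Variables (X : topologicalType) (O : rpsh X).
Implicit Types (N : mpsh O) (G : pres O).

Lemma teval_res G N U V (h : V <<= U)
    (f : G U -> N U) (f' : G V -> N V) :
  (forall x, f' (pres_res h x) = mres h (f x)) ->
  forall t, teval f' (ptres h t) = mres h (teval f t).
Proof.
move=> H; elim=> /= [|x|s es t et|a s es]; rewrite ?mres0 ?mresD ?mresZ //.
  by congr (_ + _).
by congr (_ *: _).
Qed.

Lemma gens_presented G : @gens X O (presented G) (fun U x => exists y, x = pgenerator y).
Proof.
move=> U F u Uu; have [W [h [Wu [t e]]]] := sheafify_locE F Uu.
exists W, h; split=> //; rewrite e => {h e F}.
have lin U' a (s s' : rawpres G U') :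
    shunit (wadd (wscale a s) s') = a *: (shunit s : presented G U') + shunit s'.
  by rewrite shunitD shunitZ.
have comb1 U' (y : presented G U') J a z : comb J z ->
    J U' y -> comb J (a *: y + z).
  by move=> cz Jy; rewrite -(mres_id (@sub_refl _ U') y); constructor.
elim: t => [|y|s cs t ct|a s cs].
- exact: comb0.
- rewrite -[shunit _]scale1r -[_ *: _]addr0; apply: comb1; first exact: comb0.
  by exists y.
- by have := combD cs ct; rewrite -shunitD.
- by have := combZ a cs; rewrite -shunitZ.
Qed.

Section Hom.
Variables (G : pres O) (N : mpsh O) (sN : is_sheaf N) (g : forall U, G U -> N U).
Hypothesis g_res : forall U V (h : V <<= U) x, g (pres_res h x) = mres h (g x).
Hypothesis g_rel : forall U s t, prel s t -> teval (@g U) s = teval (@g U) t.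

Let ev U (t : rawpres G U) : N U := teval (@g U) t.

Let ev_eq U (s t : rawpres G U) : weq s t -> ev s = ev t.
Proof. by apply: teval_eq; exact: g_rel. Qed.

Let ev_res U V (h : V <<= U) (s : rawpres G U) : ev (wres h s) = mres h (ev s).
Proof. exact: teval_res. Qed.

Let ev_lin U a (s t : rawpres G U) : ev (wadd (wscale a s) t) = a *: ev s + ev t.
Proof. by []. Qed.

Definition pres_hom : hom (presented G) N := lift_hom sN ev_eq ev_res ev_lin.

Lemma pres_homE U (x : G U) : pres_hom U (pgenerator x) = g x.
Proof. exact: lift_hom_unit. Qed.

End Hom.

Section Bil.
Variables (G G' : pres O) (N : mpsh O) (sN : is_sheaf N).
Variable g : forall U, G U -> G' U -> N U.
Hypothesis g_res : forall U V (h : V <<= U) x y,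
  g (pres_res h x) (pres_res h y) = mres h (g x y).
Hypothesis g_rell : forall U y s t, prel s t ->
  teval (fun x => @g U x y) s = teval (fun x => @g U x y) t.
Hypothesis g_relr : forall U x s t, prel s t -> teval (@g U x) s = teval (@g U x) t.

Let ev U (s : rawpres G U) (t : rawpres G' U) : N U :=
  teval (fun x => teval (@g U x) t) s.

Let ev_eq U (s s' : rawpres G U) (t t' : rawpres G' U) :
  weq s s' -> weq t t' -> ev s t = ev s' t'.
Proof.
move=> es et; rewrite /ev (teval_ext s (g := fun x => teval (g x) t')); last first.
  by move=> x; apply: teval_eq et => *; exact: g_relr.
(* The relations of [G] are only assumed to hold against a single generator of [G']. The induction
   on [t'] extends them to terms, using that [teval] is linear in the function evaluated. *)
apply: teval_eq es => r r' rr' {s s' t et}; elim: t' => /= [|y|t IH t' IH'|a t IH].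
- by rewrite !teval0.
- exact: g_rell.
- have H f f' (z : rawpres G U) :
      teval (fun x => f x + f' x : N U) z = teval f z + teval f' z.
    rewrite -[teval f z]scale1r -teval_lin.
    by apply: teval_ext => x; rewrite scale1r.
  by rewrite !H IH IH'.
- have H f (z : rawpres G U) : teval (fun x => a *: f x : N U) z = a *: teval f z.
    rewrite -[RHS]addr0 -(teval0 (N U) z) -teval_lin.
    by apply: teval_ext => x; rewrite addr0.
  by rewrite !H IH.
Qed.

Let ev_res U V (h : V <<= U) (s : rawpres G U) (t : rawpres G' U) :
  ev (wres h s) (wres h t) = mres h (ev s t).
Proof. by apply: teval_res => x; exact: teval_res. Qed.

Let ev_linl U a (s s' : rawpres G U) (t : rawpres G' U) :
  ev (wadd (wscale a s) s') t = a *: ev s t + ev s' t.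
Proof. by []. Qed.

Let ev_linr U a (s : rawpres G U) (t t' : rawpres G' U) :
  ev s (wadd (wscale a t) t') = a *: ev s t + ev s t'.
Proof. by rewrite /ev /= -teval_lin. Qed.

Definition pres_bil : bil (presented G) (presented G') N :=
  lift_bil sN ev_eq ev_res ev_linl ev_linr.

Lemma pres_bilE U (x : G U) (y : G' U) :
  pres_bil U (pgenerator x) (pgenerator y) = g x y.
Proof. exact: (lift2_unit sN ev_eq ev_res). Qed.

End Bil.
End Presented.

(** * Universal properties of tensors, quotients and colimits *)

Section TensorUniv.
Variables (X : topologicalType) (O : rpsh X) (M N : mpsh O).

Lemma ten_linl U a (x x' : M U) (y : N U) :
  ten (a *: x + x') y = a *: ten x y + ten x' y.
Proof.
rewrite -shunitZ -shunitD; apply: shunit_eq; apply: teq_rel.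
exact: (bilin_l a x x' y).
Qed.

Lemma ten_linr U a (x : M U) (y y' : N U) :
  ten x (a *: y + y') = a *: ten x y + ten x y'.
Proof.
rewrite -shunitZ -shunitD; apply: shunit_eq; apply: teq_rel.
exact: (bilin_r a x y y').
Qed.

Lemma ten_res U V (h : V <<= U) (x : M U) (y : N U) :
  ten (mres h x) (mres h y) = mres h (ten x y).
Proof. by rewrite /ten /pgenerator -[RHS]shunit_res. Qed.

Definition ten_bil : bil M N (tens M N) := Bil ten_linl ten_linr ten_res.

Lemma tenZl U a (x : M U) (y : N U) : ten (a *: x) y = a *: ten x y.
Proof. exact: (bil_scalel ten_bil). Qed.

Lemma tenZr U a (x : M U) (y : N U) : ten x (a *: y) = a *: ten x y.
Proof. exact: (bil_scaler ten_bil). Qed.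

Lemma gens_tens : @gens X O (tens M N) (fun U x => exists y z, x = ten y z).
Proof.
move=> U x u Uu; have [W [h [Wu c]]] := gens_presented x Uu.
exists W, h; split=> //; elim: c => [|V k a j y [[v w] ->] _ IH]; first exact: comb0.
by constructor=> //; exists v, w.
Qed.

Variables (K : mpsh O) (sK : is_sheaf K) (b : bil M N K).

Let g U (xy : tens_pres M N U) : K U := b U xy.1 xy.2.

Let g_res U V (h : V <<= U) (x : tens_pres M N U) : g (pres_res h x) = mres h (g x).
Proof. exact: bnat. Qed.

Let g_rel U s t : prel s t -> teval (@g U) s = teval (@g U) t.
Proof. by case=> *; [exact: blinl|exact: blinr]. Qed.

Definition tens_hom : hom (tens M N) K := pres_hom sK g_res g_rel.

Lemma tens_homE U (x : M U) (y : N U) : tens_hom U (ten x y) = b U x y.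
Proof. exact: pres_homE. Qed.

End TensorUniv.

Section TensorBil.
Variables (X : topologicalType) (O : rpsh X) (M N M' N' K : mpsh O) (sK : is_sheaf K).
Variable t : forall U, M U -> N U -> M' U -> N' U -> K U.
Hypothesis t_res : forall U V (h : V <<= U) x y x' y',
  t (mres h x) (mres h y) (mres h x') (mres h y') = mres h (t x y x' y').
Hypothesis t_lin1 : forall U a (x z : M U) y x' y',
  t (a *: x + z) y x' y' = a *: t x y x' y' + t z y x' y'.
Hypothesis t_lin2 : forall U a x (y z : N U) x' y',
  t x (a *: y + z) x' y' = a *: t x y x' y' + t x z x' y'.
Hypothesis t_lin3 : forall U a x y (x' z : M' U) y',
  t x y (a *: x' + z) y' = a *: t x y x' y' + t x y z y'.
Hypothesis t_lin4 : forall U a x y x' (y' z : N' U),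
  t x y x' (a *: y' + z) = a *: t x y x' y' + t x y x' z.

Let g U (x : tens_pres M N U) (y : tens_pres M' N' U) : K U := t x.1 x.2 y.1 y.2.

Let g_res U V (h : V <<= U) x y :
  @g V (pres_res h x) (pres_res h y) = mres h (@g U x y).
Proof. exact: t_res. Qed.

Let g_rell U y r s : prel r s ->
  teval (fun x => @g U x y) r = teval (fun x => @g U x y) s.
Proof. by case=> *; [exact: t_lin1|exact: t_lin2]. Qed.

Let g_relr U x r s : prel r s -> teval (@g U x) r = teval (@g U x) s.
Proof. by case=> *; [exact: t_lin3|exact: t_lin4]. Qed.

Definition tens_bil : bil (tens M N) (tens M' N') K := pres_bil sK g_res g_rell g_relr.

Lemma tens_bilE U (x : M U) (y : N U) (x' : M' U) (y' : N' U) :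
  tens_bil U (ten x y) (ten x' y') = t x y x' y'.
Proof. exact: pres_bilE. Qed.

End TensorBil.

(** * Sheaves of algebras: graded pieces, tensor algebras, quotients *)

Section AlgebraLemmas.
Variables (X : topologicalType) (O : rpsh X).
Implicit Types (A C : alg O) (U V : opn X).

Lemma mulA A U (x y z : A U) : mul x (mul y z) = mul (mul x y) z.
Proof. exact: amulA. Qed.

Lemma mul_onel A U (x : A U) : mul (one A U) x = x.
Proof. exact: amul1l. Qed.

Lemma mul_oner A U (x : A U) : mul x (one A U) = x.
Proof. exact: amul1r. Qed.

Lemma one_res A U V (h : V <<= U) : mres h (one A U) = one A V.
Proof. exact: ares1. Qed.

Lemma mul_nat A U V (h : V <<= U) (x y : A U) :
  mul (mres h x) (mres h y) = mres h (mul x y).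
Proof. by rewrite mul_res. Qed.

Definition mul_bil A : bil A A A :=
  Bil (@mul_linl X O A) (fun U a x y y' => mul_linr a y y' x) (@mul_nat A).

Lemma mulZl A U a (x y : A U) : mul (a *: x) y = a *: mul x y.
Proof. exact: (bil_scalel (mul_bil A)). Qed.

Lemma mulZr A U a (x y : A U) : mul x (a *: y) = a *: mul x y.
Proof. exact: (bil_scaler (mul_bil A)). Qed.

Lemma mulDl A U (x y z : A U) : mul (x + y) z = mul x z + mul y z.
Proof. exact: (bil_addl (mul_bil A)). Qed.

Lemma mulDr A U (x y z : A U) : mul z (x + y) = mul z x + mul z y.
Proof. exact: (bil_addr (mul_bil A)). Qed.

Lemma shunit_mul (P : rawalg O) U (x y : P U) :
  mul (shunit x : sheafify_alg P U) (shunit y : sheafify_alg P U) =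
  (shunit (wmul x y) : sheafify_alg P U).
Proof.
apply: shsec_eq => u Uu; exists U, (wmul x y); split=> //; last exact: rep_shunitP.
by apply: (rep_mul (rep_shunitP _) (rep_shunitP _)); exact: weq_refl.
Qed.

Section Products.
Variables (M : mpsh O) (A : alg O) (j : hom M A).

Lemma mprod_cat U (w w' : seq (M U)) :
  mprod j (w ++ w') = mul (mprod j w) (mprod j w').
Proof. by elim: w => [|v w IH] /=; rewrite ?mul_onel // IH mulA. Qed.

Lemma mprod_cat1 U (w : seq (M U)) (u : M U) :
  mprod j (w ++ [:: u]) = mul (mprod j w) (j U u).
Proof. by rewrite mprod_cat /= mul_oner. Qed.

Lemma mprod_cat2 U (w : seq (M U)) (u v : M U) :
  mprod j (w ++ [:: u; v]) = mul (mprod j w) (mul (j U u) (j U v)).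
Proof. by rewrite mprod_cat /= mul_oner. Qed.

Lemma mprod_res U V (h : V <<= U) (w : seq (M U)) :
  mprod j (map (mres h) w) = mres h (mprod j w).
Proof. by elim: w => [|v w IH] /=; rewrite ?one_res // IH hnat mul_res. Qed.

Lemma in_deg_prod i U (w : seq (M U)) : size w = i ->
  in_span (fun U x => exists2 w : seq (M U), size w = i & x = mprod j w) (mprod j w).
Proof. by move=> sw; apply: in_span_gen; exists w. Qed.

Definition dprod i U (w : seq (M U)) (sw : size w = i) : deg j i U :=
  SpSec (in_deg_prod sw).

Definition is_dprod i U (x : deg j i U) : Prop :=
  exists2 w : seq (M U), size w = i & spval x = mprod j w.

Lemma gens_deg i : @gens X O (deg j i) (@is_dprod i).
Proof. exact: gens_span. Qed.

Lemma is_dprod_res i : res_stable (@is_dprod i).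
Proof.
move=> U V h x [w sw e]; exists (map (mres h) w); first by rewrite size_map.
by rewrite mprod_res -e.
Qed.

(** A graded piece is a span, so closure under products reduces to concatenation of words. The
    target degree is a variable with an equation because degrees such as [m.*2 + 2] and [m.+1.*2]
    are equal without being convertible. *)
Lemma in_deg_mul i k l (e : i + k = l :> nat) U (x : deg j i U) (y : deg j k U) :
  in_span (fun U x => exists2 w : seq (M U), size w = l & x = mprod j w)
    (mul (spval x) (spval y)).
Proof.
pose c U (x : deg j i U) (y : deg j k U) := mul (spval x) (spval y).
have cl U' a (x' x'' : deg j i U') (y' : deg j k U') :
    c _ (a *: x' + x'') y' = a *: c _ x' y' + c _ x'' y'.
  exact: mul_linl.
have cr U' a (x' : deg j i U') (y' y'' : deg j k U') :
    c _ x' (a *: y' + y'') = a *: c _ x' y' + c _ x' y''.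
  exact: mul_linr.
have cn U' V (h : V <<= U') (x' : deg j i U') (y' : deg j k U') :
    c _ (mres h x') (mres h y') = mres h (c _ x' y').
  exact: mul_nat.
apply: (bil_span (b := Bil cl cr cn) (@gens_deg i) (@gens_deg k)
  (@is_dprod_res i) (@is_dprod_res k)).
move=> U' x' y' [w sw ew] [w' sw' ew']; apply: in_span_gen.
exists (w ++ w'); first by rewrite size_cat sw sw'.
by rewrite mprod_cat -ew -ew'.
Qed.

Definition dmul i k l (e : i + k = l :> nat) U (x : deg j i U) (y : deg j k U) :
  deg j l U := SpSec (in_deg_mul e x y).

Lemma dmul_linl i k l (e : i + k = l :> nat) U a (x x' : deg j i U) (y : deg j k U) :
  dmul e (a *: x + x') y = a *: dmul e x y + dmul e x' y.
Proof. by apply: spval_inj; exact: mul_linl. Qed.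

Lemma dmul_linr i k l (e : i + k = l :> nat) U a (x : deg j i U) (y y' : deg j k U) :
  dmul e x (a *: y + y') = a *: dmul e x y + dmul e x y'.
Proof. by apply: spval_inj; exact: mul_linr. Qed.

Lemma dmulZr i k l (e : i + k = l :> nat) U a (x : deg j i U) (y : deg j k U) :
  dmul e x (a *: y) = a *: dmul e x y.
Proof. by apply: spval_inj; exact: mulZr. Qed.

Lemma dmul_res i k l (e : i + k = l :> nat) U V (h : V <<= U)
    (x : deg j i U) (y : deg j k U) :
  dmul e (mres h x) (mres h y) = mres h (dmul e x y).
Proof. by apply: spval_inj; exact: mul_nat. Qed.

Lemma spval_dmul i k l (e : i + k = l :> nat) U (x : deg j i U) (y : deg j k U) :
  spval (dmul e x y) = mul (spval x) (spval y).
Proof. by []. Qed.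

Definition done U : deg j 0 U := @dprod 0 U [::] erefl.

Definition dgen U (x : M U) : deg j 1 U := @dprod 1 U [:: x] erefl.

Lemma spval_dgen U (x : M U) : spval (dgen x) = j U x.
Proof. exact: mul_oner. Qed.

Lemma dgen_lin U a (x y : M U) : dgen (a *: x + y) = a *: dgen x + dgen y.
Proof. by apply: spval_inj; rewrite spval_dgen hlin -!spval_dgen. Qed.

Lemma dgen_res U V (h : V <<= U) (x : M U) : dgen (mres h x) = mres h (dgen x).
Proof. by apply: spval_inj; rewrite spval_dgen hnat -spval_dgen. Qed.

Definition dgen_hom : hom M (deg j 1) := Hom dgen_lin dgen_res.

Lemma dgenZ U a (x : M U) : dgen (a *: x) = a *: dgen x.
Proof. exact: (hom_scale dgen_hom). Qed.

Definition dmul_bil i k l (e : i + k = l :> nat) : bil (deg j i) (deg j k) (deg j l) :=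
  Bil (fun U a x x' y => dmul_linl e a x x' y) (fun U a x y y' => dmul_linr e a x y y')
    (fun U V h x y => dmul_res e h x y).

Definition dgen2_bil : bil M M (deg j 2) :=
  bil_precompl (bil_precompr (dmul_bil (erefl 2)) dgen_hom) dgen_hom.

Lemma spval_dgen2 U (x y : M U) : spval (dgen2_bil U x y) = mul (j U x) (j U y).
Proof. by rewrite -!spval_dgen. Qed.

Lemma mres_span (J : forall U, A U -> Prop) U V (h : V <<= U) (x : span J U) :
  spval (mres h x) = mres h (spval x).
Proof. by []. Qed.

End Products.

Lemma comm_of_gens M K A (sA : is_sheaf A) (j : hom M A) (z : hom K A) :
  @gens X O A (fun U x => exists w, x = mprod j w) ->
  (forall U (k : K U) (v : M U), mul (z U k) (j U v) = mul (j U v) (z U k)) ->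
  forall U (k : K U) (x : A U), mul (z U k) x = mul x (z U k).
Proof.
move=> gA H U k x; move: U x k; apply: (gen_ind gA).
- move=> U x l k; apply: (sheaf_sep sA) => u Uu.
  by have [W [h [Wu e]]] := l u Uu; exists W, h; rewrite !mul_res -!hnat e.
- by move=> U k; rewrite Defs.mul0l Defs.mul0r.
- by move=> U a x x' e e' k; rewrite mul_linl mul_linr e e'.
- move=> U V h _ [w ->] k; rewrite -mprod_res; elim: (map _ w) => [|v w' IH] /=.
    by rewrite mul_oner mul_onel.
  by rewrite mulA H -mulA IH mulA.
Qed.

Section TensorAlg.
Variable M : mpsh O.

Lemma pgenerator_cons U x (w : seq (M U)) :
  (pgenerator (x :: w : word_pres M U) : talg M U) =
  mul (tin M U x) (pgenerator (w : word_pres M U) : talg M U).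
Proof. by rewrite /pgenerator [RHS]shunit_mul. Qed.

Lemma pgenerator_mprod U (w : seq (M U)) :
  pgenerator (w : word_pres M U) = mprod (tin M) w :> talg M U.
Proof. by elim: w => [//|x w IH]; rewrite pgenerator_cons IH. Qed.

Definition is_word U (x : talg M U) : Prop := exists w, x = mprod (tin M) w.

Lemma gens_talg : @gens X O (talg M) is_word.
Proof.
move=> U x u Uu; have [W [h [Wu c]]] := @gens_presented X O (word_pres M) U x u Uu.
exists W, h; split=> //; elim: c => [|V k a j y [w ->] _ IH]; first exact: comb0.
by constructor=> //; exists w; rewrite pgenerator_mprod.
Qed.

Lemma is_word_res : res_stable is_word.
Proof. by move=> U V h x [w ->]; exists (map (mres h) w); rewrite mprod_res. Qed.

Variables (A : alg O) (sA : is_sheaf A) (j : hom M A).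

Let g U (w : word_pres M U) : A U := mprod j w.

Let g_res U V (h : V <<= U) (w : word_pres M U) : g (pres_res h w) = mres h (g w).
Proof. exact: mprod_res. Qed.

Let g_rel U s t : prel s t -> teval (@g U) s = teval (@g U) t.
Proof.
by case=> w w' a x y /=; rewrite /g !mprod_cat /= hlin mul_linl mulDr mulZr.
Qed.

Definition talg_hom : hom (talg M) A := pres_hom sA g_res g_rel.

Lemma talg_hom_mprod U (w : seq (M U)) : talg_hom U (mprod (tin M) w) = mprod j w.
Proof. by rewrite -pgenerator_mprod; exact: pres_homE. Qed.

Lemma talg_hom1 U : talg_hom U (one (talg M) U) = one A U.
Proof. exact: (@talg_hom_mprod U [::]). Qed.

Lemma talg_hom_tin U (x : M U) : talg_hom U (tin M U x) = j U x.
Proof. by have := @talg_hom_mprod U [:: x]; rewrite /= !mul_oner. Qed.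

Lemma talg_homM U (x y : talg M U) :
  talg_hom U (mul x y) = mul (talg_hom U x) (talg_hom U y).
Proof.
move: U x y; apply: (gen_ind2 gens_talg gens_talg is_word_res is_word_res).
- move=> U x y l; apply: (sheaf_sep sA) => u Uu; have [W [h [Wu e]]] := l u Uu.
  by exists W, h; rewrite -!hnat mul_res e !hnat mul_res.
- by move=> U y; rewrite Defs.mul0l !hom_zero Defs.mul0l.
- by move=> U y; rewrite Defs.mul0r !hom_zero Defs.mul0r.
- by move=> U a x x' y e e'; rewrite mul_linl !hlin mul_linl e e'.
- by move=> U a x x' y e e'; rewrite mul_linr !hlin mul_linr e e'.
- by move=> U _ _ [w ->] [w' ->]; rewrite -mprod_cat !talg_hom_mprod mprod_cat.
Qed.

End TensorAlg.

Section Quotient.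
Variables (A : alg O) (J : forall U, A U -> Prop).

Lemma quo_appM U (x y : A U) :
  quo_app J (mul x y) = mul (quo_app J x) (quo_app J y).
Proof. by rewrite /quo_app shunit_mul. Qed.

Lemma quo_app1 U : quo_app J (one A U) = one (quo J) U.
Proof. by []. Qed.

Lemma quo_app_res U V (h : V <<= U) (x : A U) :
  quo_app J (mres h x) = mres h (quo_app J x).
Proof. exact: quo_nat. Qed.

Lemma quo_app_eq0 U (x : A U) : J x -> quo_app J x = 0.
Proof.
move=> Jx; rewrite -(hom_zero (quo_proj J)); apply: shunit_eq => /=.
rewrite subr0 -[x]scale1r -(mres_id (@sub_refl _ U) x) -[_ *: _]addr0.
constructor; last exact: comb0.
exists U, (@sub_refl _ U), x, (one A U), (one A U).
by rewrite mres_id mul_onel mul_oner.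
Qed.

Lemma quo_app_rel U a (x y : A U) : J (x - a *: y) -> quo_app J x = a *: quo_app J y.
Proof.
move=> /quo_app_eq0 e; apply/eqP; rewrite -subr_eq0 -{}e; apply/eqP.
by have := hom_sub (quo_proj J) x (a *: y); rewrite hom_scale.
Qed.

Lemma gens_quo (L : forall U, A U -> Prop) : gens L ->
  @gens X O (quo J) (fun U x => exists2 y, L U y & x = quo_app J y).
Proof.
move=> gL U x; apply: in_span_local => u Uu.
have [W [h [Wu [y e]]]] := sheafify_locE x Uu.
exists W, h; split=> //; rewrite e; apply: (in_span_hom (f := quo_proj J) gL).
by move=> V z Lz; apply: in_span_gen; exists z.
Qed.

Lemma quo_is_sheaf : is_sheaf (quo J).
Proof. exact: sheafify_is_sheaf. Qed.

Lemma mprod_quo M (j : hom M A) (k : hom M (quo J)) :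
  (forall U x, k U x = quo_app J (j U x)) ->
  forall U (w : seq (M U)), mprod k w = quo_app J (mprod j w).
Proof.
by move=> H U; elim=> [//|x w IH] /=; rewrite IH H quo_appM.
Qed.

Variables (C : mpsh O) (sC : is_sheaf C) (g : hom A C).
Hypothesis g_ideal : forall U (j : A U) (y z : A U), J j -> g U (mul (mul y j) z) = 0.
Hypothesis J_res : res_stable J.

Let ev U (x : rawquo J U) : C U := g U x.

Let ev_eq U (x y : rawquo J U) : weq x y -> ev x = ev y.
Proof.
move=> c; apply/eqP; rewrite -subr_eq0 /ev -hom_sub; apply/eqP; move: c => /=.
elim=> [|V h a _ z [W [k [j [u [v [Jj ->]]]]]] _ IH]; first exact: hom_zero.
rewrite hlin IH addr0 hnat g_ideal ?mres0 ?scaler0 //; exact: J_res.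
Qed.

Let ev_res U V (h : V <<= U) (x : rawquo J U) : ev (wres h x) = mres h (ev x).
Proof. exact: hnat. Qed.

Let ev_lin U a (x y : rawquo J U) : ev (wadd (wscale a x) y) = a *: ev x + ev y.
Proof. exact: hlin. Qed.

Definition quo_hom : hom (quo J) C := lift_hom sC ev_eq ev_res ev_lin.

Lemma quo_homE U (x : A U) : quo_hom U (quo_app J x) = g U x.
Proof. exact: lift_hom_unit. Qed.

End Quotient.

Section QuotientAlgHom.
Variables (A C : alg O) (J : forall U, A U -> Prop) (sC : is_sheaf C) (g : hom A C).
Hypothesis g1 : forall U, g U (one A U) = one C U.
Hypothesis gM : forall U (x y : A U), g U (mul x y) = mul (g U x) (g U y).
Hypothesis gJ : forall U (x : A U), J x -> g U x = 0.
Hypothesis J_res : res_stable J.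

Let g_ideal U (j y z : A U) : J j -> g U (mul (mul y j) z) = 0.
Proof. by move=> Jj; rewrite !gM (gJ Jj) Defs.mul0r Defs.mul0l. Qed.

Definition quo_alg_hom : hom (quo J) C := quo_hom sC g_ideal J_res.

Lemma quo_alg_homE U (x : A U) : quo_alg_hom U (quo_app J x) = g U x.
Proof. exact: quo_homE. Qed.

Lemma quo_alg_hom1 U : quo_alg_hom U (one (quo J) U) = one C U.
Proof. by rewrite -quo_app1 quo_alg_homE g1. Qed.

Lemma quo_alg_homM U (x y : quo J U) :
  quo_alg_hom U (mul x y) = mul (quo_alg_hom U x) (quo_alg_hom U y).
Proof.
(* Every section of [quo J] is locally the class of a section of [A], so the trivial predicate on
   [A] provides a generating family. *)
have gT : gens (fun U (x : A U) => True) by move=> V z; exact: in_span_gen.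
have rT : res_stable (fun U x => exists2 y, True & x = quo_app J y).
  by move=> V W h _ [z _ ->]; exists (mres h z) => //; rewrite quo_app_res.
apply: (bil_ext (b := bil_postcomp quo_alg_hom (mul_bil (quo J)))
  (b' := bil_precompl (bil_precompr (mul_bil C) quo_alg_hom) quo_alg_hom) sC
  (gens_quo gT) (gens_quo gT) rT rT).
move=> V _ _ [x' _ ->] [y' _ ->].
apply: (etrans (congr1 (fun z => quo_alg_hom V z) (esym (quo_appM J x' y')))).
apply: (etrans (quo_alg_homE _)); rewrite gM.
exact: (congr2 (@mul _ _ C V) (esym (quo_alg_homE x')) (esym (quo_alg_homE y'))).
Qed.

End QuotientAlgHom.

Section QuotientBil.
Variables (A : alg O) (J : forall U, A U -> Prop) (P : rawmod O) (C : mpsh O).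
Variables (sC : is_sheaf C) (b : bil A (sheafify P) C).
Hypothesis b_ideal : forall U (j : A U) (y z : A U) (t : sheafify P U),
  J j -> b U (mul (mul y j) z) t = 0.
Hypothesis J_res : res_stable J.

Let ev U (x : rawquo J U) (t : P U) : C U := b U x (shunit t : sheafify P U).

Let ev_eq U (x x' : rawquo J U) (t t' : P U) : weq x x' -> weq t t' -> ev x t = ev x' t'.
Proof.
move=> c e; rewrite /ev (shunit_eq e); apply/eqP; rewrite -subr_eq0.
move: (shunit t' : sheafify P U) => {e}t'.
have <- : b U (x - x') t' = b U x t' - b U x' t'.
  by rewrite -scaleN1r bil_addl bil_scalel scaleN1r.
apply/eqP; move: c t' => /=.
elim=> [|V h a _ z [W [k [j [u [v [Jj ->]]]]]] _ IH] t'; first exact: bil0l.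
rewrite blinl IH addr0 2!mul_res b_ideal ?scaler0 //; exact/J_res/J_res.
Qed.

Let ev_res U V (h : V <<= U) (x : rawquo J U) (t : P U) :
  ev (wres h x) (wres h t) = mres h (ev x t).
Proof. by rewrite /ev -bnat shunit_res. Qed.

Let ev_linl U a (x x' : rawquo J U) (t : P U) :
  ev (wadd (wscale a x) x') t = a *: ev x t + ev x' t.
Proof. exact: blinl. Qed.

Let ev_linr U a (x : rawquo J U) (t t' : P U) :
  ev x (wadd (wscale a t) t') = a *: ev x t + ev x t'.
Proof. by rewrite /ev shunitD shunitZ blinr. Qed.

Definition quo_bil : bil (quo J) (sheafify P) C := lift_bil sC ev_eq ev_res ev_linl ev_linr.

Lemma quo_bilE U (x : A U) (t : sheafify P U) : quo_bil U (quo_app J x) t = b U x t.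
Proof.
apply: (sheaf_sep sC) => u Uu; have [W [h [Wu [t' e]]]] := sheafify_locE t Uu.
exists W, h; split=> //; rewrite -!bnat e -quo_app_res.
exact: (lift2_unit sC ev_eq ev_res).
Qed.

End QuotientBil.
End AlgebraLemmas.

Section ColimitUniv.
Variables (X : topologicalType) (O : rpsh X).
Variables (G : nat -> mpsh O) (tr : forall m, hom (G m) (G m.+1)).

Lemma cin_lin m U a (x y : G m U) :
  cin tr (a *: x + y) = a *: cin tr x + cin tr y.
Proof.
rewrite -shunitZ -shunitD; apply: shunit_eq; apply: teq_rel.
exact: (colim_lin tr a x y).
Qed.

Lemma cin_res m U V (h : V <<= U) (x : G m U) : cin tr (mres h x) = mres h (cin tr x).
Proof. by rewrite /cin /pgenerator -[RHS]shunit_res. Qed.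

Definition cin_hom m : hom (G m) (colim tr) := Hom (@cin_lin m) (@cin_res m).

Lemma cin_tr m U (x : G m U) : cin tr (tr m U x) = cin tr x.
Proof. by apply: shunit_eq; apply: teq_sym; apply: teq_rel; exact: colim_tau. Qed.

Lemma gens_colim (L : forall m U, G m U -> Prop) : (forall m, gens (L m)) ->
  @gens X O (colim tr) (fun U x => exists m (y : G m U), L m U y /\ x = cin tr y).
Proof.
move=> gL U x; apply: in_span_local => u Uu.
have [W [h [Wu c]]] := gens_presented x Uu.
exists W, h; split=> //; elim: c => [|V k a _ y [[m z] ->] _ IH]; first exact: in_span0.
apply: in_span_lin => //; apply: in_span_res.
apply: (in_span_hom (f := cin_hom m) (gL m)) => V' t Lt.
by apply: in_span_gen; exists m, t.
Qed.

Variables (N : mpsh O) (sN : is_sheaf N).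

Section Hom.
Variable f : forall m, hom (G m) N.
Hypothesis f_tr : forall m U (x : G m U), f m.+1 U (tr m U x) = f m U x.

Let g U (x : colim_pres tr U) : N U := f (projT1 x) U (projT2 x).

Let g_res U V (h : V <<= U) (x : colim_pres tr U) : g (pres_res h x) = mres h (g x).
Proof. by case: x => m x; exact: hnat. Qed.

Let g_rel U s t : prel s t -> teval (@g U) s = teval (@g U) t.
Proof. by case=> [m a x y|m x]; [exact: hlin|exact: (esym (f_tr x))]. Qed.

Definition colim_hom : hom (colim tr) N := pres_hom sN g_res g_rel.

Lemma colim_homE m U (x : G m U) : colim_hom U (cin tr x) = f m U x.
Proof. exact: pres_homE. Qed.

End Hom.

Section Bil.
Variable f : forall m k, bil (G m) (G k) N.
Hypothesis f_trl : forall m k U (x : G m U) (y : G k U),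
  f m.+1 k U (tr m U x) y = f m k U x y.
Hypothesis f_trr : forall m k U (x : G m U) (y : G k U),
  f m k.+1 U x (tr k U y) = f m k U x y.

Let g U (x y : colim_pres tr U) : N U := f (projT1 x) (projT1 y) U (projT2 x) (projT2 y).

Let g_res U V (h : V <<= U) (x y : colim_pres tr U) :
  g (pres_res h x) (pres_res h y) = mres h (g x y).
Proof. by case: x y => m x [k y]; exact: bnat. Qed.

Let g_rell U y s t : prel s t ->
  teval (fun x => @g U x y) s = teval (fun x => @g U x y) t.
Proof.
by case: y => k y; case=> [m a x x'|m x]; [exact: blinl|exact: (esym (f_trl x y))].
Qed.

Let g_relr U x s t : prel s t -> teval (@g U x) s = teval (@g U x) t.
Proof.
by case: x => k x; case=> [m a y y'|m y]; [exact: blinr|exact: (esym (f_trr x y))].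
Qed.

Definition colim_bil : bil (colim tr) (colim tr) N := pres_bil sN g_res g_rell g_relr.

Lemma colim_bilE m k U (x : G m U) (y : G k U) :
  colim_bil U (cin tr x) (cin tr y) = f m k U x y.
Proof. exact: pres_bilE. Qed.

End Bil.
End ColimitUniv.

(** * Line bundles and central squares *)

Section LineBundle.
Variables (X : topologicalType) (O : rpsh X) (L : mpsh O).
Implicit Types (U V W : opn X).

Lemma dapp_irr U V (h k : V <<= U) (f : dual L U) (x : L V) :
  dapp (f : dsec L U) h x = dapp (f : dsec L U) k x.
Proof. by rewrite (Prop_irrelevance h k). Qed.

Lemma ev_dres U V (h : V <<= U) (f : dual L U) (x : L V) :
  ev (mres h f) x = dapp (f : dsec L U) h x.
Proof. rewrite /ev /=; exact: dapp_irr. Qed.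

Lemma ev_linr U a (f : dual L U) (x y : L U) : ev f (a *: x + y) = a * ev f x + ev f y.
Proof. exact: dlin. Qed.

Lemma ev_linl U a (f g : dual L U) (x : L U) : ev (a *: f + g) x = a * ev f x + ev g x.
Proof. by rewrite /ev /= rres_id. Qed.

Lemma ev_res U V (h : V <<= U) (f : dual L U) (x : L U) :
  ev (mres h f) (mres h x) = rres O h (ev f x).
Proof. by rewrite ev_dres; exact: dnat. Qed.

Lemma ev0r U (f : dual L U) : ev f 0 = 0.
Proof.
have := ev_linr 1 f 0 0; rewrite scaler0 addr0 mul1r => e.
by apply: (@addrI _ (ev f 0)); rewrite -e addr0.
Qed.

Lemma evZr U a (f : dual L U) (x : L U) : ev f (a *: x) = a * ev f x.
Proof. by have := ev_linr a f x 0; rewrite ev0r !addr0. Qed.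

Lemma evZl U a (f : dual L U) (x : L U) : ev (a *: f) x = a * ev f x.
Proof.
have := ev_linl a f 0 x; rewrite addr0 => ->.
have := ev_linl 0 0 0 x; rewrite scale0r addr0 mul0r add0r => _.
by rewrite [ev 0 x]/ev /= addr0.
Qed.

(** A trivialization of [L] without coordinates: by [dual_pair_expand] and [dual_pair_expand_dual]
    the two sections are dual bases of the line bundle and of its dual. *)
Definition dual_pair U (l : L U) (f : dual L U) : Prop := ev f l = 1.

Lemma dual_pair_res U V (h : V <<= U) l f :
  dual_pair l f -> dual_pair (mres h l) (mres h f).
Proof. by rewrite /dual_pair ev_res => ->; exact: rmorph1. Qed.

Hypothesis hL : line_bundle L.

Lemma rank1_basis u : exists U (l : L U), U u /\
  forall V (h : V <<= U) (x : L V), exists! a : O V, x = a *: mres h l.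
Proof.
have [U [e [Uu H]]] := hL.2 u; exists U, (e ord0); split=> // V h x.
have [c [ec uc]] := H V h x; exists (c ord0); split; first by rewrite ec big_ord1.
move=> a ea; have := uc [ffun=> a]; rewrite big_ord1 ffunE => /(_ ea) ->.
by rewrite ffunE.
Qed.

Lemma dual_pair_ex u : exists U (l : L U) (f : dual L U), U u /\ dual_pair l f.
Proof.
have [U [l [Uu H]]] := rank1_basis u.
pose co V (h : V <<= U) (x : L V) : O V := projT1 (cid (H V h x)).
have coE V (h : V <<= U) (x : L V) : x = co V h x *: mres h l.
  by case: (projT2 (cid (H V h x))).
have coU V (h : V <<= U) (x : L V) a : x = a *: mres h l -> co V h x = a.
  by move=> ex; case: (projT2 (cid (H V h x))) => _; apply.
have clin V (h : V <<= U) a (x y : L V) : co V h (a *: x + y) = a * co V h x + co V h y.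
  by apply: coU; rewrite scalerDl -scalerA -!coE.
have cnat V W (h : V <<= U) (k : W <<= V) (m : W <<= U) (x : L V) :
    co W m (mres k x) = rres O k (co V h x).
  by apply: coU; rewrite -(mres_comp h k m) -mresZ -coE.
exists U, l, (DSec clin cnat : dual L U); split=> //.
by apply: coU; rewrite scale1r mres_id.
Qed.

Lemma dual_pair_sub U u : U u -> exists V (h : V <<= U) (l : L V) (f : dual L V),
  V u /\ dual_pair l f.
Proof.
move=> Uu; have [W [l [f [Wu p]]]] := dual_pair_ex u.
exists (oI U W), (@oI_l _ U W), (mres (@oI_r _ U W) l), (mres (@oI_r _ U W) f).
by split=> //; exact: dual_pair_res.
Qed.

(** In a local basis [g] write [l = a g] and [x = c g]. Then [a f(g) = f(l) = 1], so
    [f(x) l = c f(g) a g = x]. *)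
Lemma dual_pair_expand U (l : L U) (f : dual L U) : dual_pair l f ->
  forall x : L U, x = ev f x *: l.
Proof.
move=> p x; apply: (sheaf_sep hL.1) => u Uu.
have [V [g [Vu H]]] := rank1_basis u.
exists (oI U V), (@oI_l _ U V); split=> //.
have [a [ea _]] := H _ (@oI_r _ U V) (mres (@oI_l _ U V) l).
have [c [ec _]] := H _ (@oI_r _ U V) (mres (@oI_l _ U V) x).
have := dual_pair_res (@oI_l _ U V) p.
rewrite /dual_pair mresZ -ev_res ec ea !evZr scalerA => af.
by rewrite -mulrA [_ * a]mulrC af mulr1.
Qed.

Lemma dual_pair_expand_dual U (l : L U) (f : dual L U) : dual_pair l f ->
  forall g : dual L U, g = ev g l *: f.
Proof.
move=> p g; apply: dsec_eq => V h x.
have e := dual_pair_expand (dual_pair_res h p) x.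
rewrite -(ev_dres h (ev g l *: f)) -ev_dres mresZ evZl.
by rewrite {1}e evZr ev_res mulrC.
Qed.

Lemma dual_pair_ev U (l : L U) (f : dual L U) : dual_pair l f ->
  forall (x : L U) (g : dual L U), ev g x = ev f x * ev g l.
Proof. by move=> p x g; rewrite {1}(dual_pair_expand p x) evZr. Qed.

(** Locally all sections of the dual are multiples of a single one, and multiples of one element
    commute. Commutation with generators then spreads to the whole algebra. *)
Lemma dual_alg_comm (A : alg O) (sA : is_sheaf A) (j : hom (dual L) A) :
  @gens X O A (fun U x => exists w, x = mprod j w) ->
  forall U (f : dual L U) (x : A U), mul (j U f) x = mul x (j U f).
Proof.
move=> gA; apply: (comm_of_gens sA gA) => U f g.
apply: (sheaf_sep sA) => u Uu.
have [V [h [l [e [Vu p]]]]] := dual_pair_sub Uu; exists V, h; split=> //.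
rewrite !mul_res -!hnat (dual_pair_expand_dual p (mres h f)).
rewrite (dual_pair_expand_dual p (mres h g)) !hom_scale !mulZl !mulZr.
by rewrite !scalerA mulrC.
Qed.

Section PairedTensors.
Variables P Q : mpsh O.

(** Pure tensors over opens on which [L] is trivialized. There [ten b c] equals [ev f l *: ten b c],
    which is the shape of section on which [tau] is specified. *)
Definition paired_tensor U (x : tens P Q U) : Prop :=
  exists b c l f, dual_pair (l : L U) f /\ x = ten b c.

Lemma gens_paired_tensor : gens paired_tensor.
Proof.
move=> U x; apply: in_span_local => u Uu.
have [V [h [l [f [Vu p]]]]] := dual_pair_sub Uu; exists V, h; split=> //.
move=> v Vv; have [W [k [Wv c]]] := gens_tens (mres h x) Vv.
exists W, k; split=> //; elim: c => [|V' k' a _ y [b [c ->]] _ IH]; first exact: comb0.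
rewrite -ten_res -(mres_id (@sub_refl _ W) (ten _ _)); constructor=> //.
exists (mres k' b), (mres k' c), (mres k l), (mres k f); split=> //.
exact: dual_pair_res.
Qed.

Lemma paired_tensor_res : res_stable paired_tensor.
Proof.
move=> U V h _ [b [c [l [f [p ->]]]]].
exists (mres h b), (mres h c), (mres h l), (mres h f).
by rewrite ten_res; split=> //; exact: dual_pair_res.
Qed.

End PairedTensors.

(** * Contraction of L against its dual *)

Section Contraction.
Variables (P Q N : mpsh O) (sN : is_sheaf N).
Variable t : forall U, P U -> Q U -> L U -> dual L U -> N U.
Hypothesis t_res : forall U V (h : V <<= U) x y l f,
  t (mres h x) (mres h y) (mres h l) (mres h f) = mres h (t x y l f).
Hypothesis t_linx : forall U a (x x' : P U) y l f,
  t (a *: x + x') y l f = a *: t x y l f + t x' y l f.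
Hypothesis t_liny : forall U a x (y y' : Q U) l f,
  t x (a *: y + y') l f = a *: t x y l f + t x y' l f.
Hypothesis t_scalel : forall U a (x : P U) (y : Q U) l f,
  t x y (a *: l) f = a *: t x y l f.
Hypothesis t_scalef : forall U a (x : P U) (y : Q U) l f,
  t x y l (a *: f) = a *: t x y l f.

(** Expand both sections in the pair: [l = f0(l) l0] and [f = f(l0) f0], with [f0(l) f(l0) = f(l)].
    When [f(l) = 1] this says that the value does not depend on the trivialization, which permits
    gluing. *)
Lemma contract_pair U (x : P U) (y : Q U) l f l0 f0 : dual_pair l0 f0 ->
  t x y l f = ev f l *: t x y l0 f0.
Proof.
move=> p; rewrite (dual_pair_ev p) {1}(dual_pair_expand p l) t_scalel.
by rewrite {1}(dual_pair_expand_dual p f) t_scalef scalerA.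
Qed.

Lemma contract_ex U (x : P U) (y : Q U) :
  exists n : N U, forall V (h : V <<= U) l f, dual_pair l f ->
    mres h n = t (mres h x) (mres h y) l f.
Proof.
pose R V (n : N V) := exists (h : V <<= U) l f,
  dual_pair l f /\ n = t (mres h x) (mres h y) l f.
have [] := @glue _ _ _ sN U R.
- move=> u Uu; have [V [h [l [f [Vu p]]]]] := dual_pair_sub Uu.
  by exists V, (t (mres h x) (mres h y) l f); split=> //; exists h, l, f.
- move=> V W k _ [h [l [f [p ->]]]].
  have h' : W <<= U by move=> w /k /h.
  exists h', (mres k l), (mres k f); split; first exact: dual_pair_res.
  by rewrite -t_res !(mres_comp h k h').
- move=> V _ _ VU [h [l [f [p ->]]]] [h' [l' [f' [p' ->]]]].
  rewrite !(mres_irr h' h) (contract_pair _ _ l f p').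
  by rewrite p scale1r.
- by move=> n hn; exists n => V h l f p; apply: hn; exists h, l, f.
Qed.

Definition contract_app U (x : P U) (y : Q U) : N U := projT1 (cid (contract_ex x y)).

Lemma contract_appP U (x : P U) (y : Q U) V (h : V <<= U) l f :
  dual_pair l f -> mres h (contract_app x y) = t (mres h x) (mres h y) l f.
Proof. exact: (projT2 (cid (contract_ex x y))). Qed.

Lemma contract_linl U a (x x' : P U) (y : Q U) :
  contract_app (a *: x + x') y = a *: contract_app x y + contract_app x' y.
Proof.
apply: (sheaf_sep sN) => u Uu.
have [V [h [l [f [Vu p]]]]] := dual_pair_sub Uu; exists V, h; split=> //.
by rewrite mres_lin !(contract_appP _ _ h p) mres_lin t_linx.
Qed.

Lemma contract_linr U a (x : P U) (y y' : Q U) :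
  contract_app x (a *: y + y') = a *: contract_app x y + contract_app x y'.
Proof.
apply: (sheaf_sep sN) => u Uu.
have [V [h [l [f [Vu p]]]]] := dual_pair_sub Uu; exists V, h; split=> //.
by rewrite mres_lin !(contract_appP _ _ h p) mres_lin t_liny.
Qed.

Lemma contract_nat U V (h : V <<= U) (x : P U) (y : Q U) :
  contract_app (mres h x) (mres h y) = mres h (contract_app x y).
Proof.
apply: (sheaf_sep sN) => u Vu.
have [W [k [l [f [Wu p]]]]] := dual_pair_sub Vu; exists W, k; split=> //.
have kh : W <<= U by move=> w /k /h.
rewrite (contract_appP _ _ k p) !(mres_comp h k kh).
by rewrite (contract_appP _ _ kh p).
Qed.

(** Insertion of the canonical section of L (x) L^vee, which is locally [l (x) f] for any dual
    pair. *)
Definition contract : bil P Q N := Bil contract_linl contract_linr contract_nat.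

Lemma contractE U (x : P U) (y : Q U) l f : ev f l *: contract U x y = t x y l f.
Proof.
apply: (sheaf_sep sN) => u Uu.
have [V [h [l' [f' [Vu p]]]]] := dual_pair_sub Uu; exists V, h; split=> //.
by rewrite -t_res mresZ (contract_appP _ _ h p) -ev_res -contract_pair.
Qed.

End Contraction.

End LineBundle.

(** * Centrality of L in an algebra where squares are values of q *)

Section CentralSquares.
Variables (X : topologicalType) (O : rpsh X) (E L : mpsh O) (q : quad_form E L).
Variables (A : alg O) (sA : is_sheaf A) (j : hom E A) (z : hom L A).
Hypothesis z_q : forall U (v : E U), z U (q U v) = mul (j U v) (j U v).
Hypothesis gA : @gens X O A (fun U x => exists w, x = mprod j w).
Hypothesis gL : @gens X O L (fun U l => exists v, l = q U v).
Hypothesis hL : line_bundle L.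
Implicit Types (U V W : opn X).

Lemma square_polar U (v w : E U) :
  mul (j U v) (j U w) =
  z U (q U (v + w) - q U v - q U w) - mul (j U w) (j U v).
Proof.
rewrite !hom_sub !z_q hom_add !mulDl !mulDr.
set vv := mul _ (j U v); set wv := mul _ (j U v).
set vw := mul _ _; set ww := mul _ _.
apply: (@addIr _ wv); rewrite subrK; apply: (@addIr _ ww); rewrite subrK.
by apply: (@addIr _ vv); rewrite subrK [LHS]addrC !addrA.
Qed.

Lemma sqr_ev_commutator U (l : L U) (f : dual L U) (v w : E U) : dual_pair l f ->
  ev f (q U v) ^+ 2 *: (mul (z U l) (j U w) - mul (j U w) (z U l)) = 0.
Proof.
move=> p; set zl := z U l; set x := ev f (q U v).
have iE k : z U k = ev f k *: zl by rewrite -hom_scale -(dual_pair_expand hL p).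
have vz : x *: mul (j U v) zl = x *: mul zl (j U v).
  by rewrite -mulZr -mulZl -!iE z_q mulA.
(* Here [x z w = v v w]. Carrying [w] leftwards past both factors uses the polarization identity
   twice and gives [w v v] plus the error [b(v,w) (v z - z v)]. One more factor [x] kills the error
   by [vz], whence the exponent [2]. *)
have vw : x *: mul zl (j U w) = x *: mul (j U w) zl +
    ev f (q U (v + w) - q U v - q U w) *: (mul (j U v) zl - mul zl (j U v)).
  rewrite -mulZl -iE -mulZr -iE z_q -mulA square_polar mul_subr [mul _ (mul _ _)]mulA.
  rewrite square_polar mul_subl iE mulZr mulZl opprB -mulA scalerBr.
  by rewrite addrCA.
rewrite expr2 -scalerA scalerBr vw addrC addKr scalerA mulrC -scalerA scalerBr.
by rewrite vz subrr scaler0.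
Qed.

(** Elements generating the unit ideal still generate it once squared; this is that fact acting on
    one section [y]. The multiplier [d], an inverse of [f(l)] on [y], is general for the sake of the
    induction: terms of the combination [l] are removed one at a time, and [l = 0] forces
    [y = 0]. *)
Lemma cancel_sqr_ev U (f : dual L U) (M : mpsh O) (y : M U) :
  (forall v : E U, ev f (q U v) ^+ 2 *: y = 0) ->
  forall l : L U, comb (fun U l => exists v, l = q U v) l ->
  forall d, (d * ev f l) *: y = y -> y = 0.
Proof.
move=> H l; elim=> [|V h a _ k [v ->] _ IH] d e.
  by rewrite -e ev0r mulr0 scale0r.
move: e; rewrite ev_linr -qnat; set x := ev f _; set r := ev f k => e.
(* With [f(l) = a x + r], using [y = d (a x + r) y] twice gives
   [y = d^2 (a^2 x^2 + (2 a x + r) r) y]. The term in [x^2] vanishes on [y], and what remains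
   exhibits the multiplier for the shorter combination. *)
apply: (IH (d ^+ 2 * (a * x *+ 2 + r))); rewrite -[in RHS]e -{2}e scalerA.
have -> : d * (a * x + r) * (d * (a * x + r)) =
    d ^+ 2 * a ^+ 2 * x ^+ 2 + d ^+ 2 * (a * x *+ 2 + r) * r.
  rewrite mulrACA -!expr2 sqrrD exprMn -[_ * _ * r]mulrA -[_ * _ * x ^+ 2]mulrA.
  by rewrite -mulrDr mulrDl mulrnAl -expr2 [in RHS]addrA.
by rewrite scalerDl -[X in _ = X + _]scalerA H scaler0 add0r.
Qed.

Lemma square_comm_gen U (l : L U) (w : E U) :
  mul (z U l) (j U w) = mul (j U w) (z U l).
Proof.
apply: (sheaf_sep sA) => u Uu.
have [V [h [k [f [Vu p]]]]] := dual_pair_sub hL Uu.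
have [W [h' [Wu c]]] := gL k Vu.
have hU : W <<= U by move=> x /h' /h.
exists W, hU; split=> //; have p' := dual_pair_res h' p.
rewrite !mul_res -!hnat (dual_pair_expand hL p' (mres hU l)) hom_scale mulZl mulZr.
congr (_ *: _); apply/eqP; rewrite -subr_eq0; apply/eqP.
(* [c] writes the local generator of [L] as a combination of values of [q]. The coordinate of that
   generator is [1], so the initial multiplier is [1]. *)
apply: (@cancel_sqr_ev W (mres h' f) A _ _ _ c 1).
  by move=> v; exact: sqr_ev_commutator.
by rewrite p' mulr1 scale1r.
Qed.

Lemma square_central U (l : L U) (x : A U) : mul (z U l) x = mul x (z U l).
Proof. exact: (comm_of_gens sA gA square_comm_gen). Qed.

Lemma square_mid U (u v w : E U) :
  mul (mul (j U u) (j U v)) (mul (j U v) (j U w)) = mul (mul (j U u) (j U w)) (z U (q U v)).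
Proof. by rewrite -[LHS]mulA [mul (j U v) _]mulA -z_q square_central mulA. Qed.

End CentralSquares.

(** * Consequences of the degree-two sequence for q and B *)

Section HomogeneousClifford.
Variables (X : topologicalType) (O : rpsh X) (E L : mpsh O) (q : quad_form E L).
Variable Bs : B2_sequence q.
Hypothesis hL : line_bundle L.
Implicit Types (U V W : opn X).

Lemma mprod_Bin U (w : seq (E U)) : mprod (Bin q) w = piB q U (mprod (tin E) w).
Proof. exact: mprod_quo. Qed.

(** A local combination of [i]-fold products in [B] lifts term by term to words of the same length,
    so the lift stays in degree [i]. *)
Lemma Bdeg_lift i U (b : Bdeg q i U) : locally (fun W (h : W <<= U) =>
  exists t : deg (tin E) i W, spval (mres h b) = piB q W (spval t)).
Proof.
move=> u Uu; have [W [h [Wu c]]] := gens_deg b Uu; exists W, h; split=> //.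
elim: c => [|V k a j y [w sw e] _ [t IH]]; first by exists 0; rewrite hom_zero.
exists (a *: mres k (dprod (tin E) sw) + t).
have -> : spval (a *: mres k j + y) = a *: mres k (spval j) + spval y by [].
by rewrite IH e mprod_Bin -hnat -hlin.
Qed.

(* A local section l of L maps to zero in wedge^2 E, so a lift of iota l to
   T^2(E) lies in S_2 E. *)
Lemma L_local_q2 U (l : L U) :
  locally (fun W (h : W <<= U) => exists s : S2 E W, mres h l = q2 q W s).
Proof.
move=> u Uu; have [V [h [Vu [t et]]]] := Bdeg_lift (iota Bs U l) Uu.
have w0 : wp Bs V (mres h (iota Bs U l)) = 0.
  by apply/iota_wp; exists (mres h l); rewrite hnat.
have p0 : mquo_proj (@is_square _ _ E) t = mquo_proj (@is_square _ _ E) 0.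
  rewrite -(wp_piB Bs et) w0.
  by symmetry; exact: (@shunit_eq _ _ (rawmquo (@is_square X O E)) _ _ _ (weq_refl _)).
have [W [k [Wu c]]] := shunit_loc_eq p0 Vu.
have l' : W <<= U by move=> x /k /h.
exists W, l'; split=> //.
have sp : in_span (@is_square _ _ E) (mres k t).
  have {}c : comb (@is_square _ _ E) (mres k (t : T2 E V) - mres k (0 : T2 E V)) := c.
  move: c; rewrite mres0 subr0 => c.
  by apply: locally_all => W' k'; exact: comb_res.
exists (SpSec sp); apply: (@iota_inj _ _ _ _ _ Bs); apply: spval_inj.
rewrite iota_q2 hnat -(mres_comp h k l').
have -> : spval (mres k (mres h (iota Bs U l))) =
  mres k (spval (mres h (iota Bs U l))) by [].
by rewrite et; exact: (esym (hnat (piB q) k (spval t))).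
Qed.

(* If no such form existed, q2 would be hom0, so L_local_q2 would force L = 0, and then
   hom0 itself would be such a form. *)
Lemma q2P U (v : E U) (s : S2 E U) :
  spval (spval s) = mul (tin E U v) (tin E U v) -> q2 q U s = q U v.
Proof.
have := L_local_q2; rewrite /q2 /the; case: pselect => [ex _|nex L0].
  by move: U v s; exact: (projT2 (cid ex)).
case: nex; exists (hom0 (S2 E) L) => {v s}U v s _.
apply: (sheaf_sep hL.1) => u Uu; have [W [h [Wu [t et]]]] := L0 U (q U v) u Uu.
by exists W, h; split=> //; rewrite et /= mres0.
Qed.

Lemma sq_in_deg U (v : E U) :
  in_span (fun U x => exists2 w : seq (E U), size w = 2 & x = mprod (tin E) w)
    (mul (tin E U v) (tin E U v)).
Proof. by apply: in_span_gen; exists [:: v; v] => //=; rewrite mul_oner. Qed.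

Lemma sq_in_S2 U (v : E U) : in_span (@is_square _ _ E) (SpSec (sq_in_deg v) : T2 E U).
Proof. by apply: in_span_gen; exists v. Qed.

Definition sq U (v : E U) : S2 E U := SpSec (sq_in_S2 v).

Lemma q2_sq U (v : E U) : q2 q U (sq v) = q U v.
Proof. exact: q2P. Qed.

Lemma gens_S2 : @gens X O (S2 E) (fun U s => exists v, s = sq v).
Proof.
move=> U s u Uu; have [W [h [Wu c]]] := gens_span s Uu.
exists W, h; split=> //; elim: c => [|V k a j y [v ev] _ IH]; first exact: comb0.
by constructor=> //; exists v; apply: spval_inj; apply: spval_inj.
Qed.

(** [L] is locally the image of S_2 E under [q2], and squares generate S_2 E. This is the input that
    makes the cancellation of the q(v)^2 possible. *)
Lemma gens_L : @gens X O L (fun U l => exists v, l = q U v).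
Proof.
move=> U l; apply: in_span_local => u Uu; have [W [h [Wu [s es]]]] := L_local_q2 l Uu.
exists W, h; split=> //; rewrite es; apply: (in_span_hom gens_S2) => V _ [v ->].
by apply: in_span_gen; exists v; exact: q2_sq.
Qed.

Lemma gens_B : @gens X O (B q) (fun U x => exists w, x = mprod (Bin q) w).
Proof.
move=> U x u Uu; have [W [h [Wu c]]] := gens_quo (@gens_talg _ _ E) x Uu.
exists W, h; split=> //; elim: c => [|V k a j y [_ [w ->] ->] _ IH]; first exact: comb0.
by constructor=> //; exists w; rewrite mprod_Bin.
Qed.

Definition iotaB U (l : L U) : B q U := spval (iota Bs U l).

Lemma iotaB_lin U a (l l' : L U) : iotaB (a *: l + l') = a *: iotaB l + iotaB l'.
Proof. by rewrite /iotaB hlin. Qed.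

Lemma iotaB_nat U V (h : V <<= U) (l : L U) : iotaB (mres h l) = mres h (iotaB l).
Proof. by rewrite /iotaB hnat. Qed.

Definition iB : hom L (B q) := Hom iotaB_lin iotaB_nat.

(** The left-hand square of the morphism of sequences, evaluated at [v (x) v]. *)
Lemma iB_q U (v : E U) : iB U (q U v) = mul (Bin q U v) (Bin q U v).
Proof.
have e : iB U (q U v) = piB q U (mul (tin E U v) (tin E U v)).
  refine (etrans _ (iota_q2 Bs (sq v))).
  exact (congr1 (fun l => spval (iota Bs U l)) (esym (q2_sq v))).
apply: (etrans e).
exact (quo_appM (@I2 _ _ _ _ q) (tin E U v) (tin E U v)).
Qed.

Lemma iB_central U (l : L U) (b : B q U) : mul (iB U l) b = mul b (iB U l).
Proof. exact: (square_central (@quo_is_sheaf _ _ _ _) iB_q gens_B gens_L hL). Qed.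

Lemma Bin_mid U (u v w : E U) :
  mul (mul (Bin q U u) (Bin q U v)) (mul (Bin q U v) (Bin q U w)) =
  mul (mul (Bin q U u) (Bin q U w)) (iB U (q U v)).
Proof. exact: (square_mid (@quo_is_sheaf _ _ _ _) iB_q gens_B gens_L hL). Qed.

End HomogeneousClifford.

(** * The algebra structure on the colimit *)

Section EvenClifford.
Variables (X : topologicalType) (O : rpsh X) (E L : mpsh O) (q : quad_form E L).
Variable Bs : B2_sequence q.
Hypothesis hL : line_bundle L.
Implicit Types (U V W : opn X).

Let deg2 m : (m.*2 + 2 = m.+1.*2)%N. Proof. by rewrite addn2. Qed.
Let deg1 m : (m + 1 = m.+1)%N. Proof. exact: addn1. Qed.

(** The value prescribed for [tau] at [f(l) b (x) phi], kept as a function of all four arguments so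
    that [contract] applies to it. *)
Definition tau_val m U (b : Bdeg q m.*2 U) (phi : Tdual L m U) (l : L U)
    (f : dual L U) : F q m.+1 U :=
  ten (dmul (deg2 m) b (iota Bs U l) : Bdeg q m.+1.*2 U)
    (dmul (deg1 m) phi (dgen (tin (dual L)) f) : Tdual L m.+1 U).

Lemma tau_val_res m U V (h : V <<= U) (b : Bdeg q m.*2 U) (phi : Tdual L m U) l f :
  tau_val (mres h b) (mres h phi) (mres h l) (mres h f) = mres h (tau_val b phi l f).
Proof. by rewrite /tau_val -ten_res -!dmul_res hnat dgen_res. Qed.

Lemma tau_valZl m U a (b : Bdeg q m.*2 U) (phi : Tdual L m U) l f :
  tau_val b phi (a *: l) f = a *: tau_val b phi l f.
Proof. by rewrite /tau_val hom_scale dmulZr tenZl. Qed.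

Lemma tau_valZr m U a (b : Bdeg q m.*2 U) (phi : Tdual L m U) l f :
  tau_val b phi l (a *: f) = a *: tau_val b phi l f.
Proof. by rewrite /tau_val dgenZ dmulZr tenZr. Qed.

Lemma F_is_sheaf m : is_sheaf (F q m).
Proof. exact: sheafify_is_sheaf. Qed.

Lemma tau_val_linl m U a (b b' : Bdeg q m.*2 U) (phi : Tdual L m U) l f :
  tau_val (a *: b + b') phi l f = a *: tau_val b phi l f + tau_val b' phi l f.
Proof. by rewrite /tau_val dmul_linl ten_linl. Qed.

Lemma tau_val_linr m U a (b : Bdeg q m.*2 U) (phi phi' : Tdual L m U) l f :
  tau_val b (a *: phi + phi') l f = a *: tau_val b phi l f + tau_val b phi' l f.
Proof. by rewrite /tau_val dmul_linl ten_linr. Qed.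

(** If no map as described existed, the contraction of [tau_val] would nevertheless be one. Hence
    [tau] satisfies its description instead of falling back on the default. *)
Lemma tauE m U (b : Bdeg q m.*2 U) (phi : Tdual L m U) l f :
  tau Bs m U (ev f l *: ten b phi) = tau_val b phi l f.
Proof.
rewrite /tau /the; case: pselect => [ex|nex].
  apply: (projT2 (cid ex)); first exact: spval_dmul.
  by rewrite spval_dmul spval_dgen.
pose bb := contract hL (@F_is_sheaf m.+1) (@tau_val_res m) (@tau_val_linl m)
  (@tau_val_linr m) (@tau_valZl m) (@tau_valZr m).
case: nex; exists (tens_hom (@F_is_sheaf m.+1) bb).
move=> {b phi l f} U' b phi l f b' phi' eb ephi.
rewrite hom_scale tens_homE contractE /tau_val; congr (ten _ _).
  by apply: spval_inj; rewrite eb.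
by apply: spval_inj; rewrite ephi spval_dmul spval_dgen.
Qed.

Notation B0 := (B0 Bs).
Notation B0in := (B0in Bs).

Lemma B0_is_sheaf : is_sheaf B0.
Proof. exact: sheafify_is_sheaf. Qed.

(** Classes coming from levels whose indices are only provably equal are compared through their
    values in [B] and in T(L^vee), so that no transport between levels appears. *)
Lemma B0in_eq m m' U (b : Bdeg q m.*2 U) (phi : Tdual L m U)
    (b' : Bdeg q m'.*2 U) (phi' : Tdual L m' U) :
  m = m' -> spval b = spval b' -> spval phi = spval phi' -> B0in b phi = B0in b' phi'.
Proof.
move=> em; case: _ / em b' phi' => b' phi' eb ephi.
by rewrite (spval_inj eb) (spval_inj ephi).
Qed.

Lemma B0in_linl m U a (b b' : Bdeg q m.*2 U) (phi : Tdual L m U) :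
  B0in (a *: b + b') phi = a *: B0in b phi + B0in b' phi.
Proof. by rewrite /B0in ten_linl cin_lin. Qed.

Lemma B0in_linr m U a (b : Bdeg q m.*2 U) (phi phi' : Tdual L m U) :
  B0in b (a *: phi + phi') = a *: B0in b phi + B0in b phi'.
Proof. by rewrite /B0in ten_linr cin_lin. Qed.

Lemma B0in_res m U V (h : V <<= U) (b : Bdeg q m.*2 U) (phi : Tdual L m U) :
  B0in (mres h b) (mres h phi) = mres h (B0in b phi).
Proof. by rewrite /B0in ten_res cin_res. Qed.

Definition B0in_bil m : bil (Bdeg q m.*2) (Tdual L m) B0 :=
  Bil (@B0in_linl m) (@B0in_linr m) (@B0in_res m).

Lemma B0in_ev m U (b : Bdeg q m.*2 U) (phi : Tdual L m U) l f :
  ev f l *: B0in b phi = B0in (dmul (deg2 m) b (iota Bs U l) : Bdeg q m.+1.*2 U)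
    (dmul (deg1 m) phi (dgen (tin (dual L)) f) : Tdual L m.+1 U).
Proof.
rewrite -(hom_scale (cin_hom (tau Bs) m)) [LHS]/= -cin_tr tauE.
by [].
Qed.

Definition is_B0word U (x : B0 U) : Prop :=
  exists m (b : Bdeg q m.*2 U) (phi : Tdual L m U),
    [/\ is_dprod b, is_dprod phi & x = B0in b phi].

Lemma gens_B0 : gens is_B0word.
Proof.
have gF m : @gens X O (F q m) (fun U x => exists b phi, x = ten b phi).
  exact: gens_tens.
move=> U x; apply: in_span_local => u Uu; have [W [h [Wu c]]] := gens_colim gF x Uu.
exists W, h; split=> //; elim: c => [|V k a _ y [m [_ [[b [phi ->]] ->]]] _ IH].
  exact: in_span0.
apply: in_span_lin => //; apply: in_span_res.
apply: (bil_span (b := B0in_bil m) (@gens_deg _ _ _ _ (Bin q) m.*2)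
  (@gens_deg _ _ _ _ (tin (dual L)) m)); [exact: is_dprod_res|exact: is_dprod_res|].
by move=> U' b' phi' db dphi; apply: in_span_gen; exists m, b', phi'.
Qed.

Lemma is_B0word_res : res_stable is_B0word.
Proof.
move=> U V h x [m [b [phi [db dphi ->]]]]; exists m, (mres h b), (mres h phi).
by rewrite B0in_res; split=> //; exact: is_dprod_res.
Qed.

Let dadd m k : (m.*2 + k.*2 = (m + k).*2)%N. Proof. by rewrite doubleD. Qed.

Definition B0mul_val m k U (b : Bdeg q m.*2 U) (phi : Tdual L m U)
    (c : Bdeg q k.*2 U) (psi : Tdual L k U) : B0 U :=
  B0in (dmul (dadd m k) b c : Bdeg q (m + k).*2 U)
    (dmul (erefl (m + k)%N) phi psi : Tdual L (m + k) U).

Section Graded.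
Variables m k : nat.

Lemma B0mul_val_res U V (h : V <<= U) (b : Bdeg q m.*2 U) (phi : Tdual L m U)
    (c : Bdeg q k.*2 U) (psi : Tdual L k U) :
  B0mul_val (mres h b) (mres h phi) (mres h c) (mres h psi) =
  mres h (B0mul_val b phi c psi).
Proof.
apply: (etrans _ (B0in_res h _ _)).
exact: (congr2 (@B0in (m + k) V) (dmul_res _ h b c) (dmul_res _ h phi psi)).
Qed.

Lemma B0mul_val_lin1 U a (b b' : Bdeg q m.*2 U) phi (c : Bdeg q k.*2 U) psi :
  B0mul_val (a *: b + b') phi c psi = a *: B0mul_val b phi c psi + B0mul_val b' phi c psi.
Proof.
apply: (etrans _ (B0in_linl a _ _ _)).
exact: (congr1 (fun z => @B0in (m + k) U z _) (dmul_linl _ a b b' c)).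
Qed.

Lemma B0mul_val_lin2 U a b (phi phi' : Tdual L m U) (c : Bdeg q k.*2 U) psi :
  B0mul_val b (a *: phi + phi') c psi = a *: B0mul_val b phi c psi + B0mul_val b phi' c psi.
Proof.
apply: (etrans _ (B0in_linr a _ _ _)).
exact: (congr1 (fun z => @B0in (m + k) U _ z) (dmul_linl _ a phi phi' psi)).
Qed.

Lemma B0mul_val_lin3 U a (b : Bdeg q m.*2 U) phi (c c' : Bdeg q k.*2 U) psi :
  B0mul_val b phi (a *: c + c') psi = a *: B0mul_val b phi c psi + B0mul_val b phi c' psi.
Proof.
apply: (etrans _ (B0in_linl a _ _ _)).
exact: (congr1 (fun z => @B0in (m + k) U z _) (dmul_linr _ a b c c')).
Qed.

Lemma B0mul_val_lin4 U a (b : Bdeg q m.*2 U) phi c (psi psi' : Tdual L k U) :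
  B0mul_val b phi c (a *: psi + psi') = a *: B0mul_val b phi c psi + B0mul_val b phi c psi'.
Proof.
apply: (etrans _ (B0in_linr a _ _ _)).
exact: (congr1 (fun z => @B0in (m + k) U _ z) (dmul_linr _ a phi psi psi')).
Qed.

Definition F_mul : bil (F q m) (F q k) B0 :=
  tens_bil B0_is_sheaf B0mul_val_res B0mul_val_lin1 B0mul_val_lin2 B0mul_val_lin3
    B0mul_val_lin4.

Lemma F_mulE U (b : Bdeg q m.*2 U) (phi : Tdual L m U)
    (c : Bdeg q k.*2 U) (psi : Tdual L k U) :
  F_mul U (ten b phi) (ten c psi) = B0mul_val b phi c psi.
Proof. exact: tens_bilE. Qed.

End Graded.

Lemma tin_dual_comm U (f : dual L U) (t : talg (dual L) U) :
  mul (tin (dual L) U f) t = mul t (tin (dual L) U f).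
Proof.
exact: (@dual_alg_comm _ _ _ hL (talg (dual L)) (@sheafify_is_sheaf _ _ _) (tin (dual L))
  (@gens_talg _ _ (dual L))).
Qed.

Lemma tau_pair m U (b : Bdeg q m.*2 U) (phi : Tdual L m U) l f :
  dual_pair l f -> tau Bs m U (ten b phi) = tau_val b phi l f.
Proof. by move=> p; rewrite -tauE p scale1r. Qed.

Lemma B0in_pair m U (b : Bdeg q m.*2 U) (phi : Tdual L m U) l f :
  dual_pair l f ->
  B0in b phi = B0in (dmul (deg2 m) b (iota Bs U l) : Bdeg q m.+1.*2 U)
    (dmul (deg1 m) phi (dgen (tin (dual L)) f) : Tdual L m.+1 U).
Proof. by move=> p; rewrite -B0in_ev p scale1r. Qed.

(** [tau] puts [l] and [f] in the middle of the product, [b l c (x) phi f psi], whereas the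
    transition map after multiplying puts them at the end. Centrality of [L] in [B] and
    commutativity of T(L^vee) make up the difference; in the right-hand variable associativity is
    enough. *)
Lemma F_mul_taul m k U (x : F q m U) (y : F q k U) :
  F_mul m.+1 k U (tau Bs m U x) y = F_mul m k U x y.
Proof.
apply: (bil_ext (b := bil_precompl (F_mul m.+1 k) (tau Bs m)) (b' := F_mul m k) B0_is_sheaf
  (@gens_paired_tensor _ _ _ hL _ _) (@gens_paired_tensor _ _ _ hL _ _)
  (@paired_tensor_res _ _ _ _ _) (@paired_tensor_res _ _ _ _ _)).
move=> {x y}U _ _ [b [phi [l [f [p ->]]]]] [c [psi [_ [_ [_ ->]]]]].
apply: (etrans (congr1 (fun z => F_mul m.+1 k U z (ten c psi)) (tau_pair b phi p))).
apply: (etrans (F_mulE _ _ _ _)); apply: (etrans _ (esym (F_mulE _ _ _ _))).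
apply: (etrans _ (esym (B0in_pair _ _ p))); apply: B0in_eq; first by rewrite addSn.
  rewrite !spval_dmul -[LHS]mulA -[RHS]mulA.
  exact: (congr1 (mul _) (iB_central Bs hL l _)).
rewrite !spval_dmul spval_dgen -[LHS]mulA -[RHS]mulA.
exact: (congr1 (mul _) (tin_dual_comm f _)).
Qed.

Lemma F_mul_taur m k U (x : F q m U) (y : F q k U) :
  F_mul m k.+1 U x (tau Bs k U y) = F_mul m k U x y.
Proof.
apply: (bil_ext (b := bil_precompr (F_mul m k.+1) (tau Bs k)) (b' := F_mul m k) B0_is_sheaf
  (@gens_paired_tensor _ _ _ hL _ _) (@gens_paired_tensor _ _ _ hL _ _)
  (@paired_tensor_res _ _ _ _ _) (@paired_tensor_res _ _ _ _ _)).
move=> {x y}U _ _ [b [phi [_ [_ [_ ->]]]]] [c [psi [l [f [p ->]]]]].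
apply: (etrans (congr1 (fun z => F_mul m k.+1 U (ten b phi) z) (tau_pair c psi p))).
apply: (etrans (F_mulE _ _ _ _)); apply: (etrans _ (esym (F_mulE _ _ _ _))).
apply: (etrans _ (esym (B0in_pair _ _ p))); apply: B0in_eq; first by rewrite addnS.
  by rewrite !spval_dmul mulA.
by rewrite !spval_dmul mulA.
Qed.

Definition B0_mul : bil B0 B0 B0 := colim_bil B0_is_sheaf F_mul_taul F_mul_taur.

Lemma B0_mulE m k U (b : Bdeg q m.*2 U) (phi : Tdual L m U)
    (c : Bdeg q k.*2 U) (psi : Tdual L k U) :
  B0_mul U (B0in b phi) (B0in c psi) = B0mul_val b phi c psi.
Proof. by rewrite /B0in colim_bilE F_mulE. Qed.

Definition B0_one U : B0 U := B0in (m := 0) (done (Bin q) U) (done (tin (dual L)) U).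

Lemma B0_one_res U V (h : V <<= U) : mres h (B0_one U) = B0_one V.
Proof.
rewrite -B0in_res; apply: B0in_eq => //; rewrite mres_span; exact: (one_res _ h).
Qed.

Lemma B0_mul1l U (x : B0 U) : B0_mul U (B0_one U) x = x.
Proof.
move: U x; apply: (gen_ind gens_B0).
- move=> U x H; apply: (sheaf_sep B0_is_sheaf) => u Uu.
  have [W [h [Wu e]]] := H u Uu; exists W, h; split=> //.
  by rewrite -bnat B0_one_res.
- by move=> U; rewrite bil0r.
- by move=> U a x y e e'; rewrite blinr e e'.
- move=> U V h _ [m [b [phi [_ _ ->]]]]; rewrite -(B0_one_res h) bnat; congr mres.
  by rewrite B0_mulE; apply: B0in_eq => //; exact: mul_onel.
Qed.

Lemma B0_mul1r U (x : B0 U) : B0_mul U x (B0_one U) = x.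
Proof.
move: U x; apply: (gen_ind gens_B0).
- move=> U x H; apply: (sheaf_sep B0_is_sheaf) => u Uu.
  have [W [h [Wu e]]] := H u Uu; exists W, h; split=> //.
  by rewrite -bnat B0_one_res.
- by move=> U; rewrite bil0l.
- by move=> U a x y e e'; rewrite blinl e e'.
- move=> U V h _ [m [b [phi [_ _ ->]]]]; rewrite -(B0_one_res h) bnat; congr mres.
  by rewrite B0_mulE; apply: B0in_eq; rewrite ?addn0 //; exact: mul_oner.
Qed.

Lemma B0_mulA U (x y z : B0 U) :
  B0_mul U x (B0_mul U y z) = B0_mul U (B0_mul U x y) z.
Proof.
move: U x y z.
(* [gen_ind2] treats two arguments at a time: [x] stays universally quantified and receives its own
   induction once [y] and [z] are words. *)
suff H : forall U (y z x : B0 U), B0_mul U x (B0_mul U y z) = B0_mul U (B0_mul U x y) z.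
  by move=> *; exact: H.
apply: (gen_ind2 gens_B0 gens_B0 is_B0word_res is_B0word_res).
- move=> U y z H x; apply: (sheaf_sep B0_is_sheaf) => u Uu.
  by have [W [h [Wu e]]] := H u Uu; exists W, h; rewrite -!bnat e.
- by move=> U z x; rewrite bil0l !bil0r bil0l.
- by move=> U y x; rewrite !bil0r.
- by move=> U a y y' z e e' x; rewrite blinl !blinr e e' blinl.
- by move=> U a y z z' e e' x; rewrite !blinr e e'.
- move=> U y z wy wz x; move: U x y z wy wz; apply: (gen_ind gens_B0).
  + move=> U x H y z wy wz; apply: (sheaf_sep B0_is_sheaf) => u Uu.
    have [W [h [Wu e]]] := H u Uu; exists W, h; split=> //; rewrite -!bnat.
    by apply: e; exact: is_B0word_res.
  + by move=> U y z _ _; rewrite !bil0l.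
  + by move=> U a x x' e e' y z wy wz; rewrite !blinl e // e'.
  + move=> U V h _ [m [b [phi [_ _ ->]]]] _ _ [k [c [psi [_ _ ->]]]] [i [d [chi [_ _ ->]]]].
    rewrite -B0in_res !B0_mulE; apply: B0in_eq; rewrite ?addnA // !spval_dmul.
      exact: mulA.
    exact: mulA.
Qed.

Definition B0_alg : alg_struct B0 :=
  AlgStruct B0_mulA B0_mul1l B0_mul1r
    (fun U a x y z => blinl B0_mul a x y z) (fun U a x y z => blinr B0_mul a z x y)
    B0_one_res (fun U V h x y => esym (bnat B0_mul h x y)).

Lemma B0_alg_induced : induced_from_B B0_alg.
Proof.
split=> [U b phi eb ephi|U m k b phi c psi b' phi' eb ephi].
  by apply: B0in_eq; rewrite ?eb ?ephi.
by rewrite [LHS]B0_mulE; apply: B0in_eq => //; rewrite ?eb ?ephi.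
Qed.

End EvenClifford.

(** * The universal property of C_0 *)

Section C0Universal.
Variables (X : topologicalType) (O : rpsh X) (E L : mpsh O) (q : quad_form E L).
Implicit Types (U V W : opn X).

Definition evenT U (u v : E U) (f : dual L U) : EEL E L U := ten (ten u v) f.

(** The relations [J1] and [J2] read in an arbitrary algebra [A]. When [A] is a sheaf, such a [k]
    extends to an algebra morphism from C_0. *)
Definition clifford_map (A : alg O) (k : hom (EEL E L) A) : Prop :=
  (forall U (v : E U) (f : dual L U), k U (evenT v v f) = ev f (q U v) *: one A U) /\
  (forall U (u v w : E U) (f g : dual L U),
     mul (k U (evenT u v f)) (k U (evenT v w g)) = ev f (q U v) *: k U (evenT u w g)).

Lemma evenT_res U V (h : V <<= U) (u v : E U) (f : dual L U) :
  evenT (mres h u) (mres h v) (mres h f) = mres h (evenT u v f).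
Proof. by rewrite /evenT !ten_res. Qed.

Definition is_evenT U (x : EEL E L U) : Prop := exists u v f, x = evenT u v f.

Lemma is_evenT_res : res_stable is_evenT.
Proof.
move=> U V h _ [u [v [f ->]]]; exists (mres h u), (mres h v), (mres h f).
by rewrite evenT_res.
Qed.

Lemma gens_evenT : gens is_evenT.
Proof.
have gT : gens (fun U (f : dual L U) => True) by move=> U f; exact: in_span_gen.
have rT : res_stable (fun U (f : dual L U) => True) by [].
have rE : res_stable (fun U (x : tens E E U) => exists u v, x = ten u v).
  by move=> U V h _ [u [v ->]]; exists (mres h u), (mres h v); rewrite ten_res.
have H U (x : tens E E U) (f : dual L U) : in_span is_evenT (ten x f).
  move: U x f; apply: (bil_span (b := ten_bil _ _) (@gens_tens _ _ _ _) gT rE rT).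
  by move=> U _ f [u [v ->]] _; apply: in_span_gen; exists u, v, f.
move=> U x; apply: in_span_local => w Uw; have [W [h [Ww c]]] := gens_tens x Uw.
exists W, h; split=> //; elim: c => [|V k a _ y [z [f ->]] _ IH]; first exact: in_span0.
by apply: in_span_lin => //; apply: in_span_res.
Qed.

Let J U (x : talg (EEL E L) U) := J1 q x \/ J2 q x.

Lemma pure_res U V (h : V <<= U) (u v : E U) (f : dual L U) :
  pure (mres h u) (mres h v) (mres h f) = mres h (pure u v f).
Proof. by rewrite /pure -hnat -!ten_res. Qed.

Lemma J_res : res_stable J.
Proof.
move=> U V h x [[v [f ->]]|[u [v [w [f [g ->]]]]]]; [left|right].
  exists (mres h v), (mres h f).
  by rewrite mresB mresZ one_res pure_res qnat ev_res.
exists (mres h u), (mres h v), (mres h w), (mres h f), (mres h g).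
by rewrite mresB mresZ mul_res !pure_res qnat ev_res.
Qed.

Definition C0in : hom (EEL E L) (C0 q) := comp_hom (quo_proj J) (tin (EEL E L)).

Section Hom.
Variables (A : alg O) (sA : is_sheaf A) (k : hom (EEL E L) A).
Hypothesis kq : clifford_map k.

Let t := talg_hom sA k.

Let t_pure U (u v : E U) (f : dual L U) : t U (pure u v f) = k U (evenT u v f).
Proof. exact: talg_hom_tin. Qed.

Lemma clifford_map_J U (x : talg (EEL E L) U) : J x -> t U x = 0.
Proof.
move=> [[v [f ->]]|[u [v [w [f [g ->]]]]]]; rewrite hom_sub hom_scale !t_pure.
  by rewrite (talg_hom1 sA k U) kq.1 subrr.
apply/eqP; rewrite subr_eq0; apply/eqP; apply: (etrans _ (kq.2 U u v w f g)).
apply: (etrans (talg_homM sA k _ _)).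
exact: (congr2 (@mul _ _ A U) (t_pure u v f) (t_pure v w g)).
Qed.

Definition C0_hom : hom (C0 q) A :=
  quo_alg_hom sA (fun U x y => talg_homM sA k x y) clifford_map_J J_res.

Lemma C0_hom1 U : C0_hom U (one (C0 q) U) = one A U.
Proof. by apply: quo_alg_hom1; exact: talg_hom1. Qed.

Lemma C0_homM U (x y : C0 q U) : C0_hom U (mul x y) = mul (C0_hom U x) (C0_hom U y).
Proof. exact: quo_alg_homM. Qed.

Lemma C0_hom_in U (x : EEL E L U) : C0_hom U (C0in U x) = k U x.
Proof. exact: (etrans (quo_alg_homE _ _ _ _ _) (talg_hom_tin sA k x)). Qed.

End Hom.

Lemma C0in_clifford : clifford_map C0in.
Proof.
split=> [U v f|U u v w f g].
  have Jx : J (pure v v f - ev f (q U v) *: one (talg (EEL E L)) U) by left; exists v, f.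
  exact: (quo_app_rel Jx).
have Jx : J (mul (pure u v f) (pure v w g) - ev f (q U v) *: pure u w g).
  by right; exists u, v, w, f, g.
exact: (etrans (esym (quo_appM J (pure u v f) (pure v w g))) (quo_app_rel Jx)).
Qed.

Lemma C0_is_sheaf : is_sheaf (C0 q).
Proof. exact: sheafify_is_sheaf. Qed.

Lemma mprod_C0in U (w : seq (EEL E L U)) :
  mprod C0in w = quo_app J (mprod (tin (EEL E L)) w).
Proof. exact: mprod_quo. Qed.

Lemma gens_C0 : @gens X O (C0 q) (fun U x => exists w, x = mprod C0in w).
Proof.
move=> U x u Uu; have [W [h [Wu c]]] := gens_quo (@gens_talg _ _ (EEL E L)) x Uu.
exists W, h; split=> //; elim: c => [|V k a j y [_ [w ->] ->] _ IH]; first exact: comb0.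
by constructor=> //; exists w; rewrite mprod_C0in.
Qed.

End C0Universal.

(** * The pairing of words *)

Section Pairing.
Variables (X : topologicalType) (O : rpsh X) (E L : mpsh O) (q : quad_form E L).
Variables (A : alg O) (sA : is_sheaf A) (k : hom (EEL E L) A).
Hypothesis kq : clifford_map q k.
Implicit Types (U V W : opn X).

Definition ke U (u v : E U) (f : dual L U) : A U := k U (evenT u v f).

Lemma ke_lin1 U a (u u' v : E U) (f : dual L U) :
  ke (a *: u + u') v f = a *: ke u v f + ke u' v f.
Proof. by rewrite /ke /evenT !ten_linl hlin. Qed.

Lemma ke_lin2 U a (u v v' : E U) (f : dual L U) :
  ke u (a *: v + v') f = a *: ke u v f + ke u v' f.
Proof. by rewrite /ke /evenT ten_linr ten_linl hlin. Qed.

Lemma ke_lin3 U a (u v : E U) (f g : dual L U) :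
  ke u v (a *: f + g) = a *: ke u v f + ke u v g.
Proof. by rewrite /ke /evenT ten_linr hlin. Qed.

Lemma ke_res U V (h : V <<= U) (u v : E U) (f : dual L U) :
  ke (mres h u) (mres h v) (mres h f) = mres h (ke u v f).
Proof. by rewrite /ke evenT_res hnat. Qed.

(** The product of the [k (u_i (x) v_i (x) f_i)], set to [0] when the lengths do not match. With
    this convention it is multilinear on words of any length, hence defines a pairing of the two
    full tensor algebras. *)
Fixpoint pairing U (w : seq (E U)) (s : seq (dual L U)) : A U :=
  match s with
  | [::] => if w is [::] then one A U else 0
  | f :: s' => if w is u :: v :: w' then mul (ke u v f) (pairing w' s') else 0
  end.

Lemma pairing_res U V (h : V <<= U) (w : seq (E U)) (s : seq (dual L U)) :
  pairing (map (mres h) w) (map (mres h) s) = mres h (pairing w s).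
Proof.
elim: s w => [|f s IH] [|u [|v w]] /=; rewrite ?mres0 ?one_res //.
by rewrite IH ke_res mul_res.
Qed.

Lemma pairing_linl U a w w' (x y : E U) (s : seq (dual L U)) :
  pairing (w ++ (a *: x + y) :: w') s =
  a *: pairing (w ++ x :: w') s + pairing (w ++ y :: w') s.
Proof.
elim: s w => [|f s IH] [|u [|v w]] /=; rewrite ?scaler0 ?addr0 //.
- by case: w' {IH} => [|v w']; rewrite ?scaler0 ?addr0 // ke_lin1 mul_linl.
- by rewrite ke_lin2 mul_linl.
- by rewrite IH mul_linr.
Qed.

Lemma pairing_linr U a (w : seq (E U)) s s' (f g : dual L U) :
  pairing w (s ++ (a *: f + g) :: s') =
  a *: pairing w (s ++ f :: s') + pairing w (s ++ g :: s').
Proof.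
elim: s w => [|e s IH] [|u [|v w]] /=; rewrite ?scaler0 ?addr0 //.
- by rewrite ke_lin3 mul_linl.
- by rewrite IH mul_linr.
Qed.

(** The length condition makes the cut into pairs of vectors fall exactly at the junction of the two
    words. *)
Lemma pairing_cat U (w w' : seq (E U)) (s s' : seq (dual L U)) :
  size w = (size s).*2 -> pairing (w ++ w') (s ++ s') = mul (pairing w s) (pairing w' s').
Proof.
elim: s w => [|f s IH] [|u [|v w]] //=; first by rewrite mul_onel.
by move=> [e]; rewrite IH // mulA.
Qed.

(* A square at an even position is removed by the first Clifford relation, and a
   square straddling two consecutive generators by the second one. *)
Lemma pairing_square U (w w' : seq (E U)) (s : seq (dual L U)) :
  exists (f : dual L U) (c : A U), forall V (h : V <<= U) (v : E V),
    pairing (map (mres h) w ++ v :: v :: map (mres h) w') (map (mres h) s) =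
    ev (mres h f) (q V v) *: mres h c.
Proof.
elim: s w => [|f s IH] w.
  by exists 0, 0 => V h v; rewrite !mres0 scaler0; case: w => [|? []].
case: w => [|u [|u' w]].
- exists f, (pairing w' s) => V h v /=.
  by rewrite pairing_res /ke kq.1 mulZl mul_onel.
- case: s {IH} => [|g s].
    by exists 0, 0 => V h v; rewrite !mres0 scaler0 /= Defs.mul0r.
  case: w' => [|u' w''].
    by exists 0, 0 => V h v; rewrite !mres0 scaler0 /= Defs.mul0r.
  exists f, (mul (ke u u' g) (pairing w'' s)) => V h v /=.
  by rewrite mulA /ke kq.2 mulZl pairing_res -/(ke _ _ _) ke_res mul_res.
- have [g [c H]] := IH w; exists g, (mul (ke u u' f) c) => V h v /=.
  by rewrite H ke_res mulZr mul_res.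
Qed.

Let g_res U V (h : V <<= U) (w : word_pres E U) (s : word_pres (dual L) U) :
  pairing (pres_res h w : seq (E V)) (pres_res h s : seq (dual L V)) = mres h (pairing w s).
Proof. exact: pairing_res. Qed.

Let g_rell U (y : word_pres (dual L) U) s t : prel s t ->
  teval (fun x : word_pres E U => pairing x y) s =
  teval (fun x : word_pres E U => pairing x y) t.
Proof. by case=> * /=; exact: pairing_linl. Qed.

Let g_relr U (x : word_pres E U) s t : prel s t ->
  teval (fun y : word_pres (dual L) U => pairing x y) s =
  teval (fun y : word_pres (dual L) U => pairing x y) t.
Proof. by case=> * /=; exact: pairing_linr. Qed.

Definition talg_pairing : bil (talg E) (talg (dual L)) A :=
  pres_bil sA g_res g_rell g_relr.

Lemma talg_pairingE U (w : seq (E U)) (s : seq (dual L U)) :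
  talg_pairing U (mprod (tin E) w) (mprod (tin (dual L)) s) = pairing w s.
Proof. by rewrite -!pgenerator_mprod; exact: pres_bilE. Qed.

Variable Bs : B2_sequence q.
Hypothesis hL : line_bundle L.

Let S2in : hom (S2 E) (talg E) :=
  comp_hom (span_incl _) (span_incl (@is_square _ _ E)).

Let S2in_sq U (v : E U) : S2in U (sq v) = mul (tin E U v) (tin E U v).
Proof. by []. Qed.

(** The formula assumed for squares spreads to the sections of S_2 E that they generate, with [q2 x]
    in place of [q v]. It is assumed over all smaller opens because the induction passes to them. *)
Lemma talg_pairing_S2 U (x : S2 E U) (w w' : seq (E U)) (s : seq (dual L U)) f c :
  (forall V (h : V <<= U) (v : E V),
    pairing (map (mres h) w ++ v :: v :: map (mres h) w') (map (mres h) s) =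
    ev (mres h f) (q V v) *: mres h c) ->
  talg_pairing U (mul (mul (mprod (tin E) w) (S2in U x)) (mprod (tin E) w'))
    (mprod (tin (dual L)) s) = ev f (q2 q U x) *: c.
Proof.
move: U x w w' s f c; apply: (gen_ind (@gens_S2 _ _ E)).
- move=> U x l w w' s f c H; apply: (sheaf_sep sA) => u Uu.
  have [W [h [Wu e]]] := l u Uu; exists W, h; split=> //.
  rewrite mresZ -ev_res -hnat -bnat 2!mul_res -!mprod_res -hnat.
  apply: e => V h' v; have kh : V <<= U by move=> z /h' /h.
  by rewrite -!map_comp !(eq_map (mres_comp h h' kh)) !(mres_comp h h' kh) H.
- move=> U w w' s f c _.
  by rewrite !hom_zero Defs.mul0r Defs.mul0l bil0l ev0r scale0r.
- move=> U a x y ex ey w w' s f c H.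
  rewrite hlin mul_linr mul_linl blinl (ex _ _ _ _ _ H) (ey _ _ _ _ _ H) hlin ev_linr.
  by rewrite scalerDl scalerA.
- move=> U V h _ [v ->] w w' s f c H.
  have -> : mres h (sq v) = sq (mres h v).
    apply: spval_inj; apply: spval_inj.
    by apply: (etrans (mul_res h (tin E U v) (tin E U v))); rewrite -!hnat.
  rewrite (q2_sq Bs hL) S2in_sq.
  have := H V (@sub_refl _ V) (mres h v).
  rewrite !(eq_map (mres_id _)) !map_id !mres_id => <-.
  by rewrite -talg_pairingE mprod_cat /= !mulA.
Qed.

Lemma I2_res : res_stable (@I2 _ _ _ _ q).
Proof.
move=> U V h x [s [es ->]]; exists (mres h s).
by rewrite hnat es mres0.
Qed.

(** No generators of the kernel of [q2] are at hand, so [x] is left as it is, and [y], [z] and [t]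
    are reduced to words. For words the value depends on [x] only through [q2], by [pairing_square]
    and [talg_pairing_S2]. *)
Lemma talg_pairing_ideal U (x y z : talg E U) (t : talg (dual L) U) :
  I2 q x -> talg_pairing U (mul (mul y x) z) t = 0.
Proof.
have H1 : forall U (t : talg (dual L) U) (y z x : talg E U),
    is_word y -> is_word z -> I2 q x -> talg_pairing U (mul (mul y x) z) t = 0.
  apply: (gen_ind (@gens_talg _ _ (dual L))).
  - move=> V s l y' z' x' wy wz Ix; apply: (sheaf_sep sA) => u Vu.
    have [W [h [Wu e]]] := l u Vu; exists W, h; split=> //.
    rewrite mres0 -bnat 2!mul_res; apply: e; [exact: is_word_res|exact: is_word_res|].
    exact: I2_res.
  - by move=> V y' z' x' _ _ _; rewrite bil0r.
  - move=> V a s s' e e' y' z' x' wy wz Ix.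
    by rewrite blinr e // e' // scaler0 addr0.
  - move=> V W h _ [s ->] _ _ x' [w ->] [w' ->] [r [er ->]].
    have [f [c H]] := pairing_square w w' (map (mres h) s).
    by rewrite -mprod_res (talg_pairing_S2 _ H) er ev0r scale0r.
move: U y z t x.
suff H2 : forall U (y z : talg E U) (x : talg E U) (t : talg (dual L) U),
    I2 q x -> talg_pairing U (mul (mul y x) z) t = 0.
  by move=> U y z t x; exact: H2.
apply: (gen_ind2 (@gens_talg _ _ E) (@gens_talg _ _ E) (@is_word_res _ _ E)
  (@is_word_res _ _ E)).
- move=> U y z l x t Ix; apply: (sheaf_sep sA) => u Uu.
  have [W [h [Wu e]]] := l u Uu; exists W, h; split=> //.
  by rewrite mres0 -bnat 2!mul_res; apply: e; exact: I2_res.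
- by move=> U z x t _; rewrite !Defs.mul0l bil0l.
- by move=> U z x t _; rewrite !Defs.mul0r bil0l.
- by move=> U a y y' z e e' x t Ix; rewrite !mul_linl blinl e // e' // scaler0 addr0.
- by move=> U a y z z' e e' x t Ix; rewrite mul_linr blinl e // e' // scaler0 addr0.
- by move=> U y z wy wz x t; exact: H1.
Qed.

Definition B_pairing : bil (B q) (talg (dual L)) A :=
  quo_bil sA (fun U j y z t => @talg_pairing_ideal U j y z t) I2_res.

Lemma B_pairingE U (w : seq (E U)) (s : seq (dual L U)) :
  B_pairing U (mprod (Bin q) w) (mprod (tin (dual L)) s) = pairing w s.
Proof.
rewrite -talg_pairingE mprod_Bin.
exact: (quo_bilE sA (fun U j y z t => @talg_pairing_ideal U j y z t) I2_res).
Qed.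

End Pairing.

(** * The isomorphism *)

Section PairingSquare.
Variables (X : topologicalType) (O : rpsh X) (E L : mpsh O) (q : quad_form E L).
Variables (A : alg O) (sA : is_sheaf A) (k : hom (EEL E L) A).
Hypothesis kq : clifford_map q k.
Variables (B T : alg O) (jB : hom E B) (jT : hom (dual L) T) (z : hom L B).
Hypothesis z_q : forall U (v : E U), z U (q U v) = mul (jB U v) (jB U v).
Hypothesis gL : @gens X O L (fun U l => exists v, l = q U v).
Variable b : bil B T A.
Hypothesis bE : forall U (w : seq (E U)) s,
  b U (mprod jB w) (mprod jT s) = pairing k w s.
Implicit Types (U V W : opn X).

(** On words with [l = q v], the left side pairs [w ++ [:: v; v]] with [s ++ [:: f]]. The degrees
    [m.*2] and [m] match, so the last factor splits off and is [f(q v)] by the first Clifford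
    relation. This gives compatibility with [tau]. *)
Lemma pairing_square_last m U (x : deg jB m.*2 U) (t : deg jT m U)
    (l : L U) (f : dual L U) :
  b U (mul (spval x) (z U l)) (mul (spval t) (jT U f)) =
  ev f l *: b U (spval x) (spval t).
Proof.
have H1 : forall U (l : L U) (x : deg jB m.*2 U) (t : deg jT m U) (f : dual L U),
    is_dprod x -> is_dprod t ->
    b U (mul (spval x) (z U l)) (mul (spval t) (jT U f)) =
    ev f l *: b U (spval x) (spval t).
  apply: (gen_ind gL).
  - move=> V r H c psi g dc dpsi; apply: (sheaf_sep sA) => u Vu.
    have [W [h [Wu e]]] := H u Vu; exists W, h; split=> //.
    rewrite mresZ -ev_res -!bnat !mul_res -!hnat -!mres_span.
    by apply: e; exact: is_dprod_res.
  - by move=> V c psi g _ _; rewrite hom_zero Defs.mul0r bil0l ev0r scale0r.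
  - move=> V a r r' e e' c psi g dc dpsi.
    by rewrite hlin mul_linr blinl e // e' // ev_linr scalerDl scalerA.
  - move=> V W h _ [v ->] c psi g [w sw ec] [s ss epsi].
    rewrite -qnat z_q ec epsi -mprod_cat2 -mprod_cat1 !bE pairing_cat ?sw ?ss //=.
    by rewrite mul_oner /ke kq.1 mulZr mul_oner.
move: U x t l f.
apply: (gen_ind2 (@gens_deg _ _ _ _ jB m.*2) (@gens_deg _ _ _ _ jT m)
  (@is_dprod_res _ _ _ _ jB m.*2) (@is_dprod_res _ _ _ _ jT m)).
- move=> U x t H l f; apply: (sheaf_sep sA) => u Uu.
  have [W [h [Wu e]]] := H u Uu; exists W, h; split=> //.
  by rewrite mresZ -ev_res -!bnat !mul_res -!hnat -!mres_span e.
- move=> U t l f; have e : spval (0 : deg jB m.*2 U) = 0 by [].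
  by rewrite e Defs.mul0l !bil0l scaler0.
- move=> U x l f; have e : spval (0 : deg jT m U) = 0 by [].
  by rewrite e Defs.mul0l !bil0r scaler0.
- move=> U a x x' t e e' l f.
  have es : spval (a *: x + x') = a *: spval x + spval x' by [].
  by rewrite es mul_linl !blinl e e' scalerDr !scalerA mulrC.
- move=> U a x t t' e e' l f.
  have es : spval (a *: t + t') = a *: spval t + spval t' by [].
  by rewrite es mul_linl !blinr e e' scalerDr !scalerA mulrC.
- by move=> U x t dx dt l f; exact: H1.
Qed.

End PairingSquare.

(** * The map out of the colimit *)

Section FromB0.
Variables (X : topologicalType) (O : rpsh X) (E L : mpsh O) (q : quad_form E L).
Variable Bs : B2_sequence q.
Hypothesis hL : line_bundle L.
Variables (A : alg O) (sA : is_sheaf A) (k : hom (EEL E L) A).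
Hypothesis kq : clifford_map q k.
Implicit Types (U V W : opn X).

Let beta := B_pairing sA kq Bs hL.

Definition F_pairing m : bil (Bdeg q m.*2) (Tdual L m) A :=
  bil_precompl (bil_precompr beta (span_incl _)) (span_incl _).

Lemma F_pairing_dprod m U (b : Bdeg q m.*2 U) (phi : Tdual L m U) w s :
  spval b = mprod (Bin q) w -> spval phi = mprod (tin (dual L)) s ->
  F_pairing m U b phi = pairing k w s.
Proof. by move=> eb ephi; rewrite -(B_pairingE sA kq Bs hL) -eb -ephi. Qed.

Lemma F_pairing_iota m U (b : Bdeg q m.*2 U) (phi : Tdual L m U) (l : L U) (f : dual L U) :
  beta U (mul (spval b) (iB Bs U l)) (mul (spval phi) (tin (dual L) U f)) =
  ev f l *: F_pairing m U b phi.
Proof.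
exact: (pairing_square_last sA kq (iB_q Bs hL) (gens_L Bs hL)
  (B_pairingE sA kq Bs hL) b phi).
Qed.

Lemma F_pairing_tau m U (x : F q m U) :
  tens_hom sA (F_pairing m.+1) U (tau Bs m U x) = tens_hom sA (F_pairing m) U x.
Proof.
apply: (hom_ext (f := comp_hom (tens_hom sA (F_pairing m.+1)) (tau Bs m))
  (g := tens_hom sA (F_pairing m)) sA (gens_paired_tensor hL (P := _) (Q := _))).
move=> {x}U _ [b [phi [l [f [p ->]]]]].
apply: (etrans (congr1 (tens_hom sA (F_pairing m.+1) U) (tau_pair Bs hL b phi p))).
apply: (etrans (tens_homE _ _ _ _)); apply: (etrans _ (esym (tens_homE _ _ _ _))).
have := F_pairing_iota b phi l f; rewrite p scale1r => <-.
exact: (congr1 (fun z => beta U _ (mul _ z)) (spval_dgen (tin (dual L)) f)).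
Qed.

Definition B0_hom : hom (B0 Bs) A := colim_hom sA F_pairing_tau.

Lemma B0_homE m U (b : Bdeg q m.*2 U) (phi : Tdual L m U) w s :
  spval b = mprod (Bin q) w -> spval phi = mprod (tin (dual L)) s ->
  B0_hom U (B0in Bs b phi) = pairing k w s.
Proof.
move=> eb ephi; apply: (etrans (colim_homE _ _ _)).
by apply: (etrans (tens_homE _ _ _ _)); exact: F_pairing_dprod.
Qed.

End FromB0.

(** * The map from C_0 to B_0, and the two composites *)

Section Isomorphism.
Variables (X : topologicalType) (O : rpsh X) (E L : mpsh O) (q : quad_form E L).
Variable Bs : B2_sequence q.
Hypothesis hL : line_bundle L.
Implicit Types (U V W : opn X).

Let A0 : alg O := Alg (B0_alg Bs hL).
Let sA0 : is_sheaf A0 := @B0_is_sheaf _ _ _ _ _ Bs.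

Definition even_bil : bil (tens E E) (dual L) (B0 Bs) :=
  bil_precompl (bil_precompr (B0in_bil Bs 1) (dgen_hom (tin (dual L))))
    (tens_hom (span_is_sheaf (@quo_is_sheaf _ _ _ _)) (dgen2_bil (Bin q))).

Definition even_hom : hom (EEL E L) (B0 Bs) :=
  tens_hom (@B0_is_sheaf _ _ _ _ _ Bs) even_bil.

Lemma even_homE U (u v : E U) (f : dual L U) :
  even_hom U (evenT u v f) =
  B0in Bs (dgen2_bil (Bin q) U u v : Bdeg q 1.*2 U) (dgen (tin (dual L)) f : Tdual L 1 U).
Proof.
apply: (etrans (tens_homE _ _ _ _)).
exact: (congr1 (fun z : Bdeg q 1.*2 U =>
  B0in Bs z (dgen (tin (dual L)) f : Tdual L 1 U)) (tens_homE _ _ u v)).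
Qed.

Let ev2 U (u v : E U) : Bdeg q 1.*2 U := dgen2_bil (Bin q) U u v.
Let dg U (f : dual L U) : Tdual L 1 U := dgen (tin (dual L)) f.

Let spval_ev2 U (u v : E U) : spval (ev2 u v) = mul (Bin q U u) (Bin q U v).
Proof. exact: spval_dgen2. Qed.

Let spval_dg U (f : dual L U) : spval (dg f) = tin (dual L) U f.
Proof. exact: spval_dgen. Qed.

(** In [B] the square of [v] is [1] times the image of [q v], so [v v (x) f] is the transition image
    of [f(q v)] times the unit, from level [0] to level [1]. *)
Lemma even_hom_sq U (v : E U) (f : dual L U) :
  even_hom U (evenT v v f) = ev f (q U v) *: B0_one Bs U.
Proof.
have e : B0in Bs (ev2 v v) (dg f) = ev f (q U v) *: B0_one Bs U.
  apply: (etrans _ (esym (B0in_ev Bs hL _ _ (q U v) f))); apply: B0in_eq => //.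
    by rewrite spval_ev2 -(iB_q Bs hL); exact: (esym (mul_onel _)).
  exact: (esym (mul_onel _)).
exact: (etrans (even_homE v v f) e).
Qed.

Let B_mid U (u v w : E U) :
  mul (spval (ev2 u v)) (spval (ev2 v w)) = mul (spval (ev2 u w)) (iB Bs U (q U v)).
Proof.
by rewrite !spval_ev2; exact: (Bin_mid Bs hL).
Qed.

Let T_mid U (f g : dual L U) :
  mul (spval (dg f)) (spval (dg g)) = mul (spval (dg g)) (spval (dg f)).
Proof. by rewrite !spval_dg; exact: tin_dual_comm. Qed.

(** The product is [u v v w (x) f g]; its inner square becomes [q v] and moves to the right by
    centrality. [f] has to move past [g] as well, since the transition map appends both new factors
    at the end. *)
Let ev2_mul U (u v w : E U) (f g : dual L U) :
  B0_mul Bs hL U (B0in Bs (ev2 u v) (dg f)) (B0in Bs (ev2 v w) (dg g)) =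
  ev f (q U v) *: B0in Bs (ev2 u w) (dg g).
Proof.
rewrite B0_mulE (B0in_ev Bs hL).
apply: B0in_eq; first by [].
  by rewrite !spval_dmul; exact: B_mid.
by rewrite !spval_dmul; exact: T_mid.
Qed.

Lemma even_hom_mid U (u v w : E U) (f g : dual L U) :
  B0_mul Bs hL U (even_hom U (evenT u v f)) (even_hom U (evenT v w g)) =
  ev f (q U v) *: even_hom U (evenT u w g).
Proof.
have := ev2_mul u v w f g.
by rewrite -(even_homE u v f) -(even_homE v w g) -(even_homE u w g).
Qed.

Lemma even_clifford : clifford_map q (even_hom : hom (EEL E L) A0).
Proof.
by split=> [U v f|U u v w f g]; [exact: even_hom_sq|exact: even_hom_mid].
Qed.

Let psi : hom (C0 q) A0 := C0_hom sA0 even_clifford.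
Let phi : hom A0 (C0 q) := B0_hom Bs hL (@C0_is_sheaf _ _ _ _ q) (C0in_clifford q).

(** A pairing with values in C_0 is a product of generators. [psi] sends each factor to a class of
    level [1], and the product of B_0 assembles these classes in level [m]. *)
Lemma psi_pairing m U (w : seq (E U)) (s : seq (dual L U))
    (b : Bdeg q m.*2 U) (t : Tdual L m U) :
  size w = m.*2 -> size s = m ->
  spval b = mprod (Bin q) w -> spval t = mprod (tin (dual L)) s ->
  psi U (pairing (C0in q) w s) = B0in Bs b t.
Proof.
elim: m w s b t => [|m IH] [|u [|v w]] [|f s] // b t.
  by move=> _ _ eb et; apply: (etrans (C0_hom1 _ _ _)); apply: B0in_eq.
move=> [sw] [ss] eb et; apply: (etrans (C0_homM _ _ _ _)).
apply: (etrans (congr2 (fun y z => B0_mul Bs hL U y z)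
  (etrans (C0_hom_in sA0 even_clifford _) (even_homE u v f))
  (IH w s (dprod (Bin q) sw) (dprod (tin (dual L)) ss) sw ss erefl erefl))).
apply: (etrans (B0_mulE _ _ _ _ _ _)); apply: B0in_eq => //.
  rewrite eb; apply: (etrans (congr1 (fun z => mul z _) (spval_dgen2 (Bin q) u v))).
  exact: (esym (mulA _ _ _)).
rewrite et; exact: (congr1 (fun z => mul z _) (spval_dgen (tin (dual L)) f)).
Qed.

Lemma phiK U (x : B0 Bs U) : psi U (phi U x) = x.
Proof.
apply: (hom_ext (f := comp_hom psi phi) (g := id_hom (B0 Bs)) sA0 (@gens_B0 _ _ _ _ _ Bs)).
move=> {x}U _ [m [b [t [[w sw eb] [s ss et] ->]]]].
apply: (etrans (congr1 (psi U) (B0_homE Bs hL _ _ eb et))).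
exact: psi_pairing.
Qed.

Lemma phi1 U : phi U (B0_one Bs U) = one (C0 q) U.
Proof. exact: (@B0_homE _ _ _ _ _ Bs hL _ _ _ _ 0 U _ _ [::] [::]). Qed.

(** Compatibility of [phi] with left multiplication by the image of one generator. As C_0 is
    generated by words, this carries the induction in [psiK], and multiplicativity of the
    isomorphism itself comes from [psi]. *)
Lemma phi_mul U (x : EEL E L U) (y : B0 Bs U) :
  phi U (B0_mul Bs hL U (even_hom U x) y) = mul (C0in q U x) (phi U y).
Proof.
apply: (bil_ext (b := bil_postcomp phi (bil_precompl (B0_mul Bs hL) even_hom))
  (b' := bil_precompl (bil_precompr (mul_bil (C0 q)) phi) (C0in q)) (@C0_is_sheaf _ _ _ _ q)
  (@gens_evenT _ _ E L) (@gens_B0 _ _ _ _ _ Bs) (@is_evenT_res _ _ E L)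
  (@is_B0word_res _ _ _ _ _ Bs)).
move=> {x y}U _ _ [u [v [f ->]]] [m [b [t [[w sw eb] [s ss et] ->]]]].
apply: (etrans (congr1 (fun z => phi U (B0_mul Bs hL U z _)) (even_homE u v f))).
apply: (etrans (congr1 (phi U) (B0_mulE _ _ _ _ _ _))).
apply: (etrans (@B0_homE _ _ _ _ _ Bs hL _ _ _ _ _ _ _ _ (u :: v :: w) (f :: s) _ _)).
- rewrite spval_dmul eb.
  apply: (etrans (congr1 (fun z => mul z _) (spval_dgen2 (Bin q) u v))).
  exact: (esym (mulA _ _ _)).
- rewrite spval_dmul et.
  exact: (congr1 (fun z => mul z _) (spval_dgen (tin (dual L)) f)).
- exact: (congr1 (mul _) (esym (B0_homE Bs hL _ _ eb et))).
Qed.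

Lemma psiK U (x : C0 q U) : phi U (psi U x) = x.
Proof.
apply: (hom_ext (f := comp_hom phi psi) (g := id_hom (C0 q)) (@C0_is_sheaf _ _ _ _ q)
  (@gens_C0 _ _ _ _ q)).
move=> {x}U _ [w ->]; elim: w => [|x w IH].
  exact: (etrans (congr1 (phi U) (C0_hom1 _ _ _)) (phi1 U)).
apply: (etrans (congr1 (phi U) (C0_homM _ _ _ _))).
apply: (etrans (congr1 (fun z => phi U (B0_mul Bs hL U z _))
  (C0_hom_in sA0 even_clifford x))).
apply: (etrans (phi_mul _ _)).
exact: (congr1 (mul _) IH).
Qed.

Lemma C0_B0_iso : alg_iso (C0 q) A0.
Proof.
exists psi; split=> [U|U|U x y].
- by exists (phi U); [exact: psiK|exact: phiK].
- exact: C0_hom1.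
- exact: C0_homM.
Qed.

End Isomorphism.

Theorem propositionA1 (S : scheme) (n : nat) (E L : mpsh (OS S))
    (hE : vector_bundle n E) (hL : line_bundle L) (q : quad_form E L)
    (Bs : B2_sequence q) :
  exists2 s : alg_struct (B0 Bs),
    induced_from_B s & alg_iso (C0 q) (Alg s).
Proof.
exists (B0_alg Bs hL); first exact: B0_alg_induced.
exact: C0_B0_iso.
Qed.
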